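(* Let $d\ge 2$ be an integer and $0<\sigma<\frac d2$. For each admissible growth function $\Theta$, there exist a divergence-free vector field $u=u(x,t)$ on $\mathbb{R}^d\times[0,\infty)$ with modulus of continuity $\varphi_\Theta$ (that is, there is $C>0$ with $|u(x,t)-u(y,t)|\le C\varphi_\Theta(|x-y|)$ for all $x,y\in\mathbb{R}^d$, $t\ge 0$) and an initial datum $\theta_0\in H^\sigma(\mathbb{R}^d)$ such that the solution $\theta$ of the transport equation $\partial_t\theta+u\cdot\nabla_x\theta=0$, $\theta(0,\cdot)=\theta_0$, satisfies $\theta(t)\notin H^s(\mathbb{R}^d)$ for every $t>0$ and every $s>0$.
   Context: Admissible growth function: a function $\Theta:[1,\infty)\to(0,\infty)$ that is differentiable, increasing, satisfies $\lim_{x\to\infty}\Theta(x)=\infty$, and for which there are constants $M>1$, $C>0$ such that (1) $\Theta(xy)\le\Theta(x)+\Theta(y)+C$ for all $x,y\ge M$, and (2) $x\Theta'(x)\le C\,\Theta(x)$ for all $x>M$. Associated modulus of continuity: $\varphi_\Theta:[0,\infty)\to[0,\infty)$, $\varphi_\Theta(0)=0$, $\varphi_\Theta(r)=r\log(e/r)\,\Theta(\log(e/r))$ for $0<r<e^{-2}$, and $\varphi_\Theta(r)=3e^{-2}\Theta(3)$ for $r\ge e^{-2}$. It satisfies the Osgood condition $\int_0^{e^{-2}}\frac{dr}{\varphi_\Theta(r)}=\infty$. Solution: for a divergence-free field with an Osgood modulus of continuity, the ODE $\frac{d}{dt}\phi(x,t)=u(\phi(x,t),t)$, $\phi(x,0)=x$,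 has a unique solution (flow), and the transport equation has a unique integrable weak solution, given by $\theta(x,t)=\theta_0(\phi^{-1}(x,t))$, where $\phi^{-1}(\cdot,t)$ is the inverse of $\phi(\cdot,t)$. This is the solution meant. *)

(* Defs.v *)
From HB Require Import structures.
From mathcomp Require Import all_boot all_order all_algebra.
From mathcomp Require Import all_classical all_reals all_analysis.

Set Implicit Arguments.
Unset Strict Implicit.
Unset Printing Implicit Defensive.

Import Order.TTheory GRing.Theory Num.Theory.
Import numFieldNormedType.Exports.

Local Open Scope classical_set_scope.
Local Open Scope ring_scope.

(* The sigma-algebra on 'rV[R]_n generated by the coordinate projections, that
   is, the Borel sigma-algebra of R^n. *)
Definition rV_display : measure_display. Proof. exact: default_measure_display. Qed.

Section rV_measurable.
Context {R : realType} {n : nat}.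

Let coor (i : 'I_n) (x : 'rV[R]_n) : measurableTypeR R := x 0 i.

Let rV_set0 : g_sigma_preimage coor set0.
Proof. exact: sigma_algebra0. Qed.

Let rV_setC A : g_sigma_preimage coor A -> g_sigma_preimage coor (~` A).
Proof. exact: sigma_algebraC. Qed.

Let rV_bigcup (F : _^nat) : (forall i, g_sigma_preimage coor (F i)) ->
  g_sigma_preimage coor (\bigcup_i (F i)).
Proof. exact: sigma_algebra_bigcup. Qed.

HB.instance Definition _ := @isMeasurable.Build rV_display
  'rV[R]_n (g_sigma_preimage coor) rV_set0 rV_setC rV_bigcup.

Lemma measurable_rV_coor (i : 'I_n) :
  measurable_fun [set: 'rV[R]_n] (fun x => x 0%R i : measurableTypeR R).
Proof.
move=> _ Y mY; rewrite setTI; apply: sub_sigma_algebra => /=.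
rewrite -bigcup_seq/=; exists i => /=; first by rewrite mem_index_enum.
by exists Y => //; rewrite setTI.
Qed.

Lemma measurable_fun_rV d (T : measurableType d) (f : T -> 'rV[R]_n) :
  (forall i, measurable_fun [set: T] (fun x => f x 0 i : measurableTypeR R)) ->
  measurable_fun [set: T] f.
Proof.
move=> mf; apply: (measurability (\bigcup_(i in [set: 'I_n])
    preimage_set_system setT (coor i) measurable)).
  by congr (<<s _ >>); rewrite -bigcup_seq; apply: eq_bigcupl; split => i //=;
    rewrite mem_index_enum.
move=> _ [_ [i _ [B mB <-]] <-].
by have := mf i measurableT B mB; rewrite !setTI.
Qed.

End rV_measurable.

Definition rVcons {R : realType} {n : nat} (p : measurableTypeR R * 'rV[R]_n) :
  'rV[R]_n.+1 := row_mx (p.1)%:M p.2.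

Lemma rVcons0 {R : realType} {n : nat} (p : measurableTypeR R * 'rV[R]_n) :
  rVcons p 0 0 = p.1.
Proof.
have E : (0 : 'I_n.+1) = lshift n (0 : 'I_1) by exact/val_inj.
by rewrite /rVcons E (row_mxEl (p.1)%:M p.2) mxE.
Qed.

Lemma rVconsS {R : realType} {n : nat} (p : measurableTypeR R * 'rV[R]_n) i :
  rVcons p 0 (lift ord0 i) = p.2 0 i.
Proof.
have E : lift ord0 i = rshift 1 i by exact/val_inj.
by rewrite /rVcons E (row_mxEr (p.1)%:M p.2).
Qed.

Lemma measurable_rVcons {R : realType} {n : nat} :
  measurable_fun setT (@rVcons R n).
Proof.
apply: measurable_fun_rV => i; have [j ->|->] := unliftP 0 i; last first.
  rewrite (_ : (fun _ => _) = fst); first exact: measurable_fst.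
  by apply/funext => p; rewrite rVcons0.
rewrite (_ : (fun _ => _) = (fun v : 'rV[R]_n => v 0 j : measurableTypeR R) \o snd).
  by apply: measurableT_comp; [exact: measurable_rV_coor|exact: measurable_snd].
by apply/funext => p; rewrite rVconsS.
Qed.

Section lebesgue_rV_step.
Local Open Scope ereal_scope.
Context {R : realType} {n : nat}.
Variable m : {sigma_finite_measure set 'rV[R]_n -> \bar R}.

Definition lebesgue_rV_step : set 'rV[R]_n.+1 -> \bar R :=
  pushforward (@lebesgue_measure R \x m) (@rVcons R n).

Let step0 : lebesgue_rV_step set0 = 0.
Proof. by rewrite /lebesgue_rV_step /pushforward preimage_set0 measure0. Qed.

Let step_ge0 A : 0 <= lebesgue_rV_step A.
Proof. by rewrite /lebesgue_rV_step /pushforward measure_ge0. Qed.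

Let step_sigma_additive : semi_sigma_additive lebesgue_rV_step.
Proof.
have mc B : measurable B -> measurable (@rVcons R n @^-1` B).
  by move=> mB; rewrite -[X in measurable X]setTI; exact: measurable_rVcons.
move=> F mF tF mUF; rewrite /lebesgue_rV_step /pushforward preimage_bigcup.
apply: measure_semi_sigma_additive.
- by move=> k; exact: mc.
- apply/trivIsetP => /= i j _ _ ij; rewrite -preimage_setI.
  by move/trivIsetP : tF => /(_ _ _ _ _ ij) ->//; rewrite preimage_set0.
- by rewrite -preimage_bigcup; exact: mc.
Qed.

HB.instance Definition _ := isMeasure.Build _ _ _ lebesgue_rV_step
  step0 step_ge0 step_sigma_additive.

Let step_sigma_finite : sigma_finite setT lebesgue_rV_step.
Proof.
have [F FT Foo] : sigma_finite setT (@lebesgue_measure R \x m).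
  have /sigma_finiteP[F [TF ndF Foo]] := sigma_finiteT (@lebesgue_measure R).
  have /sigma_finiteP[G [TG ndG Goo]] := sigma_finiteT m.
  exists (fun k => F k `*` G k).
    rewrite -setXTT TF TG predeqE => -[x y]; split.
      move=> [/= [i _ Fx] [j _ Gy]]; exists (maxn i j) => //; split.
      - by move: x Fx; exact/subsetPset/ndF/leq_maxl.
      - by move: y Gy; exact/subsetPset/ndG/leq_maxr.
    by move=> [i _ []/= ? ?]; split; exists i.
  move=> k; have [? ?] := Foo k; have [? ?] := Goo k.
  split; first exact: measurableX.
  by rewrite product_measure1E// lte_mul_pinfty// ge0_fin_numE.
pose g (v : 'rV[R]_n.+1) : measurableTypeR R * 'rV[R]_n :=
  (v ord0 ord0, @rsubmx _ 1 1 n v).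
have mg : measurable_fun setT g.
  apply/measurable_fun_pairP; split; first exact: measurable_rV_coor.
  apply: measurable_fun_rV => i.
  rewrite (_ : (fun _ => _) =
      fun v : 'rV[R]_n.+1 => v ord0 (rshift 1 i) : measurableTypeR R).
    exact: measurable_rV_coor.
  by apply/funext => v; rewrite mxE.
have gK p : g (rVcons p) = p.
  by rewrite /g rVcons0 /rVcons row_mxKr; case: p.
exists (fun k => g @^-1` F k).
  by rewrite -preimage_bigcup -FT preimage_setT.
move=> k; have [mFk Fk] := Foo k; split.
  by rewrite -[X in measurable X]setTI; exact: mg.
rewrite /lebesgue_rV_step /pushforward.
rewrite (_ : _ @^-1` _ = F k)//.
by apply/seteqP; split => p /=; rewrite gK.
Qed.

HB.instance Definition _ := Measure_isSigmaFinite.Build _ _ _ lebesgue_rV_step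
  step_sigma_finite.

End lebesgue_rV_step.

(* Lebesgue measure on R^n, as the n-fold product of Lebesgue measure on R. *)
Fixpoint lebesgue_rV (R : realType) (n : nat) :
    {sigma_finite_measure set 'rV[R]_n -> \bar R} :=
  match n return {sigma_finite_measure set 'rV[R]_n -> \bar R} with
  | 0%N => dirac (0 : 'rV[R]_0)
  | k.+1 => lebesgue_rV_step (lebesgue_rV R k)
  end.

Section lebesgue_rV_theory.
Local Open Scope ereal_scope.

Lemma lebesgue_rV_box (R : realType) (n : nat)
    (A : 'I_n -> set (measurableTypeR R)) : (forall i, measurable (A i)) ->
  lebesgue_rV R n [set x | forall i, A i (x ord0 i)] =
  \prod_(i < n) lebesgue_measure (A i).
Proof.
elim: n A => [|n IH] A mA.
  rewrite big_ord0 /= diracE mem_set// => -[].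
  by move=> i /=; case: i.
rewrite big_ord_recl /= /lebesgue_rV_step /pushforward.
rewrite (_ : _ @^-1` _ =
    A ord0 `*` [set x : 'rV[R]_n | forall i, A (lift ord0 i) (x ord0 i)]).
  rewrite product_measure1E//; first by
    rewrite (IH (fun i => A (lift ord0 i))).
  rewrite (_ : [set x | _] = \bigcap_(i in [set: 'I_n])
      ((fun x : 'rV[R]_n => x ord0 i) @^-1` A (lift ord0 i))).
    apply: fin_bigcap_measurable => // i _.
    by rewrite -[X in measurable X]setTI; exact: measurable_rV_coor.
  by apply/seteqP; split => x /= h; [move=> i _; exact: h|move=> i; exact: h].
apply/seteqP; split => p /=.
  by move=> h; split => [|i]; [rewrite -rVcons0|rewrite -rVconsS]; exact: h.
move=> [h0 hL] i; have [j ->|->] := unliftP ord0 i; first by rewrite rVconsS.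
by rewrite rVcons0.
Qed.

End lebesgue_rV_theory.

(* Theta : [1, oo) -> (0, oo) is represented by a total function of which only
   the values on [1, oo) matter; differentiability at 1 is one-sided. *)
Definition admissible_growth (R : realType) (Theta : R -> R) : Prop :=
  [/\ forall x, 1 <= x -> 0 < Theta x,
      (forall x, 1 < x -> derivable Theta x 1) /\
        cvg (h^-1 * (Theta (1 + h) - Theta 1) @[h --> (0 : R)^'+]),
      forall x y, 1 <= x -> x <= y -> Theta x <= Theta y,
      Theta x @[x --> +oo] --> +oo &
      exists M C : R, [/\ 1 < M, 0 < C,
        forall x y, M <= x -> M <= y -> Theta (x * y) <= Theta x + Theta y + C &
        forall x, M < x -> x * 'D_1 Theta x <= C * Theta x]].

Definition phi_modulus (R : realType) (Theta : R -> R) (r : R) : R :=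
  if r <= 0 then 0
  else if r < expR (- 2) then
    r * ln (expR 1 / r) * Theta (ln (expR 1 / r))
  else 3 * expR (- 2) * Theta 3.

(* The library's norm on 'rV[R]_d is the sup norm; this is the Euclidean one. *)
Definition enorm (R : realType) (d : nat) (x : 'rV[R]_d) : R :=
  Num.sqrt (\sum_(i < d) x 0 i ^+ 2).

(* A time-dependent field u(x, t) is written [u t x]; only t >= 0 matters. *)
Definition has_modulus (R : realType) (d : nat) (omega : R -> R)
    (u : R -> 'rV[R]_d -> 'rV[R]_d) : Prop :=
  exists2 C : R, 0 < C & forall t x y, 0 <= t ->
    enorm (u t x - u t y) <= C * omega (enorm (x - y)).

Definition iter_derive (R : realType) (V : normedModType R) (f : V -> R)
    (vs : seq V) : V -> R :=
  foldr (fun v g => 'D_v g) f vs.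

Definition smooth (R : realType) (V : normedModType R) (f : V -> R) : Prop :=
  forall vs : seq V, continuous (iter_derive f vs) /\
    forall x v, derivable (iter_derive f vs) x v.

Definition test_function (R : realType) (V : normedModType R) (f : V -> R) :
    Prop :=
  smooth f /\ exists2 K : set V, compact K & forall x, ~ K x -> f x = 0.

(* The field is merely continuous in x, so its divergence is taken in the sense
   of distributions, at each time. *)
Definition divergence_free (R : realType) (d : nat)
    (u : R -> 'rV[R]_d -> 'rV[R]_d) : Prop :=
  forall t, 0 <= t -> forall psi : 'rV[R]_d -> R, test_function psi ->
    \int[lebesgue_rV R d]_x
      (\sum_(i < d) u t x 0 i * 'D_(delta_mx 0 i) psi x) = 0.

Section fourier.
Context {R : realType} {d : nat}.
Implicit Types (f : 'rV[R]_d -> R) (xi : 'rV[R]_d).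

Definition dotr (x y : 'rV[R]_d) : R := \sum_(i < d) x 0 i * y 0 i.

(* Real and imaginary parts of the integral of f(x) exp(-i x.xi) over the ball
   |x| <= n. *)
Definition fourier_re f (n : nat) xi : R :=
  \int[lebesgue_rV R d]_(x in [set x | enorm x <= n%:R]) (f x * cos (dotr x xi)).

Definition fourier_im f (n : nat) xi : R :=
  - \int[lebesgue_rV R d]_(x in [set x | enorm x <= n%:R])
      (f x * sin (dotr x xi)).

(* Plancherel's definition of the Fourier transform of f in L^2: the limit in
   L^2 of the transforms of the truncations of f to balls. *)
Definition is_fourier_transform f (Fre Fim : 'rV[R]_d -> R) : Prop :=
  [/\ Fre \in Lfun (lebesgue_rV R d) 2%:E,
      Fim \in Lfun (lebesgue_rV R d) 2%:E,
      'N[lebesgue_rV R d]_2%:E[(fun xi => (Fre xi - fourier_re f n xi)%:E)]%E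
        @[n --> \oo] --> 0%E &
      'N[lebesgue_rV R d]_2%:E[(fun xi => (Fim xi - fourier_im f n xi)%:E)]%E
        @[n --> \oo] --> 0%E].

(* H^s(R^d) for real-valued functions and s >= 0. *)
Definition sobolev (s : R) f : Prop :=
  f \in Lfun (lebesgue_rV R d) 2%:E /\
  exists Fre Fim : 'rV[R]_d -> R,
    [/\ is_fourier_transform f Fre Fim,
        (fun xi => (1 + enorm xi ^+ 2) `^ (s / 2) * Fre xi)
          \in Lfun (lebesgue_rV R d) 2%:E &
        (fun xi => (1 + enorm xi ^+ 2) `^ (s / 2) * Fim xi)
          \in Lfun (lebesgue_rV R d) 2%:E].

End fourier.

Section transport.
Context {R : realType} {d : nat}.
Local Notation leb_tx := (@lebesgue_measure R \x lebesgue_rV R d)%E.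
Implicit Types (u : R -> 'rV[R]_d -> 'rV[R]_d) (theta : R -> 'rV[R]_d -> R).

Definition measurable_field u : Prop :=
  measurable_fun ([set t : measurableTypeR R | 0 <= t] `*` [set: 'rV[R]_d])
    (fun p => u p.1 p.2).

(* The increment h ranges over t + h >= 0, so the derivative at t = 0 is
   one-sided. *)
Definition is_flow u (phi : R -> 'rV[R]_d -> 'rV[R]_d) : Prop :=
  forall x, phi 0 x = x /\
    forall t, 0 <= t ->
      h^-1 *: (phi (t + h) x - phi t x)
        @[h --> within [set h | 0 <= t + h] (0 : R)^'] --> u t (phi t x).

(* Integrable weak solutions of the Cauchy problem; div u = 0 is used to write
   the equation in divergence form, and the test functions on R^d x [0, oo) are
   the restrictions of test functions on the whole space-time. *)
Definition weak_solution u (theta0 : 'rV[R]_d -> R) theta : Prop :=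
  (forall T, 0 < T -> leb_tx.-integrable
     ([set t : measurableTypeR R | 0 <= t <= T] `*` [set: 'rV[R]_d])
     (fun p => (theta p.1 p.2)%:E)) /\
  forall psi : R * 'rV[R]_d -> R, test_function psi ->
    let D := [set t : measurableTypeR R | 0 <= t] `*` [set: 'rV[R]_d] in
    let F (p : measurableTypeR R * 'rV[R]_d) := theta p.1 p.2 *
      ('D_(1, 0) psi p +
       \sum_(i < d) u p.1 p.2 0 i * 'D_(0, delta_mx 0 i) psi p) in
    leb_tx.-integrable D (fun p => (F p)%:E) /\
    \int[leb_tx]_(p in D) F p +
      \int[lebesgue_rV R d]_x (theta0 x * psi (0, x)) = 0.

(* The weak solution transported by the flow. *)
Definition transport_solution u (theta0 : 'rV[R]_d -> R) theta : Prop :=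
  weak_solution u theta0 theta /\
  exists phi phiinv : R -> 'rV[R]_d -> 'rV[R]_d, is_flow u phi /\
    forall t, 0 <= t ->
      [/\ cancel (phi t) (phiinv t), cancel (phiinv t) (phi t) &
          forall x, theta t x = theta0 (phiinv t x)].

End transport.

(* Main.v *)
(** Put bumps 2^-k chi(x - p_k) at centres p_k going to infinity. In the time window
[2^-k-1, 2^-k] the k-th bump, and nothing else, is stirred by L_k alternating shears in the
plane of the first two coordinates, with sawtooth profiles of slope 4^k and period e^(-L_k);
the modulus of continuity allows this as soon as L_k is large in terms of k, because Theta is
unbounded. At any t > 0 infinitely many bumps have been stirred completely.

The loss of regularity is measured by V_z(f), the integral of |f(x + z) - f(x)|^2. Where the
sawtooth rises, the inverse of a shear turns the shift z into z' = z + 4^k z_j e_i; as four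
translates of the sawtooth rise on a cover of the line, one of them yields
V_z(f o shear^-1) >= V_z'(f) / 4. After L_k steps a shift of size about 4^(-k L_k) has become
one of size e^(-L_k), so V_z of the k-th piece is at least about C^(-L_k), whereas membership
in H^s forces V_z <= C |z|^(2 min(s,1)) uniformly in k, by a Plancherel inequality obtained
from the Fejer kernel.

The phases are disjoint in time and locally finite in space, so the flow is an explicit
composition of measure-preserving shears. Since the field is Lipschitz along bounded
trajectories, Gronwall's lemma identifies it with any other flow. *)
From HB Require Import structures.
Require Import Defs.
From mathcomp Require Import all_boot all_order all_algebra.
From mathcomp Require Import ring lra zify.
From mathcomp Require Import all_classical all_reals all_analysis measurable_realfun.
Set Implicit Arguments.
Unset Strict Implicit.
Unset Printing Implicit Defensive.
Import Order.TTheory GRing.Theory Num.Theory.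
Import numFieldNormedType.Exports.
Local Open Scope classical_set_scope.
Local Open Scope ring_scope.

(** At scale e^(-L) a log-Lipschitz field is no worse than a Lipschitz field of constant about L,
    which pays for L shears of bounded slope per unit time. With bounded slope the argument would
    exclude only exponents s above some threshold: the loss of a factor 4 per shear, and the
    doublings that bring the final shift to unit size, are exponential in L just like the
    amplification of the shift. To exclude every s > 0 the slope has to tend to infinity with the
    level. This is what an unbounded Theta pays for: slope 4^k within time 2^-k-1 costs a factor of
    order 8^k over the log-Lipschitz budget. As soon as k * min(s,1) >= 3 the amplification beats
    both losses.

    The obstacle to amplification is that an increment may sit on a descending tooth. Hence the
    translate of each sawtooth is selected by averaging, for the very function that it has to stir,
    and the field depends on the datum. The shifts before and after every shear are fixed
    beforehand, so these selections can be made in chronological order. *)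

Section continuity.
Context {R : realType} (T : topologicalType).
Implicit Types f g : T -> R.

Lemma continuous_composition (U V : topologicalType) (f : T -> U) (g : U -> V) :
  continuous f -> continuous g -> continuous (fun x => g (f x)).
Proof. by move=> cf cg x; apply: continuous_comp; [exact: cf|exact: cg]. Qed.

Lemma continuous_fD f g : continuous f -> continuous g -> continuous (fun x => f x + g x).
Proof. by move=> cf cg x; apply: cvgD; [exact: cf|exact: cg]. Qed.

Lemma continuous_fB f g : continuous f -> continuous g -> continuous (fun x => f x - g x).
Proof. by move=> cf cg x; apply: cvgB; [exact: cf|exact: cg]. Qed.

Lemma continuous_fM f g : continuous f -> continuous g -> continuous (fun x => f x * g x).
Proof. by move=> cf cg x; apply: cvgM; [exact: cf|exact: cg]. Qed.

Lemma continuous_fcst (c : R) : continuous (fun _ : T => c).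
Proof. by move=> x; exact: cvg_cst. Qed.

Lemma continuous_fsum I (s : seq I) (f : I -> T -> R) :
  (forall i, continuous (f i)) -> continuous (fun x => \sum_(i <- s) f i x).
Proof.
move=> cf; elim: s => [|i s IH].
  rewrite (_ : (fun _ => _) = fun=> 0); first exact: continuous_fcst.
  by apply/funext => x; rewrite big_nil.
rewrite (_ : (fun _ => _) = fun x => f i x + \sum_(j <- s) f j x).
  exact: continuous_fD.
by apply/funext => x; rewrite big_cons.
Qed.

Lemma continuous_fprod I (s : seq I) (f : I -> T -> R) :
  (forall i, continuous (f i)) -> continuous (fun x => \prod_(i <- s) f i x).
Proof.
move=> cf; elim: s => [|i s IH].
  rewrite (_ : (fun _ => _) = fun=> 1); first exact: continuous_fcst.
  by apply/funext => x; rewrite big_nil.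
rewrite (_ : (fun _ => _) = fun x => f i x * \prod_(j <- s) f j x).
  exact: continuous_fM.
by apply/funext => x; rewrite big_cons.
Qed.

End continuity.

(** * Changes of variables in Lebesgue integrals on R^n *)

Section rV_topology.
Context {R : realType}.

Lemma measurable_rV_ball n (c : 'rV[R]_n) (r : R) : 0 < r ->
  measurable (ball c r : set 'rV[R]_n).
Proof.
move=> r0.
rewrite (_ : ball c r = \bigcap_(i in [set: 'I_n])
    ((fun x : 'rV[R]_n => x ord0 i) @^-1` ball (c ord0 i) r)).
  apply: fin_bigcap_measurable => // i _.
  rewrite -[X in measurable X]setTI; apply: measurable_rV_coor => //.
  by rewrite ball_itv; exact: measurable_itv.
apply/seteqP; split => x /=.
  by move=> [_ h] i _; exact: h.
by move=> h; split=> // i j; rewrite (ord1 i); exact: h.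
Qed.

(** Balls of the sup norm are cubes, and those with rational centre and radius form a countable
    base; so an open set is a countable union of members of the sigma-algebra generated by the
    coordinates. *)
Lemma open_measurable_rV n (U : set 'rV[R]_n) : open U -> measurable U.
Proof.
move=> oU.
pose cen (q : n.-tuple rat * rat) : 'rV[R]_n := \row_i ratr (tnth q.1 i).
pose good := [set q : n.-tuple rat * rat | 0 < q.2 /\ ball (cen q) (ratr q.2) `<=` U].
rewrite (_ : U = \bigcup_(q in good) ball (cen q) (ratr q.2)).
  rewrite bigcup_mkcond; apply: countable_bigcupT_measurable => // q.
  by case: ifPn => // /set_mem[q0 _]; apply: measurable_rV_ball; rewrite ltr0q.
apply/seteqP; split => x; last by move=> [q [_ qU]]; exact: qU.
move=> Ux; have /nbhs_ballP[e /= e0 eU] : nbhs x U by exact: open_nbhs_nbhs.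
have [r /andP[r0 re]] : exists r : rat, 0 < (ratr r : R) < e / 2.
  have /rat_in_itvoo[r] : 0 < e / 2 by rewrite divr_gt0.
  by rewrite in_itv /=; exists r.
have H i : exists q : rat, `|x ord0 i - ratr q| < ratr r :> R.
  have /rat_in_itvoo[q] : x ord0 i < x ord0 i + ratr r by rewrite ltrDl.
  rewrite in_itv/= => /andP[q1 q2]; exists q.
  by rewrite distrC ger0_norm ?subr_ge0 1?ltW// ltrBlDl.
have [f fP] := choice H.
exists ([tuple f i | i < n], r).
  split => /=; first by rewrite -(ltr0q R).
  move=> y /= [_ qy]; apply: eU; split=> // i j; rewrite (ord1 i).
  have := qy ord0 j; rewrite mxE tnth_mktuple => qy1.
  rewrite /ball /= (le_lt_trans (ler_distD (ratr (f j)) _ _))//.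
  rewrite (splitr e) ltrD// (lt_trans _ re)//.
by split=> /=; [rewrite ltr0q -(ltr0q R)|move=> i j; rewrite (ord1 i) mxE tnth_mktuple /ball /= distrC; exact: fP].
Qed.

Lemma continuous_measurable_rV n (f : 'rV[R]_n -> R) : continuous f ->
  measurable_fun [set: 'rV[R]_n] (f : 'rV[R]_n -> measurableTypeR R).
Proof.
move=> /continuousP cf; apply: (measurability _ (RGenOpens.measurableE R)).
move=> _ [_ [a [b ->] <-]]; rewrite setTI; apply: open_measurable_rV.
exact/cf/interval_open.
Qed.

Lemma cvg_rV (T : Type) (F : set_system T) (FF : Filter F) n
    (f : T -> 'rV[R]_n) (l : 'rV[R]_n) :
  (forall i, (fun t => f t ord0 i) @ F --> l ord0 i) -> f @ F --> l.
Proof.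
move=> h; apply/cvg_ballP => e e0.
have : \forall t \near F, forall i : 'I_n, ball (l ord0 i) e (f t ord0 i).
  by apply: filter_forall => i; have /cvg_ballP := h i; exact.
by apply: filterS => t ht; split => // i j; rewrite (ord1 i).
Qed.

Lemma continuous_rV (T : topologicalType) n (f : T -> 'rV[R]_n) :
  (forall i, continuous (fun t => f t ord0 i)) -> continuous f.
Proof. by move=> h x; apply: cvg_rV => i; exact: h. Qed.

Lemma continuous_coord n (i : 'I_n) :
  continuous (fun x : 'rV[R]_n => x ord0 i).
Proof. exact: coord_continuous. Qed.

Definition rVtail n (x : 'rV[R]_n.+1) : 'rV[R]_n := \row_i x ord0 (lift ord0 i).

Lemma rVtail_rVcons n (p : measurableTypeR R * 'rV[R]_n) : rVtail (rVcons p) = p.2.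
Proof. by apply/rowP => i; rewrite mxE rVconsS. Qed.

Lemma continuous_rVtail n : continuous (@rVtail n).
Proof.
apply: continuous_rV => i.
rewrite (_ : (fun _ => _) = fun x : 'rV[R]_n.+1 => x ord0 (lift ord0 i)).
  exact: continuous_coord.
by apply/funext => x; rewrite mxE.
Qed.

(** Composition with [rVcons] reduces the claim to R^(n+1), where open sets are known to be
    measurable. *)
Lemma continuous_measurable_prod n (f : R * 'rV[R]_n -> R) : continuous f ->
  measurable_fun [set: measurableTypeR R * 'rV[R]_n]
    (f : measurableTypeR R * 'rV[R]_n -> measurableTypeR R).
Proof.
move=> cf.
pose g (x : 'rV[R]_n.+1) : R * 'rV[R]_n := (x ord0 ord0, rVtail x).
have cg : continuous (f \o g).
  move=> x; apply: continuous_comp; last exact: cf.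
  exact: (cvg_pair (@continuous_coord _ _ _) (@continuous_rVtail _ _)).
have -> : f = (f \o g) \o @rVcons R n.
  by apply/funext => -[a x]; rewrite /g /= rVcons0 rVtail_rVcons.
apply: measurableT_comp; last exact: measurable_rVcons.
exact: continuous_measurable_rV.
Qed.

End rV_topology.

Section rV_integral.
Context {R : realType}.
Local Notation leb := (@lebesgue_measure R).

Lemma measurable_rVcons_preimage n (A : set 'rV[R]_n.+1) : measurable A ->
  measurable (@rVcons R n @^-1` A).
Proof. by move=> mA; rewrite -[X in measurable X]setTI; exact: measurable_rVcons. Qed.

Section transfer.
Context d (T : measurableType d) (mu : {measure set T -> \bar R}).

(** The pushforward of [mu] under [f] is [c] times [mu]. Dilation by a > 0 has c = a^-n;
    translations, shears and the flow have c = 1. *)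
Definition measure_scaling (c : R) (f : T -> T) :=
  measurable_fun setT f /\
  forall A, measurable A -> mu (f @^-1` A) = (c%:E * mu A)%E.

Lemma ge0_integral_scaling c f (g : T -> \bar R) : 0 <= c -> measure_scaling c f ->
  measurable_fun setT g -> (forall x, 0 <= g x)%E ->
  (\int[mu]_x g (f x) = c%:E * \int[mu]_x g x)%E.
Proof.
move=> c0 [mf sf] mg g0.
rewrite -[c]/(NngNum c0)%:num -ge0_integral_mscale//.
rewrite -[LHS](@ge0_integral_pushforward _ _ _ _ _ f mf mu setT g)//.
by apply: eq_measure_integral => A mA _; exact: sf.
Qed.

Lemma integrable_scaling c f (g : T -> R) : 0 <= c -> measure_scaling c f ->
  mu.-integrable setT (EFin \o g) -> mu.-integrable setT (EFin \o (g \o f)).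
Proof.
move=> c0 sf /integrableP[mg ig]; apply/integrableP; split.
  by apply: (measurableT_comp mg); exact: sf.1.
rewrite (@ge0_integral_scaling c f (fun x => `|(g x)%:E|%E) c0)//.
  by rewrite lte_mul_pinfty// ?lee_fin.
exact: measurableT_comp.
Qed.

Lemma Rintegral_scaling c f (g : T -> R) : 0 <= c -> measure_scaling c f ->
  mu.-integrable setT (EFin \o g) ->
  \int[mu]_x g (f x) = c * \int[mu]_x g x.
Proof.
move=> c0 sf ig; have igf := integrable_scaling c0 sf ig.
have [mg _] := integrableP _ _ _ ig.
rewrite /Rintegral -[c in RHS]/(fine c%:E) -fineM//; last first.
  exact: integrable_fin_num.
congr fine; rewrite integralE [in RHS]integralE muleBr//; last first.
  by rewrite fin_num_adde_defr// (integrable_pos_fin_num _ ig).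
rewrite (funepos_comp (EFin \o g) f) (funeneg_comp (EFin \o g) f) /=.
rewrite -2?(ge0_integral_scaling c0 sf)//.
- exact: measurable_funeneg.
- exact: measurable_funepos.
Qed.

Lemma measure_scaling_comp f g :
  measure_scaling 1 f -> measure_scaling 1 g ->
  measure_scaling 1 (f \o g).
Proof.
move=> [mf sf] [mg sg]; split; first exact: measurableT_comp.
move=> A mA; rewrite comp_preimage sg ?mul1e ?sf ?mul1e//.
by rewrite -[X in measurable X]setTI; exact: mf.
Qed.

Lemma measure_scaling_id : measure_scaling 1 id.
Proof. by split => // A _; rewrite mul1e. Qed.

End transfer.

Lemma measure_scaling_prod d1 d2 (T1 : measurableType d1) (T2 : measurableType d2)
    (m1 : {sigma_finite_measure set T1 -> \bar R})
    (m2 : {sigma_finite_measure set T2 -> \bar R})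
    (c1 c2 : R) (f1 : T1 -> T1) (f2 : T2 -> T2) :
  0 < c1 -> 0 < c2 ->
  measure_scaling m1 c1 f1 -> measure_scaling m2 c2 f2 ->
  measure_scaling (m1 \x m2)%E (c1 * c2) (fun p => (f1 p.1, f2 p.2)).
Proof.
move=> c10 c20 [mf1 s1] [mf2 s2].
have mF : measurable_fun setT (fun p : T1 * T2 => (f1 p.1, f2 p.2)).
  by apply/measurable_fun_pairP; split; [exact: (measurableT_comp mf1 measurable_fst)|exact: (measurableT_comp mf2 measurable_snd)].
split => // A mA.
have c0 : 0 < c1 * c2 by rewrite mulr_gt0.
have ci0 : 0 <= (c1 * c2)^-1 by rewrite invr_ge0 ltW.
(* Uniqueness compares with [m1 \x m2] itself, so it is applied to the pushforward divided by c1 *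
   c2. *)
have := @product_measure_unique _ _ _ _ _ m1 m2
  (mscale (NngNum ci0) (pushforward (m1 \x m2)%E (fun p : T1 * T2 => (f1 p.1, f2 p.2)))).
move=> /(_ mF _ A mA) H; rewrite [X in _ = (_ * X)%E]H; last first.
  move=> B C mB mC.
  transitivity (((c1 * c2)^-1)%:E * (m1 \x m2) ((f1 @^-1` B) `*` (f2 @^-1` C)))%E => //.
  rewrite product_measure1E; last 2 first.
  - by rewrite -[X in measurable X]setTI; exact: mf1.
  - by rewrite -[X in measurable X]setTI; exact: mf2.
  rewrite s1// s2//.
  have -> : (c1%:E * m1 B * (c2%:E * m2 C) =
      (c1 * c2)%:E * (m1 B * m2 C))%E by rewrite EFinM muleACA.
  by rewrite muleA -EFinM mulVf ?gt_eqF// mul1e.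
by rewrite /mscale /pushforward/= muleA -EFinM mulfV ?gt_eqF// mul1e.
Qed.

(** Cavalieri's principle: each section of the preimage is the preimage of a section under a
    measure-preserving map. *)
Lemma measure_scaling_skewr d1 d2 (T1 : measurableType d1) (T2 : measurableType d2)
    (m1 : {sigma_finite_measure set T1 -> \bar R})
    (m2 : {sigma_finite_measure set T2 -> \bar R})
    (f : T1 -> T2 -> T2) :
  measurable_fun setT (fun p : T1 * T2 => f p.1 p.2) ->
  (forall x, measure_scaling m2 1 (f x)) ->
  measure_scaling (m1 \x m2)%E 1 (fun p => (p.1, f p.1 p.2)).
Proof.
move=> mf sf.
split.
  by apply/measurable_fun_pairP; split; [exact: measurable_fst|exact: mf].
move=> A mA; rewrite mul1e /product_measure1; apply: eq_integral => x _ /=.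
have [_ /(_ (xsection A x))] := sf x.
rewrite mul1e => <-; last exact: measurable_xsection.
congr (m2 _); apply/seteqP; split => y /=; rewrite /xsection /= !inE//.
Qed.

Lemma measure_scaling_skewl d1 d2 (T1 : measurableType d1) (T2 : measurableType d2)
    (m1 : {sigma_finite_measure set T1 -> \bar R})
    (m2 : {sigma_finite_measure set T2 -> \bar R})
    (f : T2 -> T1 -> T1) :
  measurable_fun setT (fun p : T1 * T2 => f p.2 p.1) ->
  (forall y, measure_scaling m1 1 (f y)) ->
  measure_scaling (m1 \x m2)%E 1 (fun p => (f p.2 p.1, p.2)).
Proof.
move=> mf sf.
(* The product measure is built from sections at a fixed first coordinate. Here the sections at a
   fixed second coordinate are the ones mapped with their measure preserved, so the order of
   integration is exchanged first. *)
have E B : measurable B -> (m1 \x m2)%E B = (m1 \x^ m2)%E B.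
  by move=> mB; apply: product_measure_unique => // *; exact: product_measure2E.
have mF : measurable_fun setT (fun p : T1 * T2 => (f p.2 p.1, p.2)).
  by apply/measurable_fun_pairP; split; [exact: mf|exact: measurable_snd].
split => // A mA; rewrite mul1e.
have mA' : measurable ((fun p : T1 * T2 => (f p.2 p.1, p.2)) @^-1` A).
  by rewrite -[X in measurable X]setTI; exact: mF.
apply: (etrans (E _ mA')); apply: etrans (esym (E _ mA)).
rewrite /product_measure2; apply: eq_integral => y _ /=.
have [_ /(_ (ysection A y))] := sf y.
rewrite mul1e => <-; last exact: measurable_ysection.
congr (m1 _); apply/seteqP; split => x /=; rewrite /ysection /= !inE//.
Qed.

Lemma affine_scaling1 (a b : R) (a0 : 0 < a) :
  measure_scaling leb a^-1 (fun x => b + a * x).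
Proof.
have mf : measurable_fun setT ((fun x => b + a * x) : measurableTypeR R -> measurableTypeR R).
  by apply: measurable_funD => //; exact: measurable_funM.
split => // A mA.
have := @lebesgue_measure_unique R (mscale (NngNum (ltW a0)) (pushforward leb
  ((fun x => b + a * x) : measurableTypeR R -> measurableTypeR R))).
move=> /(_ mf _ A mA) H; rewrite [X in _ = (_ * X)%E]H; last first.
  move=> _ [[u v] _ <-].
  pose I := `]((u - b) / a), ((v - b) / a)]%classic.
  transitivity (a%:E * leb I)%E; last first.
    congr (_ * leb _)%E; apply/seteqP; split => x /=; rewrite /I /= !in_itv /=;
      by rewrite ltr_pdivrMr// ler_pdivlMr// ltrBlDl lerBrDl mulrC.
  rewrite /I /= !lebesgue_measure_itv /= !lte_fin ltr_pM2r ?invr_gt0//.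
  rewrite ltrD2r; case: ifP => _; last by rewrite mule0.
  by rewrite -!EFinD -EFinM; congr EFin; field; rewrite gt_eqF.
by rewrite /mscale /pushforward/= muleA -EFinM mulVf ?gt_eqF// mul1e.
Qed.

Lemma measure_scaling_rVcons n (c : R) (f : 'rV[R]_n.+1 -> 'rV[R]_n.+1)
    (F : measurableTypeR R * 'rV[R]_n -> measurableTypeR R * 'rV[R]_n) :
  measurable_fun setT f -> (forall p, f (rVcons p) = rVcons (F p)) ->
  measure_scaling (leb \x lebesgue_rV R n)%E c F ->
  measure_scaling (lebesgue_rV R n.+1) c f.
Proof.
move=> mf fF [mF sF]; split => // A mA.
have := sF _ (measurable_rVcons_preimage mA).
rewrite (_ : F @^-1` _ = @rVcons R n @^-1` (f @^-1` A))//.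
by apply/seteqP; split => p /=; rewrite fF.
Qed.

Lemma affine_scaling n (a : R) (b : 'rV[R]_n) :
  0 < a -> measure_scaling (lebesgue_rV R n) (a ^- n) (fun x => b + a *: x).
Proof.
move=> a0.
have mT k (v : 'rV[R]_k) : measurable_fun setT (fun x : 'rV[R]_k => v + a *: x).
  apply: measurable_fun_rV => i.
  rewrite (_ : (fun _ => _) = fun x : 'rV[R]_k => v 0 i + a * x 0 i).
    apply: measurable_funD => //; apply: measurable_funM => //.
    exact: measurable_rV_coor.
  by apply/funext => x; rewrite !mxE.
elim: n b => [|n IH] b.
  split; [exact: mT|move=> A mA]; rewrite expr0 invr1 mul1e; congr (lebesgue_rV R 0 _).
  by apply/seteqP; split => x /=; rewrite [_ + _](_ : _ = x)//; apply/rowP => -[].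
apply: (@measure_scaling_rVcons _ _ _
    (fun p => (b 0 0 + a * p.1 : measurableTypeR R, rVtail b + a *: p.2 : 'rV[R]_n))) => //.
  move=> p; apply/rowP => i; have [j ->|->] := unliftP ord0 i.
    by rewrite rVconsS [LHS]mxE [X in _ + X]mxE rVconsS !mxE.
  by rewrite rVcons0 [LHS]mxE [X in _ + X]mxE rVcons0.
rewrite exprS invfM; apply: (@measure_scaling_prod _ _ _ _ leb (lebesgue_rV R n) _ _ (fun x => b 0 0 + a * x : measurableTypeR R) (fun y => rVtail b + a *: y)).
- by rewrite invr_gt0.
- by rewrite invr_gt0 exprn_gt0.
- exact: affine_scaling1.
- exact: IH.
Qed.

Lemma translation_scaling n (b : 'rV[R]_n) :
  measure_scaling (lebesgue_rV R n) 1 (fun x => x + b).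
Proof.
rewrite (_ : (fun x => x + b) = fun x => b + 1 *: x); last first.
  by apply/funext => x; rewrite scale1r addrC.
by have := affine_scaling b ltr01; rewrite expr1n invr1.
Qed.

Lemma translation_scaling1 (b : R) :
  measure_scaling leb 1 (fun x => x + b).
Proof.
have [mf sf] := affine_scaling1 b ltr01.
rewrite (_ : (fun x => x + b) = fun x => b + 1 * x); last first.
  by apply/funext => x; rewrite mul1r addrC.
by split => // A mA; rewrite sf// invr1.
Qed.

Definition shear n (i : 'I_n) (g : 'rV[R]_n -> R) (x : 'rV[R]_n) : 'rV[R]_n :=
  x + g x *: delta_mx 0 i.

Lemma shearE n (i : 'I_n) (g : 'rV[R]_n -> R) (x : 'rV[R]_n) j :
  shear i g x 0 j = x 0 j + g x * (j == i)%:R.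
Proof. by rewrite !mxE eqxx. Qed.

Lemma measurable_shear n (i : 'I_n) (g : 'rV[R]_n -> R) :
  measurable_fun setT (g : _ -> measurableTypeR R) -> measurable_fun setT (shear i g).
Proof.
move=> mg; apply: measurable_fun_rV => j.
rewrite (_ : (fun _ => _) = fun x : 'rV[R]_n => x 0 j + g x * (j == i)%:R).
  by apply: measurable_funD; [exact: measurable_rV_coor|exact: measurable_funM].
by apply/funext => x; rewrite shearE.
Qed.

(** Induction on the dimension, splitting off the first coordinate. If the moved coordinate is among
    the others, every section is sheared and the induction hypothesis applies; if it is the first
    one, it is translated by an amount that depends on the others. *)
Lemma shear_scaling n (i : 'I_n) (g : 'rV[R]_n -> R) :
  measurable_fun setT (g : _ -> measurableTypeR R) ->
  (forall x s, g (x + s *: delta_mx 0 i) = g x) ->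
  measure_scaling (lebesgue_rV R n) 1 (shear i g).
Proof.
elim: n i g => [[]//|n IH] i g mg gi.
have [j ij|i0] := unliftP ord0 i.
  apply: (@measure_scaling_rVcons _ _ _
      (fun p => (p.1, shear j (fun y => g (rVcons (p.1, y))) p.2 : 'rV[R]_n))).
  - exact: measurable_shear.
  - move=> p; apply/rowP => k; rewrite shearE.
    have [l ->|->] := unliftP ord0 k.
      by rewrite !rVconsS shearE ij (inj_eq lift_inj) -surjective_pairing.
    by rewrite !rVcons0 ij /= mulr0 addr0.
  apply: (@measure_scaling_skewr _ _ _ _ _ _
    (fun x y => shear j (fun y => g (rVcons (x, y))) y)).
    apply: measurable_fun_rV => k.
    rewrite (_ : (fun _ => _) = fun p : measurableTypeR R * 'rV[R]_n =>
        p.2 0 k + g (rVcons p) * (k == j)%:R).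
      apply: measurable_funD.
        exact: (measurableT_comp (measurable_rV_coor k) measurable_snd).
      apply: measurable_funM => //.
      exact: (measurableT_comp mg measurable_rVcons).
    by apply/funext => -[x y]; rewrite shearE.
  move=> x; apply: IH.
    exact: (measurableT_comp mg (measurableT_comp measurable_rVcons (measurable_pair1 x))).
  move=> y s; rewrite -[RHS](gi _ s); congr g; apply/rowP => k.
  rewrite [RHS]mxE [X in _ = _ + X]mxE [X in _ = _ + _ * X]mxE eqxx /=.
  have [l ->|->] := unliftP ord0 k.
    by rewrite !rVconsS !mxE eqxx ij (inj_eq lift_inj).
  by rewrite !rVcons0 ij /= mulr0 addr0.
apply: (@measure_scaling_rVcons _ _ _
      (fun p => (p.1 + g (rVcons (0 : measurableTypeR R, p.2)) : measurableTypeR R, p.2))).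
- exact: measurable_shear.
- move=> p; apply/rowP => k; rewrite shearE i0.
  (* [g] is invariant in the moved coordinate, which may therefore be set to 0; the translation then
     depends on the tail alone. *)
  have -> : g (rVcons (0 : measurableTypeR R, p.2)) = g (rVcons p).
    rewrite -(gi _ p.1); congr g; apply/rowP => l.
    rewrite [LHS]mxE [X in _ + X = _]mxE [X in _ + _ * X = _]mxE eqxx /= i0.
    have [m ->|->] := unliftP ord0 l; first by rewrite !rVconsS /= mulr0 addr0.
    by rewrite !rVcons0 eqxx mulr1 add0r.
  have [l ->|->] := unliftP ord0 k; first by rewrite !rVconsS /= mulr0 addr0.
  by rewrite !rVcons0 eqxx mulr1.
apply: (@measure_scaling_skewl _ _ _ _ leb (lebesgue_rV R n) (fun y x => x + g (rVcons (0 : measurableTypeR R, y)) : measurableTypeR R)).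
  apply: measurable_funD; first exact: measurable_fst.
  have mF : measurable_fun setT (fun p : measurableTypeR R * 'rV[R]_n =>
      ((0 : measurableTypeR R), p.2)).
    by apply/measurable_fun_pairP; split; [exact: measurable_cst|exact: measurable_snd].
  exact: (measurableT_comp mg (measurableT_comp measurable_rVcons mF)).
move=> y; exact: translation_scaling1.
Qed.

End rV_integral.

Lemma oppr_eq_self (R : realDomainType) (x : R) : - x = x -> x = 0.
Proof. by move=> ?; lra. Qed.

(** * Fourier integrals of product functions *)

Section real_integrals.
Context {R : realType} d (T : measurableType d) (mu : {measure set T -> \bar R}).
Local Notation intg f := (mu.-integrable setT (EFin \o (f : T -> R))).

Lemma intg_measurable (f : T -> R) : intg f -> measurable_fun setT f.
Proof. by move=> /integrableP[/measurable_EFinP]. Qed.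

Lemma intg_le (f g : T -> R) : measurable_fun setT f ->
  (forall x, `|f x| <= g x) -> intg g -> intg f.
Proof.
move=> mf fg; apply: le_integrable => //; first exact/measurable_EFinP.
by move=> x _ /=; rewrite lee_fin (le_trans (fg x))// ler_norm.
Qed.

Lemma intgD (f g : T -> R) : intg f -> intg g -> intg (fun x => f x + g x).
Proof. by move=> If Ig; exact: (integrableD measurableT If Ig). Qed.

Lemma intgB (f g : T -> R) : intg f -> intg g -> intg (fun x => f x - g x).
Proof. by move=> If Ig; exact: (integrableB measurableT If Ig). Qed.

Lemma intgZ (c : R) (f : T -> R) : intg f -> intg (fun x => c * f x).
Proof. by move=> If; exact: (integrableZl measurableT c If). Qed.

Lemma intg_mulb (f g : T -> R) (B : R) : intg f -> measurable_fun setT g ->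
  (forall x, `|g x| <= B) -> intg (fun x => f x * g x).
Proof.
move=> If mg gB; have mf := intg_measurable If.
apply: (@intg_le _ (fun x => B * `|f x|)).
- exact: measurable_funM.
- by move=> x; rewrite normrM mulrC ler_wpM2r.
- by apply: intgZ; exact: (integrable_norm If).
Qed.

Lemma intg_sum I (s : seq I) (f : I -> T -> R) : (forall i, intg (f i)) ->
  intg (fun x => \sum_(i <- s) f i x).
Proof.
move=> If; have := @integrable_sum _ _ _ mu setT measurableT I s xpredT (fun i => EFin \o f i) (fun i _ => If i).
by apply: eq_integrable => // x _ /=; rewrite sumEFin.
Qed.

Lemma Rint_sum I (s : seq I) (f : I -> T -> R) : (forall i, intg (f i)) ->
  \int[mu]_x (\sum_(i <- s) f i x) = \sum_(i <- s) \int[mu]_x (f i x).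
Proof.
move=> If; elim: s => [|i s IH].
  by rewrite big_nil; under eq_Rintegral do rewrite big_nil; rewrite Rintegral_cst ?mul0r.
under eq_Rintegral do rewrite big_cons.
by rewrite RintegralD// ?IH ?big_cons//; exact: intg_sum.
Qed.

Lemma Rint_le (f g : T -> R) : intg f -> intg g -> (forall x, f x <= g x) ->
  \int[mu]_x f x <= \int[mu]_x g x.
Proof. by move=> If Ig fg; apply: le_Rintegral. Qed.

Lemma Rint_EFin (f : T -> R) : intg f ->
  (\int[mu]_x (f x)%:E)%E = (\int[mu]_x f x)%:E.
Proof. by move=> If; rewrite /Rintegral fineK//; exact: integrable_fin_num. Qed.

Lemma ge0_intg (f : T -> R) (c : R) : measurable_fun setT f ->
  (forall x, 0 <= f x) -> (\int[mu]_x (f x)%:E <= c%:E)%E -> intg f.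
Proof.
move=> mf f0 fc; apply/integrableP; split; first exact/measurable_EFinP.
under eq_integral do rewrite /= ger0_norm//.
by rewrite (le_lt_trans fc)// ltry.
Qed.

Lemma Rdct (F : nat -> T -> R) (f g : T -> R) :
  (forall n, measurable_fun setT (F n)) -> intg g ->
  (forall x n, `|F n x| <= g x) -> (forall x, (F n x @[n --> \oo]) --> f x) ->
  (\int[mu]_x F n x @[n --> \oo]) --> \int[mu]_x f x.
Proof.
move=> mF Ig Fg Ff.
have mf : measurable_fun setT f.
  by apply: (measurable_fun_cvg mF) => x _; exact: Ff.
have cvF : {ae mu, forall x, setT x -> (EFin \o F n) x @[n --> \oo] --> (EFin \o f) x}.
  by apply: aeW => x _; apply: cvg_EFin; [exact: nearW|exact: Ff].
have bF : {ae mu, forall x n, setT x -> (`|(EFin \o F n) x| <= (EFin \o g) x)%E}.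
  by apply: aeW => x n _ /=; rewrite lee_fin.
have [If _ cv] := @dominated_convergence _ _ _ mu setT measurableT
  (fun n => EFin \o F n) (EFin \o f) (EFin \o g)
  (fun n => (measurable_EFinP _ _).2 (mF n)) ((measurable_EFinP _ _).2 mf) cvF Ig bF.
apply: fine_cvg; rewrite /Rintegral fineK//; exact: integrable_fin_num.
Qed.

End real_integrals.

Section product_integrals.
Context {R : realType} d1 d2 (T1 : measurableType d1) (T2 : measurableType d2).
Variables (m1 : {sigma_finite_measure set T1 -> \bar R})
  (m2 : {sigma_finite_measure set T2 -> \bar R}).
Local Notation m12 := (m1 \x m2)%E.

Lemma Rfubini1 (F : T1 * T2 -> R) : m12.-integrable setT (EFin \o F) ->
  (forall x, m2.-integrable setT (fun y => (F (x, y))%:E)) ->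
  \int[m12]_p F p = \int[m1]_x (\int[m2]_y F (x, y)).
Proof.
move=> IF IFx; rewrite /Rintegral -(integral12_prod_meas1 IF).
congr fine; apply: eq_integral => x _.
by rewrite fineK//; exact: (integrable_fin_num measurableT (IFx x)).
Qed.

Lemma Rfubini2 (F : T1 * T2 -> R) : m12.-integrable setT (EFin \o F) ->
  (forall y, m1.-integrable setT (fun x => (F (x, y))%:E)) ->
  \int[m12]_p F p = \int[m2]_y (\int[m1]_x F (x, y)).
Proof.
move=> IF IFx; rewrite /Rintegral -(integral21_prod_meas1 IF).
congr fine; apply: eq_integral => x _.
by rewrite fineK//; exact: (integrable_fin_num measurableT (IFx x)).
Qed.

Lemma intg_tensor (f : T1 -> R) (g : T2 -> R) :
  m1.-integrable setT (EFin \o f) -> m2.-integrable setT (EFin \o g) ->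
  m12.-integrable setT (EFin \o (fun p => f p.1 * g p.2)).
Proof.
move=> If Ig.
have mfg : measurable_fun setT (fun p : T1 * T2 => (f p.1 * g p.2)%:E).
  apply/measurable_EFinP; apply: measurable_funM.
    exact: (measurableT_comp (intg_measurable If) measurable_fst).
  exact: (measurableT_comp (intg_measurable Ig) measurable_snd).
apply/(integrable12ltyP _ _ mfg).
have Ig' := integrable_norm Ig; have If' := integrable_norm If.
rewrite (eq_integral (fun x => (`|f x| * \int[m2]_y `|g y|)%:E)); last first.
  move=> x _ /=; under eq_integral do rewrite normrM EFinM.
  rewrite (integralZl measurableT Ig') EFinM; congr (_ * _)%E.
  exact: Rint_EFin Ig'.
under eq_integral do rewrite mulrC.
have /integrable_lty := integrableZl measurableT (\int[m2]_y `|g y|) If'.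
by move=> /(_ measurableT).
Qed.

Lemma Rint_tensor (f : T1 -> R) (g : T2 -> R) :
  m1.-integrable setT (EFin \o f) -> m2.-integrable setT (EFin \o g) ->
  \int[m12]_p (f p.1 * g p.2) = (\int[m1]_x f x) * (\int[m2]_y g y).
Proof.
move=> If Ig; rewrite Rfubini1; last 2 first.
- exact: intg_tensor.
- by move=> x; exact: (intgZ (f x) Ig).
rewrite -RintegralZr//; apply: eq_Rintegral => x _ /=.
by rewrite (RintegralZl (mu := m2) (f x) measurableT Ig).
Qed.

End product_integrals.

Section rV_real_integrals.
Context {R : realType}.
Local Notation leb := (@lebesgue_measure R).
Local Notation intgn n f := ((lebesgue_rV R n).-integrable setT (EFin \o (f : 'rV[R]_n -> R))).

Lemma intg_rVS n (f : 'rV[R]_n.+1 -> R) : measurable_fun setT f ->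
  (leb \x lebesgue_rV R n)%E.-integrable setT (EFin \o (f \o @rVcons R n)) ->
  intgn n.+1 f.
Proof.
move=> mf If.
by have := integrable_pushforward (@measurable_rVcons R n)
  ((measurable_EFinP _ _).2 mf) If measurableT.
Qed.

Lemma Rint_rVS n (f : 'rV[R]_n.+1 -> R) : measurable_fun setT f ->
  (leb \x lebesgue_rV R n)%E.-integrable setT (EFin \o (f \o @rVcons R n)) ->
  \int[lebesgue_rV R n.+1]_x f x = \int[(leb \x lebesgue_rV R n)%E]_p f (rVcons p).
Proof.
move=> mf If.
by have := @integral_pushforward _ _ _ _ _ _ (@measurable_rVcons R n)
  (leb \x lebesgue_rV R n)%E setT (EFin \o f) ((measurable_EFinP _ _).2 mf) If measurableT => E;
  rewrite /Rintegral; congr fine.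
Qed.

Lemma intg_rV0 (f : 'rV[R]_0 -> R) : intgn 0 f.
Proof.
have mf : measurable_fun setT f.
  rewrite (_ : f = cst (f 0)); first exact: measurable_cst.
  by apply/funext => x /=; congr f; apply/rowP => -[].
apply/integrableP; split; first exact/measurable_EFinP.
rewrite integral_dirac//; first by rewrite diracT mul1e ltry.
by apply: measurableT_comp => //; exact/measurable_EFinP.
Qed.

Lemma Rint_rV0 (f : 'rV[R]_0 -> R) : \int[lebesgue_rV R 0]_x f x = f 0.
Proof.
have /integrableP[mf _] := intg_rV0 f.
by rewrite /Rintegral integral_dirac// diracT mul1e.
Qed.

Lemma intg_rV_tensor n (f : R -> R) (g : 'rV[R]_n -> R) :
  leb.-integrable setT (EFin \o f) -> intgn n g ->
  intgn n.+1 (fun x => f (x ord0 ord0) * g (rVtail x)).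
Proof.
move=> If Ig; apply: intg_rVS.
  apply: measurable_funM.
    exact: (measurableT_comp (intg_measurable If) (measurable_rV_coor _)).
  apply: (measurableT_comp (intg_measurable Ig)).
  apply: measurable_fun_rV => i.
  rewrite (_ : (fun _ => _) = fun x : 'rV[R]_n.+1 => x 0 (lift ord0 i)).
    exact: measurable_rV_coor.
  by apply/funext => x; rewrite mxE.
have := intg_tensor If Ig; apply: eq_integrable => // p _ /=.
by rewrite rVcons0 rVtail_rVcons.
Qed.

Lemma Rint_rV_tensor n (f : R -> R) (g : 'rV[R]_n -> R) :
  leb.-integrable setT (EFin \o f) -> intgn n g ->
  \int[lebesgue_rV R n.+1]_x (f (x ord0 ord0) * g (rVtail x)) =
  (\int[leb]_x f x) * (\int[lebesgue_rV R n]_x g x).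
Proof.
move=> If Ig; have mI := intg_measurable (intg_rV_tensor If Ig).
have E : (fun p : measurableTypeR R * 'rV[R]_n =>
    f (rVcons p ord0 ord0) * g (rVtail (rVcons p))) = fun p => f p.1 * g p.2.
  by apply/funext => p; rewrite rVcons0 rVtail_rVcons.
rewrite Rint_rVS//.
  by rewrite E Rint_tensor.
have := intg_tensor If Ig; apply: eq_integrable => // p _ /=.
by rewrite rVcons0 rVtail_rVcons.
Qed.

Definition rVprod n (q : R -> R) (x : 'rV[R]_n) : R := \prod_(i < n) q (x ord0 i).

Lemma rVprodS n (q : R -> R) (x : 'rV[R]_n.+1) :
  rVprod q x = q (x ord0 ord0) * rVprod q (rVtail x).
Proof.
rewrite /rVprod big_ord_recl; congr (_ * _).
by apply: eq_bigr => i _; rewrite mxE.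
Qed.

Lemma dotrS n (x y : 'rV[R]_n.+1) :
  dotr x y = x ord0 ord0 * y ord0 ord0 + dotr (rVtail x) (rVtail y).
Proof.
rewrite /dotr big_ord_recl; congr (_ + _).
by apply: eq_bigr => i _; rewrite !mxE.
Qed.

Lemma intg_rVprod n (q : R -> R) : leb.-integrable setT (EFin \o q) ->
  intgn n (rVprod q).
Proof.
move=> Iq; elim: n => [|n IH]; first exact: intg_rV0.
rewrite (_ : rVprod q = fun x => q (x ord0 ord0) * rVprod q (rVtail x)).
  exact: (intg_rV_tensor Iq IH).
by apply/funext => x; rewrite rVprodS.
Qed.

Lemma Rint_rVprod n (q : R -> R) : leb.-integrable setT (EFin \o q) ->
  \int[lebesgue_rV R n]_x rVprod q x = (\int[leb]_x q x) ^+ n.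
Proof.
move=> Iq; elim: n => [|n IH]; first by rewrite Rint_rV0 /rVprod big_ord0 expr0.
under eq_Rintegral do rewrite rVprodS.
by rewrite (Rint_rV_tensor Iq (intg_rVprod n Iq)) IH exprS.
Qed.

Lemma measurable_dotr n (xi : 'rV[R]_n) : measurable_fun setT (fun x : 'rV[R]_n => dotr x xi).
Proof.
rewrite /dotr; apply: measurable_sum => i; apply: measurable_funM => //.
exact: measurable_rV_coor.
Qed.

Lemma measurable_cos : measurable_fun setT (@cos R).
Proof. by apply: continuous_measurable_fun; exact: continuous_cos. Qed.

Lemma measurable_sin : measurable_fun setT (@sin R).
Proof. by apply: continuous_measurable_fun; exact: continuous_sin. Qed.

Lemma normr_cos (x : R) : `|cos x| <= 1.
Proof. by rewrite ler_norml cos_geN1 cos_le1. Qed.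

Lemma normr_sin (x : R) : `|sin x| <= 1.
Proof. by rewrite ler_norml sin_geN1 sin_le1. Qed.

Definition cos_transform (q : R -> R) (v : R) : R := \int[leb]_t (q t * cos (t * v)).

Lemma intg_cosm d (T : measurableType d) (mu : {measure set T -> \bar R}) (f g : T -> R) :
  mu.-integrable setT (EFin \o f) -> measurable_fun setT g ->
  mu.-integrable setT (EFin \o (fun x => f x * cos (g x))).
Proof.
move=> If mg; apply: (intg_mulb If (B := 1)) => [|x]; last exact: normr_cos.
exact: (measurableT_comp measurable_cos).
Qed.

Lemma intg_sinm d (T : measurableType d) (mu : {measure set T -> \bar R}) (f g : T -> R) :
  mu.-integrable setT (EFin \o f) -> measurable_fun setT g ->
  mu.-integrable setT (EFin \o (fun x => f x * sin (g x))).
Proof.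
move=> If mg; apply: (intg_mulb If (B := 1)) => [|x]; last exact: normr_sin.
exact: (measurableT_comp measurable_sin).
Qed.

Lemma Rint_odd (f : R -> R) : leb.-integrable setT (EFin \o f) ->
  (forall x, f (- x) = - f x) -> \int[leb]_x f x = 0.
Proof.
move=> If fN.
have sN : measure_scaling leb 1 (-%R : R -> R).
  split; first by apply: continuous_measurable_fun; exact: opp_continuous.
  by move=> A mA; rewrite mul1e; exact: lebesgue_measureN.
have := Rintegral_scaling ler01 sN If; rewrite mul1r.
under eq_Rintegral do rewrite fN -mulN1r.
by rewrite RintegralZl// mulN1r; exact: oppr_eq_self.
Qed.

Lemma intg_rVprod_cos n (q : R -> R) (xi : 'rV[R]_n) : leb.-integrable setT (EFin \o q) ->
  intgn n (fun x => rVprod q x * cos (dotr x xi)).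
Proof.
by move=> Iq; apply: (intg_cosm (intg_rVprod n Iq)); exact: measurable_dotr.
Qed.

Lemma intg_rVprod_sin n (q : R -> R) (xi : 'rV[R]_n) : leb.-integrable setT (EFin \o q) ->
  intgn n (fun x => rVprod q x * sin (dotr x xi)).
Proof.
by move=> Iq; apply: (intg_sinm (intg_rVprod n Iq)); exact: measurable_dotr.
Qed.

(** The Fourier transform of a product function factorizes. In real form this becomes a joint
    induction on the addition formulas of cosine and sine, where evenness of [q] kills every term
    with a one-dimensional sine integral. *)
Lemma Rint_rVprod_cos_sin n (q : R -> R) (xi : 'rV[R]_n) :
  leb.-integrable setT (EFin \o q) -> (forall x, q (- x) = q x) ->
  \int[lebesgue_rV R n]_x (rVprod q x * cos (dotr x xi)) =
    \prod_(i < n) cos_transform q (xi ord0 i) /\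
  \int[lebesgue_rV R n]_x (rVprod q x * sin (dotr x xi)) = 0.
Proof.
move=> Iq qN; elim: n xi => [|n IH] xi.
  by rewrite !Rint_rV0 /rVprod /dotr !big_ord0 cos0 sin0 mulr1 mulr0.
have [IHc IHs] := IH (rVtail xi).
have mx : measurable_fun setT (fun t : measurableTypeR R => t * xi ord0 ord0).
  by apply: measurable_funM.
have Ic := intg_cosm Iq mx; have Is := intg_sinm Iq mx.
have Pc := intg_rVprod_cos (rVtail xi) Iq; have Ps := intg_rVprod_sin (rVtail xi) Iq.
have s0 : \int[leb]_t (q t * sin (t * xi ord0 ord0)) = 0.
  by apply: Rint_odd => // t; rewrite qN mulNr sinN mulrN.
have CC := Rint_rV_tensor Ic Pc; have SS := Rint_rV_tensor Is Ps.
have SC := Rint_rV_tensor Is Pc; have CS := Rint_rV_tensor Ic Ps.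
have iCC := intg_rV_tensor Ic Pc; have iSS := intg_rV_tensor Is Ps.
have iSC := intg_rV_tensor Is Pc; have iCS := intg_rV_tensor Ic Ps.
split.
  rewrite big_ord_recl; transitivity (\int[lebesgue_rV R n.+1]_x (
    q (x ord0 ord0) * cos (x ord0 ord0 * xi ord0 ord0) *
      (rVprod q (rVtail x) * cos (dotr (rVtail x) (rVtail xi))) -
    q (x ord0 ord0) * sin (x ord0 ord0 * xi ord0 ord0) *
      (rVprod q (rVtail x) * sin (dotr (rVtail x) (rVtail xi))))).
    apply: eq_Rintegral; by move=> x _; rewrite rVprodS dotrS cosD; ring.
  rewrite RintegralB// CC SS s0 mul0r subr0 IHc; congr (_ * _).
  by apply: eq_bigr => i _; rewrite mxE.
transitivity (\int[lebesgue_rV R n.+1]_x (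
    q (x ord0 ord0) * sin (x ord0 ord0 * xi ord0 ord0) *
      (rVprod q (rVtail x) * cos (dotr (rVtail x) (rVtail xi))) +
    q (x ord0 ord0) * cos (x ord0 ord0 * xi ord0 ord0) *
      (rVprod q (rVtail x) * sin (dotr (rVtail x) (rVtail xi))))).
  apply: eq_Rintegral; by move=> x _; rewrite rVprodS dotrS sinD; ring.
by rewrite RintegralD// SC CS s0 IHs mul0r mulr0 addr0.
Qed.

End rV_real_integrals.

(** * A Plancherel inequality *)

Section fejer.
Context {R : realType}.
Local Notation leb := (@lebesgue_measure R).

Lemma Rint_FTC (F f : R -> R) (a b : R) : a < b ->
  (forall x : R, is_derive x (1 : R) F (f x)) -> continuous f ->
  \int[leb]_(x in `[a, b]) f x = F b - F a.
Proof.
move=> ab dF cf.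
have dF' x : derivable F x 1 by have [] := dF x.
have cF : continuous F.
  by move=> x; apply: differentiable_continuous; exact/derivable1_diffP.
rewrite /Rintegral (@continuous_FTC2 _ f F)//.
- exact: continuous_subspaceT.
- split => [x _|//|//]; first exact: dF'.
    by apply: cvg_at_right_filter; exact: cF.
  by apply: cvg_at_left_filter; exact: cF.
- by move=> x _; rewrite derive1E; apply: derive_val.
Qed.

(** This function, and its product over the coordinates in R^n, is the integrable majorant used
    throughout. *)
Lemma intg_oneDsqrV : leb.-integrable setT (fun t => ((1 + t ^+ 2)^-1 : R)%:E).
Proof.
apply: (@ge0_intg _ _ _ leb (fun t => (1 + t ^+ 2)^-1) pi).
- by apply: continuous_measurable_fun; exact: continuous_oneDsqrV.
- by move=> x; rewrite invr_ge0 addr_ge0 ?sqr_ge0.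
have := @ge0_symfun_integralT R (fun t => (1 + t ^+ 2)^-1).
move=> ->.
- have -> : [set x | 0 <= x] = `[0, +oo[%classic :> set R.
    by apply/seteqP; split => x /=; rewrite in_itv /= andbT.
  by rewrite (integral0y_oneDsqr R) -EFinM lee_fin mulrCA divff ?mulr1.
- by move=> x; rewrite invr_ge0 addr_ge0 ?sqr_ge0.
- exact: continuous_oneDsqrV.
- by move=> x /=; rewrite sqrrN.
Qed.

Lemma is_derive_mulr (v x : R) : is_derive x (1 : R) (fun t => t * v) v.
Proof.
have := @is_deriveM R R id (cst v) x 1 1 0 _ _.
by rewrite scaler0 add0r /GRing.scale /= mulr1; apply.
Qed.

Lemma is_derive_sinZ (v x : R) :
  is_derive x (1 : R) (fun t => sin (t * v)) (cos (x * v) * v).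
Proof.
exact: (@is_derive1_comp R sin (fun t => t * v) x (cos (x * v)) v
  (is_derive_sin _) (is_derive_mulr v x)).
Qed.

Lemma is_derive_cosZ (v x : R) :
  is_derive x (1 : R) (fun t => cos (t * v)) (- sin (x * v) * v).
Proof.
exact: (@is_derive1_comp R cos (fun t => t * v) x (- sin (x * v)) v
  (is_derive_cos _) (is_derive_mulr v x)).
Qed.

Lemma continuous_cosZ (v : R) : continuous (fun t : R => cos (t * v)).
Proof.
move=> x; rewrite -[fun _ => _]/(cos \o (fun t : R => t * v)); apply: continuous_comp.
  exact: mulrr_continuous.
exact: continuous_cos.
Qed.

Lemma continuous_cos_transform (q : R -> R) : leb.-integrable setT (EFin \o q) ->
  continuous (cos_transform q).
Proof.
move=> Iq x.
have mx (v : R) : measurable_fun setT (fun t : measurableTypeR R => t * v).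
  exact: measurable_funM.
have H := @continuity_under_integral R _ _ leb (fun l t => q t * cos (t * l)) setT
  measurableT (x - 1) (x + 1) (fun l _ => intg_cosm Iq (mx l)) _ (fun t => `|q t|)
  (integrable_norm Iq) _.
apply: H; last by rewrite inE /= in_itv /= ltrBlDr ltrDl ltr01.
  apply: aeW => t _ l _; apply: cvgM; first exact: cvg_cst.
  under eq_fun do rewrite mulrC; rewrite mulrC; exact: continuous_cosZ.
move=> l _; apply: aeW => t _.
by rewrite normrM ler_piMr// normr_cos.
Qed.

Lemma measurable_cos_transform (q : R -> R) : leb.-integrable setT (EFin \o q) ->
  measurable_fun setT (cos_transform q).
Proof.
by move=> Iq; apply: continuous_measurable_fun; exact: continuous_cos_transform.
Qed.

(** A frequency cut-off whose Fourier transform, the Fejer kernel, is nonnegative and integrable. *)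
Definition hat (t : R) : R := Num.max 0 (1 - `|t|).

Lemma hat_ge0 t : 0 <= hat t.
Proof. by rewrite /hat le_max lexx. Qed.

Lemma hat_le1 t : hat t <= 1.
Proof. by rewrite /hat ge_max ler01 /= lerBlDr lerDl. Qed.

Lemma hatN t : hat (- t) = hat t.
Proof. by rewrite /hat normrN. Qed.

Lemma continuous_hat : continuous hat.
Proof.
move=> x; apply: (@continuous_max _ _ (fun=> 0) (fun t => 1 - `|t|)).
  exact: cvg_cst.
by apply: cvgB; [exact: cvg_cst|exact: norm_continuous].
Qed.

Lemma measurable_hat : measurable_fun setT hat.
Proof. by apply: continuous_measurable_fun; exact: continuous_hat. Qed.

Lemma intg_hat : leb.-integrable setT (EFin \o hat).
Proof.
apply: (@intg_le _ _ _ leb hat (fun t => 2 * (1 + t ^+ 2)^-1)).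
- exact: measurable_hat.
- move=> t; rewrite ger0_norm ?hat_ge0// -ler_pdivrMl//.
  have p1 : 0 < 1 + t ^+ 2 by rewrite ltr_pwDl ?sqr_ge0.
  rewrite -[leRHS]mul1r ler_pdivlMr//.
  have [t1|t1] := leP `|t| 1.
    have : t ^+ 2 <= 1 by rewrite -real_normK ?num_real// expr_le1.
    have := hat_le1 t; have := hat_ge0 t; nra.
  rewrite /hat max_l ?mulr0 ?mul0r//; first lra.
- by apply: intgZ; exact: intg_oneDsqrV.
Qed.

Definition fejer (v : R) : R := cos_transform hat v.

Lemma fejerE v : v != 0 -> fejer v = 2 * (1 - cos v) / v ^+ 2.
Proof.
move=> v0; rewrite /fejer /cos_transform.
have m01 a b : measurable (`[a, b] : set (measurableTypeR R)) by exact: measurable_itv.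
have mv : measurable_fun setT (fun t : measurableTypeR R => t * v).
  exact: measurable_funM.
have If := intg_cosm intg_hat mv.
transitivity (\int[leb]_(t in `[-1, 1]) (hat t * cos (t * v))).
  rewrite [RHS]Rintegral_mkcond; apply: eq_Rintegral => t _.
  rewrite patchE; case: ifPn => //; rewrite notin_setE /= in_itv /= -ler_norml => /negP.
  by rewrite -ltNge => /ltW t1; rewrite /hat max_l ?mul0r// subr_le0.
have I1 (i : interval R) : leb.-integrable [set` i] (EFin \o (fun t => hat t * cos (t * v))).
  exact: (integrableS measurableT).
have := @Rintegral_itvB _ (fun t => hat t * cos (t * v)) (BLeft (-1)) (BRight 1) 0 (I1 _).
rewrite !bnd_simp lerN10 ler01 => /(_ isT isT).
rewrite Rintegral_itv_obnd_cbnd//.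
move/eqP; rewrite subr_eq => /eqP ->.
have -> : \int[leb]_(t in `[0, 1]) (hat t * cos (t * v)) = (1 - cos v) / v ^+ 2.
  transitivity (\int[leb]_(t in `[0, 1]) ((1 - t) * cos (t * v))).
    apply: eq_Rintegral => t; rewrite inE /= in_itv /= => /andP[t0 t1].
    by rewrite /hat max_r ?subr_ge0 ger0_norm.
  pose F t := (1 - t) * (sin (t * v) / v) - cos (t * v) / v ^+ 2.
  transitivity (F 1 - F 0); last first.
    by rewrite /F subrr !mul0r cos0 sin0 !mul1r !mul0r; field.
  apply: Rint_FTC => //.
  - move=> x; have ds := is_derive_sinZ v x; have dc := is_derive_cosZ v x.
    by apply: is_derive_eq; rewrite /GRing.scale /=; field.
  - move=> x; apply: cvgM; first by apply: cvgB; [exact: cvg_cst|exact: cvg_id].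
    exact: continuous_cosZ.
have -> : \int[leb]_(t in `[-1, 0]) (hat t * cos (t * v)) = (1 - cos v) / v ^+ 2.
  transitivity (\int[leb]_(t in `[-1, 0]) ((1 + t) * cos (t * v))).
    apply: eq_Rintegral => t; rewrite inE /= in_itv /= => /andP[t0 t1].
    by rewrite /hat max_r ?subr_ge0 ler0_norm// ?opprK// lerNl.
  pose F t := (1 + t) * (sin (t * v) / v) + cos (t * v) / v ^+ 2.
  transitivity (F 0 - F (-1)); last first.
    by rewrite /F !mul0r cos0 sin0 mulN1r sinN cosN subrr; field.
  apply: Rint_FTC => //.
  - move=> x; have ds := is_derive_sinZ v x; have dc := is_derive_cosZ v x.
    by apply: is_derive_eq; rewrite /GRing.scale /=; field.
  - move=> x; apply: cvgM; first by apply: cvgD; [exact: cvg_cst|exact: cvg_id].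
    exact: continuous_cosZ.
by field.
Qed.

Lemma fejer_ge0 v : 0 <= fejer v.
Proof.
have [->|v0] := eqVneq v 0.
  apply: Rintegral_ge0 => t _; rewrite mulr0 cos0 mulr1; exact: hat_ge0.
by rewrite fejerE// divr_ge0 ?sqr_ge0// mulr_ge0// subr_ge0 cos_le1.
Qed.

Lemma measurable_fejer : measurable_fun setT fejer.
Proof. by apply: measurable_cos_transform; exact: intg_hat. Qed.

Lemma intg_fejer : leb.-integrable setT (EFin \o fejer).
Proof.
pose I := \int[leb]_t hat t.
have I0 : 0 <= I by apply: Rintegral_ge0 => t _; exact: hat_ge0.
(* The bounds [fejer v <= I] and [v ^+ 2 * fejer v <= 4], the latter from the closed form, add up to
   this majorant. *)
apply: (@intg_le _ _ _ leb fejer (fun t => (I + 4) * (1 + t ^+ 2)^-1)).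
- exact: measurable_fejer.
- move=> v; rewrite ger0_norm ?fejer_ge0//.
  have p1 : 0 < 1 + v ^+ 2 by rewrite ltr_pwDl ?sqr_ge0.
  have fI : fejer v <= I.
    have mv : measurable_fun setT (fun t : measurableTypeR R => t * v).
      exact: measurable_funM.
    apply: Rint_le; [exact: (intg_cosm intg_hat mv)|exact: intg_hat|].
    by move=> t; rewrite ler_piMr ?hat_ge0 ?cos_le1.
  rewrite ler_pdivlMr// mulrDr mulr1 lerD//.
  have [->|v0] := eqVneq v 0; first by rewrite expr0n mulr0.
  rewrite fejerE// divfK ?sqrf_eq0//.
  by have := cos_geN1 v; lra.
- by apply: intgZ; exact: intg_oneDsqrV.
Qed.

Lemma Rint_hat_gt0 : 0 < \int[leb]_t hat t.
Proof.
pose J : set (measurableTypeR R) := `[0, 2^-1]%classic.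
have mJ : measurable J by exact: measurable_itv.
have IJ : leb.-integrable setT (EFin \o (\1_J : _ -> R)).
  exact: integrable_indic_itv.
have : \int[leb]_t (2^-1 * \1_J t) <= \int[leb]_t hat t.
  apply: Rint_le; [exact: intgZ|exact: intg_hat|move=> t].
  rewrite indicE; case: (boolP (t \in J)) => [|_]; last by rewrite mulr0 hat_ge0.
  rewrite inE /J /= in_itv /= mulr1 /hat => /andP[t0 t1].
  by rewrite ger0_norm// le_max; apply/orP; right; lra.
apply: lt_le_trans; rewrite RintegralZl// mulr_gt0//.
rewrite /Rintegral integral_indic// setIT /J /= lebesgue_measure_itv /= lte_fin.
by rewrite ifT /= ?oppr0 ?addr0 //= invr_gt0.
Qed.

(** The Plancherel inequality only divides by this constant, so a lower bound on 0 <= v <= 1/2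
    suffices: on the support of [hat] one has |t v| <= 1/2 there, whence cos (t v) >= cos (1/2) >
    0. *)
Lemma Rint_fejer_gt0 : 0 < \int[leb]_v fejer v.
Proof.
pose J : set (measurableTypeR R) := `[0, 2^-1]%classic.
have mJ : measurable J by exact: measurable_itv.
have IJ : leb.-integrable setT (EFin \o (\1_J : _ -> R)).
  exact: integrable_indic_itv.
pose c := cos 2^-1 * \int[leb]_t hat t.
have c0 : 0 < c.
  rewrite mulr_gt0 ?Rint_hat_gt0// cos_gt0_pihalf//.
  by have := @pihalf_ge1 R; lra.
have : \int[leb]_v (c * \1_J v) <= \int[leb]_v fejer v.
  apply: Rint_le; [exact: intgZ|exact: intg_fejer|move=> v].
  rewrite indicE; case: (boolP (v \in J)) => [|_]; last by rewrite mulr0 fejer_ge0.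
  rewrite inE /J /= in_itv /= mulr1 => /andP[v0 v1].
  have mv : measurable_fun setT (fun t : measurableTypeR R => t * v).
    exact: measurable_funM.
  rewrite /c -RintegralZl//; last exact: intg_hat.
  apply: Rint_le; [exact: (intgZ _ intg_hat)|exact: (intg_cosm intg_hat mv)|move=> t].
  have [t1|t1] := leP `|t| 1; last first.
    by rewrite /hat max_l ?mulr0 ?mul0r// subr_le0 ltW.
  rewrite mulrC ler_wpM2l ?hat_ge0//.
  have : `|t * v| <= 2^-1.
    by rewrite normrM (ger0_norm v0) -[leRHS]mul1r ler_pM.
  move=> tv; have -> : cos (t * v) = cos `|t * v|.
    by case: (ger0P (t * v)) => // _; rewrite cosN.
  have pi1 : (1 : R) <= pi by have := @pihalf_ge1 R; lra.
  rewrite leNgt; apply/negP => cl.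
  have p2 : (2^-1 : R) <= pi by lra.
  have := @ltr_cos R 2^-1 `|t * v|.
  rewrite !in_itv /= invr_ge0 ler0n p2 normr_ge0 (le_trans tv p2) => /(_ isT isT).
  by rewrite cl ltNge tv.
apply: lt_le_trans; rewrite RintegralZl// mulr_gt0//.
rewrite /Rintegral integral_indic// setIT /J /= lebesgue_measure_itv /= lte_fin.
by rewrite ifT /= ?subr0 ?invr_gt0.
Qed.

End fejer.

(* A copy of the product measure: the library's own sigma-finite structure on
   products is shadowed by the one for subprobabilities and is not inferred. *)
Definition sfprod {R : realType} d1 d2 (T1 : measurableType d1)
    (T2 : measurableType d2) (m1 : {sigma_finite_measure set T1 -> \bar R})
    (m2 : {sigma_finite_measure set T2 -> \bar R}) :
  set (T1 * T2) -> \bar R := (m1 \x m2)%E.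

Section sfprod.
Context {R : realType} d1 d2 (T1 : measurableType d1)
    (T2 : measurableType d2) (m1 : {sigma_finite_measure set T1 -> \bar R})
    (m2 : {sigma_finite_measure set T2 -> \bar R}).

HB.instance Definition _ := Measure.copy (sfprod m1 m2) (m1 \x m2)%E.

Lemma sfprod_sigma_finite : sigma_finite setT (sfprod m1 m2).
Proof.
have /sigma_finiteP[F [TF ndF Foo]] := sigma_finiteT m1.
have /sigma_finiteP[G [TG ndG Goo]] := sigma_finiteT m2.
exists (fun n => F n `*` G n).
 rewrite -setXTT TF TG predeqE => -[x y]; split.
    move=> [/= [n _ Fnx] [k _ Gky]]; exists (maxn n k) => //; split.
    - by move: x Fnx; exact/subsetPset/ndF/leq_maxl.
    - by move: y Gky; exact/subsetPset/ndG/leq_maxr.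
  by move=> [n _ []/= ? ?]; split; exists n.
move=> k; have [? ?] := Foo k; have [? ?] := Goo k.
split; first exact: measurableX.
by rewrite /sfprod product_measure1E// lte_mul_pinfty// ge0_fin_numE.
Qed.

HB.instance Definition _ := Measure_isSigmaFinite.Build _ _ _ (sfprod m1 m2)
  sfprod_sigma_finite.

End sfprod.

Section plancherel.
Context {R : realType} {n : nat}.
Local Notation leb := (@lebesgue_measure R).
Local Notation lebn := (lebesgue_rV R n).
Variables (g : 'rV[R]_n -> R) (B : R).
Hypotheses (cg : continuous g) (Ig : lebn.-integrable setT (EFin \o g))
  (gB : forall x, `|g x| <= B).

Let Gre xi := \int[lebn]_x (g x * cos (dotr x xi)).
Let Gim xi := \int[lebn]_x (g x * sin (dotr x xi)).

Lemma measurable_dotr2 d (T : measurableType d) (f h : T -> 'rV[R]_n) :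
  measurable_fun setT f -> measurable_fun setT h ->
  measurable_fun setT (fun p => dotr (f p) (h p)).
Proof.
move=> mf mh; rewrite /dotr; apply: measurable_sum => i.
apply: measurable_funM.
  exact: (measurableT_comp (measurable_rV_coor i) mf).
exact: (measurableT_comp (measurable_rV_coor i) mh).
Qed.

Let Gsq xi : Gre xi ^+ 2 + Gim xi ^+ 2 =
  \int[(lebn \x lebn)%E]_p (g p.1 * g p.2 * cos (dotr p.1 xi - dotr p.2 xi)).
Proof.
have Ic := intg_cosm Ig (measurable_dotr xi).
have Is := intg_sinm Ig (measurable_dotr xi).
rewrite !expr2 -(Rint_tensor Ic Ic) -(Rint_tensor Is Is) -RintegralD//; last 2 first.
- exact: (intg_tensor Ic Ic).
- exact: (intg_tensor Is Is).
by apply: eq_Rintegral => p _; rewrite cosB; ring.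
Qed.

(** Both sides are the triple integral of hat(a xi) g(x) g(y) cos((x - y).xi), with [hat] taken
    coordinatewise. Integrating over x and y first gives the left-hand side; integrating over xi
    first gives the Fejer kernel at (x - y) / a, and the substitution x = y + a w absorbs the factor
    a^-n. *)
Lemma fejer_identity (a : R) : 0 < a ->
  \int[lebn]_xi (rVprod hat (a *: xi) * (Gre xi ^+ 2 + Gim xi ^+ 2)) =
  \int[(lebn \x lebn)%E]_p (g p.1 * rVprod fejer p.2 * g (p.1 + a *: p.2)).
Proof.
move=> a0; have an0 : 0 <= a ^- n by rewrite invr_ge0 exprn_ge0// ltW.
have sc0 : measure_scaling lebn (a ^- n) (fun x => a *: x).
  rewrite (_ : (fun _ => _) = fun x : 'rV[R]_n => 0 + a *: x).
    exact: affine_scaling.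
  by apply/funext => x; rewrite add0r.
have Ih : lebn.-integrable setT (EFin \o (fun xi => rVprod hat (a *: xi))).
  exact: (integrable_scaling an0 sc0 (intg_rVprod n intg_hat)).
pose gg (p : 'rV[R]_n * 'rV[R]_n) := g p.1 * g p.2.
have Igg : (lebn \x lebn)%E.-integrable setT (EFin \o gg) := intg_tensor Ig Ig.
have mcos : measurable_fun setT (fun q : 'rV[R]_n * ('rV[R]_n * 'rV[R]_n) =>
    cos (dotr q.2.1 q.1 - dotr q.2.2 q.1)).
  apply: (measurableT_comp measurable_cos); apply: measurable_funB.
    apply: measurable_dotr2 => //.
    exact: (measurableT_comp measurable_fst measurable_snd).
  apply: measurable_dotr2 => //.
  exact: (measurableT_comp measurable_snd measurable_snd).
have cosb (T : Type) (f : T -> R) x : `|cos (f x)| <= 1 by exact: normr_cos.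
have Ibig := intg_mulb (@intg_tensor _ _ _ _ _ lebn (sfprod lebn lebn) _ gg Ih Igg) mcos (cosb _ _).
have mcos1 xi : measurable_fun setT (fun p : 'rV[R]_n * 'rV[R]_n =>
    cos (dotr p.1 xi - dotr p.2 xi)).
  by apply: (measurableT_comp measurable_cos); apply: measurable_funB;
    apply: measurable_dotr2.
have mcos2 (p : 'rV[R]_n * 'rV[R]_n) : measurable_fun setT (fun xi : 'rV[R]_n =>
    cos (dotr p.1 xi - dotr p.2 xi)).
  by apply: (measurableT_comp measurable_cos); apply: measurable_funB;
    apply: measurable_dotr2.
have F1 := Rfubini1 Ibig _; have F2 := Rfubini2 Ibig _.
transitivity (\int[(lebn \x lebn)%E]_p (g p.1 * g p.2 *
    (a ^- n * rVprod fejer (a^-1 *: (p.1 - p.2))))).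
  transitivity (\int[(lebn \x (sfprod lebn lebn))%E]_q (rVprod hat (a *: q.1) *
      (g q.2.1 * g q.2.2) * cos (dotr q.2.1 q.1 - dotr q.2.2 q.1))).
    rewrite F1; last first.
      move=> xi; have := intgZ (rVprod hat (a *: xi)) (intg_mulb Igg (mcos1 xi) (cosb _ _)).
      by apply: eq_integrable => // p _ /=; rewrite mulrA.
    apply: eq_Rintegral => xi _; rewrite Gsq -RintegralZl//; last first.
      exact: (intg_mulb Igg (mcos1 xi) (cosb _ _)).
    by apply: eq_Rintegral => p _ /=; rewrite !mulrA.
  rewrite F2; last first.
    move=> p; have := intgZ (g p.1 * g p.2) (intg_mulb Ih (mcos2 p) (cosb _ _)).
    by apply: eq_integrable => // xi _ /=; congr EFin; rewrite /gg /=; ring.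
  apply: eq_Rintegral => p _ /=.
  transitivity (\int[lebn]_xi (g p.1 * g p.2 * (rVprod hat (a *: xi) *
      cos (dotr (a *: xi) (a^-1 *: (p.1 - p.2)))))).
    apply: eq_Rintegral => xi _.
    have -> : dotr p.1 xi - dotr p.2 xi = dotr (a *: xi) (a^-1 *: (p.1 - p.2)).
      rewrite /dotr -sumrB; apply: eq_bigr => i _; rewrite !mxE.
      by field; rewrite gt_eqF.
    by rewrite /gg /=; ring.
  have Ihc := intg_rVprod_cos (a^-1 *: (p.1 - p.2)) intg_hat.
  rewrite RintegralZl//; last exact: (integrable_scaling an0 sc0 Ihc).
  congr (_ * _).
  rewrite (Rintegral_scaling an0 sc0 Ihc); congr (_ * _).
  by have [-> _] := Rint_rVprod_cos_sin (a^-1 *: (p.1 - p.2)) intg_hat hatN.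
have IW := intg_rVprod n (@intg_fejer R).
have mW := intg_measurable IW.
pose f y x := g x * rVprod fejer (a^-1 *: (x - y)).
have mWy y : measurable_fun setT (fun x : 'rV[R]_n => rVprod fejer (a^-1 *: (x - y))).
  apply: (measurableT_comp mW); apply: measurable_fun_rV => i.
  rewrite (_ : (fun _ => _) = fun x : 'rV[R]_n => a^-1 * (x 0 i - y 0 i)).
    by apply: measurable_funM => //; apply: measurable_funB => //; exact: measurable_rV_coor.
  by apply/funext => x; rewrite !mxE.
have [M WM] : exists M, forall w : 'rV[R]_n, `|rVprod fejer w| <= M.
  exists ((\int[leb]_t hat t) ^+ n) => w; rewrite /rVprod normr_prod.
  rewrite -[X in _ ^+ X]card_ord -prodr_const; apply: ler_prod => i _.
  rewrite normr_ge0 ger0_norm ?fejer_ge0//=.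
  have mv : measurable_fun setT (fun t : measurableTypeR R => t * w ord0 i).
    exact: measurable_funM.
  apply: Rint_le; [exact: (intg_cosm intg_hat mv)|exact: intg_hat|].
  by move=> t; rewrite ler_piMr ?hat_ge0 ?cos_le1.
have If y : lebn.-integrable setT (EFin \o f y).
  exact: (intg_mulb Ig (mWy y) (fun x => WM _)).
have mW2 : measurable_fun setT (fun p : 'rV[R]_n * 'rV[R]_n =>
    rVprod fejer (a^-1 *: (p.1 - p.2))).
  apply: (measurableT_comp mW); apply: measurable_fun_rV => i.
  rewrite (_ : (fun _ => _) = fun p : 'rV[R]_n * 'rV[R]_n => a^-1 * (p.1 0 i - p.2 0 i)).
    apply: measurable_funM => //; apply: measurable_funB.
      exact: (measurableT_comp (measurable_rV_coor i) measurable_fst).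
    exact: (measurableT_comp (measurable_rV_coor i) measurable_snd).
  by apply/funext => p; rewrite !mxE.
have sc y : measure_scaling lebn (a ^- n) (fun w => y + a *: w).
  exact: affine_scaling.
have mgy : measurable_fun setT (fun p : 'rV[R]_n * 'rV[R]_n => g (p.1 + a *: p.2)).
  apply: (measurableT_comp (intg_measurable Ig)); apply: measurable_fun_rV => i.
  rewrite (_ : (fun _ => _) = fun p : 'rV[R]_n * 'rV[R]_n => p.1 0 i + a * p.2 0 i).
    apply: measurable_funD; first exact: (measurableT_comp (measurable_rV_coor i) measurable_fst).
    apply: measurable_funM => //.
    exact: (measurableT_comp (measurable_rV_coor i) measurable_snd).
  by apply/funext => p; rewrite !mxE.
have I2 : (lebn \x lebn)%E.-integrable setT (EFin \o (fun p : 'rV[R]_n * 'rV[R]_n =>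
    g p.1 * g p.2 * (a ^- n * rVprod fejer (a^-1 *: (p.1 - p.2))))).
  apply: (@intg_mulb _ _ _ _ (fun p : 'rV[R]_n * 'rV[R]_n => g p.1 * g p.2)
      _ (a ^- n * M) Igg).
    exact: measurable_funM.
  by move=> p; rewrite normrM ger0_norm// ler_wpM2l.
rewrite (Rfubini2 I2); last first.
  move=> y; have := intgZ (g y * a ^- n) (If y).
  by apply: eq_integrable => // x _ /=; rewrite /f; congr EFin; ring.
have I3 : (lebn \x lebn)%E.-integrable setT (EFin \o (fun p : 'rV[R]_n * 'rV[R]_n =>
    g p.1 * rVprod fejer p.2 * g (p.1 + a *: p.2))).
  apply: (@intg_mulb _ _ _ _ (fun p : 'rV[R]_n * 'rV[R]_n => g p.1 * rVprod fejer p.2) _ B) => //.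
  exact: (intg_tensor Ig IW).
have mgw y : measurable_fun setT (fun w : 'rV[R]_n => g (y + a *: w)).
  exact: (measurableT_comp (intg_measurable Ig) (sc y).1).
have I4 y : lebn.-integrable setT (EFin \o (fun w => rVprod fejer w * g (y + a *: w))).
  exact: (intg_mulb IW (mgw y) (fun w => gB _)).
rewrite (Rfubini1 I3); last first.
  move=> y; have := intgZ (g y) (I4 y).
  by apply: eq_integrable => // x _ /=; rewrite mulrA.
apply: eq_Rintegral => y _.
transitivity (g y * (a ^- n * \int[lebn]_x f y x)).
  rewrite mulrA -RintegralZl//.
  by apply: eq_Rintegral => x _; rewrite /f /=; ring.
rewrite -(Rintegral_scaling an0 (sc y) (If y)) -RintegralZl//; last first.
  exact: (integrable_scaling an0 (sc y) (If y)).
apply: eq_Rintegral => w _; rewrite /f addrAC subrr add0r scalerA mulVf ?gt_eqF//.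
by rewrite scale1r /=; ring.
Qed.

(** As [a] tends to 0 the right-hand side of [fejer_identity] tends to the product of the two
    integrals, by continuity of [g] and dominated convergence; the bound B on [g] provides the
    majorant. *)
Lemma plancherel_le (D : R) :
  (forall a, 0 < a -> \int[lebn]_xi (rVprod hat (a *: xi) *
     (Gre xi ^+ 2 + Gim xi ^+ 2)) <= D) ->
  (\int[leb]_v fejer v) ^+ n * \int[lebn]_x (g x ^+ 2) <= D.
Proof.
move=> HD.
have IW := intg_rVprod n (@intg_fejer R).
have mg := intg_measurable Ig.
have Igsq : lebn.-integrable setT (EFin \o (fun x => g x ^+ 2)).
  exact: (intg_mulb Ig mg gB).
have cv : (\int[(lebn \x lebn)%E]_p (g p.1 * rVprod fejer p.2 *
    g (p.1 + k.+1%:R^-1 *: p.2)) @[k --> \oo]) -->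
    \int[(lebn \x lebn)%E]_p (g p.1 ^+ 2 * rVprod fejer p.2).
  apply: (@Rdct _ _ _ (lebn \x lebn)%E _ _
      (fun p : 'rV[R]_n * 'rV[R]_n => B * `|g p.1 * rVprod fejer p.2|)).
  - move=> k; apply: measurable_funM.
      exact: (intg_measurable (intg_tensor Ig IW)).
    apply: (measurableT_comp mg); apply: measurable_fun_rV => i.
    rewrite (_ : (fun _ => _) = fun p : 'rV[R]_n * 'rV[R]_n => p.1 0 i + k.+1%:R^-1 * p.2 0 i).
      apply: measurable_funD; first exact: (measurableT_comp (measurable_rV_coor i) measurable_fst).
      apply: measurable_funM => //.
      exact: (measurableT_comp (measurable_rV_coor i) measurable_snd).
    by apply/funext => p; rewrite !mxE.
  - by apply: intgZ; exact: (integrable_norm (intg_tensor Ig IW)).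
  - by move=> p k; rewrite normrM mulrC ler_wpM2r.
  - move=> p; rewrite (_ : g p.1 ^+ 2 * rVprod fejer p.2 =
      g p.1 * rVprod fejer p.2 * g (p.1 + 0 *: p.2)); last first.
      by rewrite scale0r addr0; ring.
    apply: cvgM; first exact: cvg_cst.
    apply: (@cvg_comp _ _ _ (fun k : nat => p.1 + k.+1%:R^-1 *: p.2) g); last exact: cg.
    apply: cvgD; first exact: cvg_cst.
    by apply: cvgZr_tmp; exact: cvg_harmonic.
rewrite -(Rint_rVprod n (@intg_fejer R)) mulrC -(Rint_tensor Igsq IW).
apply: (cvgr_to_le cv); apply: nearW => k.
by rewrite -fejer_identity ?invr_gt0// HD ?invr_gt0.
Qed.

End plancherel.

(** * Elementary inequalities and measurability of Fourier integrals *)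

Section elementary.
Context {R : realType}.

Lemma is_derive_lipschitz (f df : R -> R) (K a b : R) :
  (forall x : R, is_derive x (1 : R) f (df x)) -> (forall x, `|df x| <= K) ->
  `|f b - f a| <= K * `|b - a|.
Proof.
move=> dF dK.
wlog ab : a b / a <= b => [H|].
  by have [/H//|/ltW/H] := leP a b; rewrite distrC (distrC b).
move: ab; rewrite le_eqVlt => /predU1P[->|ab]; first by rewrite !subrr normr0 mulr0.
have [|c _ ->] := MVT ab (fun x _ => dF x).
  apply: continuous_subspaceT => x.
  by apply: differentiable_continuous; apply/derivable1_diffP; have [] := dF x.
by rewrite normrM ler_wpM2r.
Qed.

Lemma normr_sin_le (x : R) : `|sin x| <= `|x|.
Proof.
have := @is_derive_lipschitz sin cos 1 0 x (fun x => is_derive_sin x) (fun x => normr_cos x).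
by rewrite sin0 !subr0 mul1r.
Qed.

Lemma one_sub_cos_le (u : R) : 2 - 2 * cos u <= u ^+ 2.
Proof.
have E : 2 - 2 * cos u = 4 * sin (u / 2) ^+ 2.
  rewrite [in LHS](splitr u) cosD -!expr2 cos2sin2; ring.
have := normr_sin_le (u / 2); rewrite -(ler_pXn2r (_ : 0 < 2)%N) ?nnegrE// !real_normK ?num_real// E.
rewrite expr_div_n => h; lra.
Qed.

(** Interpolates between the bound u^2, which is the better one for |u| <= 1, and the trivial bound
    4. The first cannot be improved near 0, which is why the exponent [Num.min s 1] appears
    later. *)
Lemma one_sub_cos_powR (u s : R) : 0 < s -> s <= 1 ->
  2 - 2 * cos u <= 4 * (u ^+ 2) `^ s.
Proof.
move=> s0 s1; have [u1|u1] := leP (u ^+ 2) 1; last first.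
  have : 1 <= (u ^+ 2) `^ s by rewrite -(powRr0 (u ^+ 2)) ler_powR// ltW.
  by have := cos_geN1 u; lra.
have : u ^+ 2 <= (u ^+ 2) `^ s.
  have [->|u0] := eqVneq (u ^+ 2) 0; first exact: powR_ge0.
  rewrite -[leLHS]powRr1 ?sqr_ge0//.
  by rewrite ger_powR// lt0r u0 sqr_ge0 u1.
have := one_sub_cos_le u; have := sqr_ge0 u; lra.
Qed.

Lemma eighths_le (x y e : R) : x <= e / 16 -> y <= e / 16 -> 8 * x + 8 * y <= e.
Proof. by move=> *; lra. Qed.

Lemma sum_sqr_ge0 n (x : 'rV[R]_n) : 0 <= \sum_(i < n) x 0 i ^+ 2.
Proof. by apply: sumr_ge0 => i _; exact: sqr_ge0. Qed.

Lemma enorm_ge0 n (x : 'rV[R]_n) : 0 <= enorm x.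
Proof. exact: sqrtr_ge0. Qed.

Lemma enorm_sqr n (x : 'rV[R]_n) : enorm x ^+ 2 = \sum_(i < n) x 0 i ^+ 2.
Proof. by rewrite /enorm sqr_sqrtr// sum_sqr_ge0. Qed.

(** The Cauchy-Schwarz inequality, from Lagrange's identity. *)
Lemma dotr_sqr_le n (x y : 'rV[R]_n) : dotr x y ^+ 2 <= enorm x ^+ 2 * enorm y ^+ 2.
Proof.
rewrite !enorm_sqr /dotr.
have : 0 <= \sum_(i < n) \sum_(j < n) (x 0 i * y 0 j - x 0 j * y 0 i) ^+ 2.
  by apply: sumr_ge0 => i _; apply: sumr_ge0 => j _; exact: sqr_ge0.
have -> : \sum_(i < n) \sum_(j < n) (x 0 i * y 0 j - x 0 j * y 0 i) ^+ 2 =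
    2 * ((\sum_(i < n) x 0 i ^+ 2) * (\sum_(i < n) y 0 i ^+ 2)) -
    2 * (\sum_(i < n) x 0 i * y 0 i) ^+ 2.
  have E1 : \sum_(i < n) \sum_(j < n) (x 0 i ^+ 2 * y 0 j ^+ 2) =
      (\sum_(i < n) x 0 i ^+ 2) * (\sum_(i < n) y 0 i ^+ 2).
    rewrite mulr_suml; apply: eq_bigr => i _; by rewrite mulr_sumr.
  have E2 : \sum_(i < n) \sum_(j < n) (x 0 j ^+ 2 * y 0 i ^+ 2) =
      (\sum_(i < n) x 0 i ^+ 2) * (\sum_(i < n) y 0 i ^+ 2).
    by rewrite exchange_big /= E1.
  have E3 : \sum_(i < n) \sum_(j < n) ((x 0 i * y 0 i) * (x 0 j * y 0 j)) =
      (\sum_(i < n) x 0 i * y 0 i) ^+ 2.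
    rewrite expr2 mulr_suml; apply: eq_bigr => i _; by rewrite mulr_sumr.
  rewrite mulr2n !mulrDl !mul1r -{1}E1 -E2 -E3 -!big_split -!sumrB /=.
  apply: eq_bigr => i _; rewrite -!big_split -sumrB /=.
  by apply: eq_bigr => j _; ring.
lra.
Qed.

Lemma measurable_enorm n : measurable_fun setT (@enorm R n : 'rV[R]_n -> measurableTypeR R).
Proof.
apply: (@measurableT_comp _ _ _ _ _ _ (@Num.sqrt R)).
  by apply: continuous_measurable_fun; exact: sqrt_continuous.
apply: measurable_sum => i; apply: measurable_funX; exact: measurable_rV_coor.
Qed.

End elementary.

Lemma continuous_addr {R : realType} n (z : 'rV[R]_n) : continuous (fun x : 'rV[R]_n => x + z).
Proof.
apply: continuous_rV => i.
rewrite (_ : (fun _ => _) = fun x : 'rV[R]_n => x ord0 i + z ord0 i).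
  by move=> x; exact: (cvgD (@continuous_coord _ _ i x) (cvg_cst _)).
by apply/funext => x; rewrite mxE.
Qed.

Section fourier_measurable.
Context {R : realType} {n : nat}.
Local Notation lebn := (lebesgue_rV R n).

(** Measurability in xi comes with Fubini's theorem, which asks for joint integrability in x and xi.
    The integrand is therefore multiplied by the positive integrable weight [w xi], which is divided
    out afterwards. *)
Lemma measurable_fourier_integral (g : 'rV[R]_n -> R) (c : R -> R) :
  lebn.-integrable setT (EFin \o g) -> measurable_fun setT c -> (forall x, `|c x| <= 1) ->
  measurable_fun setT (fun xi : 'rV[R]_n => \int[lebn]_x (g x * c (dotr x xi))).
Proof.
move=> Ig mc c1.
pose w := @rVprod R n (fun t => (1 + t ^+ 2)^-1).
have Iw : lebn.-integrable setT (EFin \o w) := intg_rVprod n (@intg_oneDsqrV R).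
have w0 xi : w xi != 0.
  apply/prodf_neq0 => i _; rewrite invr_neq0// gt_eqF// ltr_pwDl ?sqr_ge0//.
have mdot : measurable_fun setT (fun p : 'rV[R]_n * 'rV[R]_n => c (dotr p.1 p.2)).
  by apply: (measurableT_comp mc); exact: measurable_dotr2.
have If := intg_mulb (intg_tensor Ig Iw) mdot (fun p => c1 _).
have mG := measurable_fubini_G If.
rewrite (_ : (fun xi => _) = fun xi => (w xi)^-1 *
    fine (fubini_G lebn (fun p => (g p.1 * w p.2 * c (dotr p.1 p.2))%:E) xi)).
  apply: measurable_funM.
    rewrite (_ : (fun xi => _) = rVprod (fun t => 1 + t ^+ 2)).
      rewrite /rVprod; apply: measurable_prod => i _.
      by apply: measurable_funD => //; apply: measurable_funX; exact: measurable_rV_coor.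
    by apply/funext => xi; rewrite /w /rVprod prodfV invrK.
  exact: (measurableT_comp (fine_measurable measurableT) mG).
apply/funext => xi; rewrite /fubini_G.
have mdx : measurable_fun setT (fun x : 'rV[R]_n => c (dotr x xi)).
  by apply: (measurableT_comp mc); exact: measurable_dotr.
have Ix := intg_mulb Ig mdx (fun p => c1 _).
transitivity ((w xi)^-1 * \int[lebn]_x (w xi * (g x * c (dotr x xi)))).
  by rewrite RintegralZl// mulKf.
congr (_ * _); rewrite /Rintegral; congr fine; apply: eq_integral => x _.
by congr EFin; ring.
Qed.

Lemma L2_norm_cvg0 (F : nat -> 'rV[R]_n -> R) :
  (forall k, measurable_fun setT (F k)) ->
  ('N[lebn]_2%:E[(fun xi => (F k xi)%:E)]%E @[k --> \oo] --> 0%E) ->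
  forall e, 0 < e -> \forall k \near \oo,
    lebn.-integrable setT (EFin \o (fun xi => F k xi ^+ 2)) /\
    \int[lebn]_xi (F k xi ^+ 2) <= e.
Proof.
move=> mF cF e e0.
have se : 0 < Num.sqrt e by rewrite sqrtr_gt0.
have /fine_cvgP[fN] := cF.
move=> /cvgrPdist_lt /(_ _ se) H.
near=> k.
have fNk : 'N[lebn]_2%:E[(fun xi => (F k xi)%:E)]%E \is a fin_num by near: k.
have /= : `|0 - fine 'N[lebn]_2%:E[(fun xi => (F k xi)%:E)]%E| < Num.sqrt e by near: k.
rewrite sub0r normrN ger0_norm ?fine_ge0 ?Lnorm_ge0// => Hk.
have m2 : measurable_fun setT (fun xi => F k xi ^+ 2) by exact: measurable_funX.
have NE : ('N[lebn]_2%:E[(fun xi => (F k xi)%:E)] `^ 2 = \int[lebn]_xi (F k xi ^+ 2)%:E)%E.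
  rewrite unlock /Lnorm -poweRrM mulVf// poweRe1; last first.
    by apply: integral_ge0 => x _; exact: poweR_ge0.
  apply: eq_integral => x _.
  by rewrite /= ?poweR_EFin powR_mulrn// real_normK ?num_real.
have : (\int[lebn]_xi (F k xi ^+ 2)%:E <= e%:E)%E.
  rewrite -NE; have -> : e%:E = ((Num.sqrt e)%:E `^ 2)%E.
    by rewrite poweR_EFin powR_mulrn ?sqrtr_ge0// sqr_sqrtr ?ltW.
  apply: gt0_ler_poweR; rewrite ?ler0n ?in_itv /= ?leey ?andbT ?lee_fin ?sqrtr_ge0 ?Lnorm_ge0//.
  by rewrite -(fineK fNk) lee_fin ltW.
move=> Ie; have I2 : lebn.-integrable setT (EFin \o (fun xi => F k xi ^+ 2)).
  by apply: (ge0_intg m2 _ Ie) => x; exact: sqr_ge0.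
by split=> //; rewrite -lee_fin -Rint_EFin.
Unshelve. all: by end_near. Qed.

Lemma Lfun2_sqr (f : 'rV[R]_n -> R) : f \in Lfun lebn 2%:E ->
  measurable_fun setT f /\ lebn.-integrable setT (EFin \o (fun x => f x ^+ 2)).
Proof.
move=> f2; split; last exact: Lfun2_integrable_sqr.
by move: f2 => /[!inE] /andP[]; rewrite inE.
Qed.

End fourier_measurable.

(** * Translations of Sobolev functions *)

Section sobolev_translation.
Context {R : realType} {n : nat}.
Local Notation lebn := (lebesgue_rV R n).
Variables (f : 'rV[R]_n -> R) (B : R).
Let fk (k : nat) (x : 'rV[R]_n) : R := if enorm x <= k%:R then f x else 0.
Hypotheses (cfk : forall k, continuous (fk k))
  (Ifk : forall k, lebn.-integrable setT (EFin \o fk k))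
  (fB : forall x, `|f x| <= B).

Let fkE k : fk k = f \_ [set x | enorm x <= k%:R].
Proof.
by apply/funext => x; rewrite /fk patchE; case: ifPn => h;
  [rewrite mem_set|rewrite memNset//; exact/negP].
Qed.

Let fkB k x : `|fk k x| <= B.
Proof.
by rewrite /fk; case: ifP => _ //; rewrite normr0 (le_trans (normr_ge0 (f 0))).
Qed.

Let fourier_reE k xi : fourier_re f k xi = \int[lebn]_x (fk k x * cos (dotr x xi)).
Proof.
rewrite /fourier_re Rintegral_mkcond; apply: eq_Rintegral => x _.
by rewrite fkE !patchE; case: ifP => // _; rewrite mul0r.
Qed.

Let fourier_imE k xi : fourier_im f k xi = - \int[lebn]_x (fk k x * sin (dotr x xi)).
Proof.
rewrite /fourier_im Rintegral_mkcond; congr (- _); apply: eq_Rintegral => x _.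
by rewrite fkE !patchE; case: ifP => // _; rewrite mul0r.
Qed.

(** Translation by z multiplies the transform by exp(i z.xi), and |exp(i z.xi) - 1|^2 = 2 - 2
    cos(z.xi). *)
Let fourier_shift k z xi :
  let g x := fk k (x + z) - fk k x in
  (\int[lebn]_x (g x * cos (dotr x xi))) ^+ 2 +
  (\int[lebn]_x (g x * sin (dotr x xi))) ^+ 2 =
  (2 - 2 * cos (dotr z xi)) * (fourier_re f k xi ^+ 2 + fourier_im f k xi ^+ 2).
Proof.
move=> g; rewrite fourier_reE fourier_imE sqrrN.
have st := translation_scaling z.
have md : measurable_fun setT (fun x : 'rV[R]_n => dotr x xi - dotr z xi).
  by apply: measurable_funB => //; exact: measurable_dotr.
have dE x : dotr x xi = dotr (x + z) xi - dotr z xi.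
  by rewrite /dotr -sumrB; apply: eq_bigr => i _; rewrite !mxE; ring.
have Ic := intg_cosm (Ifk k) (measurable_dotr xi).
have Is := intg_sinm (Ifk k) (measurable_dotr xi).
have Ic' := intg_cosm (Ifk k) md; have Is' := intg_sinm (Ifk k) md.
have Tc := Rintegral_scaling ler01 st Ic'; have Ts := Rintegral_scaling ler01 st Is'.
have ITc := integrable_scaling ler01 st Ic'; have ITs := integrable_scaling ler01 st Is'.
set a := \int[lebn]_x (fk k x * cos (dotr x xi)).
set b := \int[lebn]_x (fk k x * sin (dotr x xi)).
have -> : \int[lebn]_x (g x * cos (dotr x xi)) =
    a * cos (dotr z xi) + b * sin (dotr z xi) - a.
  transitivity (\int[lebn]_x (fk k (x + z) * cos (dotr (x + z) xi - dotr z xi) -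
      fk k x * cos (dotr x xi))).
    by apply: eq_Rintegral => x _; rewrite -dE /g mulrBl.
  rewrite RintegralB// Tc mul1r; congr (_ - _).
  transitivity (\int[lebn]_x (cos (dotr z xi) * (fk k x * cos (dotr x xi)) +
      sin (dotr z xi) * (fk k x * sin (dotr x xi)))).
    by apply: eq_Rintegral => x _; rewrite cosB; ring.
  rewrite RintegralD//; [|exact: intgZ|exact: intgZ].
  by rewrite !RintegralZl// !(mulrC (_ (dotr z xi))).
have -> : \int[lebn]_x (g x * sin (dotr x xi)) =
    b * cos (dotr z xi) - a * sin (dotr z xi) - b.
  transitivity (\int[lebn]_x (fk k (x + z) * sin (dotr (x + z) xi - dotr z xi) -
      fk k x * sin (dotr x xi))).
    by apply: eq_Rintegral => x _; rewrite -dE /g mulrBl.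
  rewrite RintegralB// Ts mul1r; congr (_ - _).
  transitivity (\int[lebn]_x (cos (dotr z xi) * (fk k x * sin (dotr x xi)) -
      sin (dotr z xi) * (fk k x * cos (dotr x xi)))).
    by apply: eq_Rintegral => x _; rewrite sinB; ring.
  rewrite RintegralB//; [|exact: intgZ|exact: intgZ].
  by rewrite !RintegralZl// !(mulrC (_ (dotr z xi))).
have := cos2Dsin2 (dotr z xi); set c := cos _; set t := sin _ => ct.
transitivity ((a ^+ 2 + b ^+ 2) * (c ^+ 2 + t ^+ 2) - 2 * c * (a ^+ 2 + b ^+ 2) +
  (a ^+ 2 + b ^+ 2)); first by ring.
by rewrite ct; ring.
Qed.

(** Stated for any [h] dominated by the increments of all large truncations, so that it applies to
    the increment of a single piece of [f]; the constant C depends neither on [z] nor on [h] and is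
    therefore common to all pieces. *)
Lemma sobolev_translation (s : R) : 0 < s -> sobolev s f ->
  exists2 C, 0 <= C & forall (z : 'rV[R]_n) (h : 'rV[R]_n -> R),
    measurable_fun setT h ->
    (\forall k \near \oo, forall x, `|h x| <= `|fk k (x + z) - fk k x|) ->
    \int[lebn]_x (h x ^+ 2) <= C * (enorm z ^+ 2) `^ (Num.min s 1).
Proof.
move=> s0 [_ [Fre [Fim [[/Lfun2_sqr[mFre IFre] /Lfun2_sqr[mFim IFim] cre cim]]]]].
move=> /Lfun2_sqr[_ Wre] /Lfun2_sqr[_ Wim].
set s1 := Num.min s 1.
have s10 : 0 < s1 by rewrite lt_min s0 ltr01.
have s11 : s1 <= 1 by rewrite ge_min lexx orbT.
pose p (xi : 'rV[R]_n) := 1 + enorm xi ^+ 2.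
have p1 xi : 1 <= p xi by rewrite lerDl sqr_ge0.
have p0 xi : 0 <= p xi by rewrite (le_trans ler01).
have sqE (F : 'rV[R]_n -> R) xi : (p xi `^ (s / 2) * F xi) ^+ 2 = p xi `^ s * F xi ^+ 2.
  rewrite exprMn expr2 -powRD; first by rewrite -splitr.
  by apply/implyP => _; rewrite gt_eqF// (lt_le_trans ltr01).
pose S := \int[lebn]_xi (p xi `^ s * Fre xi ^+ 2) + \int[lebn]_xi (p xi `^ s * Fim xi ^+ 2).
have IWre : lebn.-integrable setT (EFin \o (fun xi => p xi `^ s * Fre xi ^+ 2)).
  by move: Wre; apply: eq_integrable => // xi _ /=; rewrite sqE.
have IWim : lebn.-integrable setT (EFin \o (fun xi => p xi `^ s * Fim xi ^+ 2)).
  by move: Wim; apply: eq_integrable => // xi _ /=; rewrite sqE.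
pose m := (\int[@lebesgue_measure R]_v fejer v) ^+ n.
have m0 : 0 < m by rewrite exprn_gt0// Rint_fejer_gt0.
have S0 : 0 <= S.
  by apply: addr_ge0; apply: Rintegral_ge0 => xi _; rewrite mulr_ge0 ?powR_ge0 ?sqr_ge0.
exists (8 * S / m); first by rewrite !mulr_ge0// invr_ge0 ltW.
move=> z h mh hf; set Z := (enorm z ^+ 2) `^ s1.
have Z0 : 0 <= Z by exact: powR_ge0.
rewrite mulrAC ler_pdivlMr// mulrC; apply/ler_addgt0Pr => e e0.
(* The squared L^2 errors of the real and the imaginary part each enter the bound [RHS] below with a
   factor 8. *)
have e16 : 0 < e / 16 by rewrite divr_gt0.
have mre k : measurable_fun setT (fourier_re f k).
  rewrite (_ : fourier_re f k = fun xi => \int[lebn]_x (fk k x * cos (dotr x xi))).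
    apply: measurable_fourier_integral => //; [exact: measurable_cos|exact: normr_cos].
  by apply/funext => xi; rewrite fourier_reE.
have mim k : measurable_fun setT (fourier_im f k).
  rewrite (_ : fourier_im f k = fun xi => - \int[lebn]_x (fk k x * sin (dotr x xi))).
    apply: measurable_funN.
    apply: measurable_fourier_integral => //; [exact: measurable_sin|exact: normr_sin].
  by apply/funext => xi; rewrite fourier_imE.
have Ere := L2_norm_cvg0 (fun k => measurable_funB mFre (mre k)) cre e16.
have Eim := L2_norm_cvg0 (fun k => measurable_funB mFim (mim k)) cim e16.
have [k [[IEre Lre] [IEim Lim] hk]] : exists k, [/\
    lebn.-integrable setT (EFin \o (fun xi => (Fre xi - fourier_re f k xi) ^+ 2)) /\
      \int[lebn]_xi ((Fre xi - fourier_re f k xi) ^+ 2) <= e / 16,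
    lebn.-integrable setT (EFin \o (fun xi => (Fim xi - fourier_im f k xi) ^+ 2)) /\
      \int[lebn]_xi ((Fim xi - fourier_im f k xi) ^+ 2) <= e / 16 &
    forall x, `|h x| <= `|fk k (x + z) - fk k x|].
  near \oo => k; exists k; split; by near: k.
pose g x := fk k (x + z) - fk k x.
have st := translation_scaling z.
have Ig : lebn.-integrable setT (EFin \o g).
  by apply: intgB; [exact: (integrable_scaling ler01 st (Ifk k))|exact: Ifk].
have cg : continuous g.
  apply: continuous_fB => //.
  exact: (@continuous_composition _ _ _ (fun x : 'rV[R]_n => x + z) (fk k) (@continuous_addr _ _ z) (@cfk k)).
have gB x : `|g x| <= B + B by rewrite (le_trans (ler_normB _ _))// lerD.
have Igsq : lebn.-integrable setT (EFin \o (fun x => g x ^+ 2)).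
  exact: (intg_mulb Ig (intg_measurable Ig) gB).
have hg x : h x ^+ 2 <= g x ^+ 2.
  by rewrite -real_normK ?num_real// -[leRHS]real_normK ?num_real// lerXn2r ?nnegrE.
have Ih : lebn.-integrable setT (EFin \o (fun x => h x ^+ 2)).
  apply: (intg_le _ _ Igsq) => [|x]; first exact: measurable_funX.
  by rewrite ger0_norm ?sqr_ge0.
apply: (@le_trans _ _ (m * \int[lebn]_x (g x ^+ 2))).
  by rewrite ler_wpM2l ?(ltW m0)//; exact: (Rint_le Ih Igsq hg).
apply: (plancherel_le cg Ig gB) => a a0.
under eq_Rintegral do rewrite fourier_shift.
(* From r^2 <= 2 F^2 + 2 (F - r)^2, where the factor 2 - 2 cos(z.xi) is bounded by 4 Z p^s on the
   first term and by 4 on the second. *)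
pose RHS xi := 8 * Z * (p xi `^ s * Fre xi ^+ 2) + 8 * Z * (p xi `^ s * Fim xi ^+ 2) +
  (8 * (Fre xi - fourier_re f k xi) ^+ 2 + 8 * (Fim xi - fourier_im f k xi) ^+ 2).
have I1 := intgD (intgZ (8 * Z) IWre) (intgZ (8 * Z) IWim).
have I2 := intgD (intgZ 8 IEre) (intgZ 8 IEim).
have IR : lebn.-integrable setT (EFin \o RHS) by exact: intgD.
have bound xi : 0 <= rVprod hat (a *: xi) * ((2 - 2 * cos (dotr z xi)) *
     (fourier_re f k xi ^+ 2 + fourier_im f k xi ^+ 2)) <= RHS xi.
  have w0 : 0 <= rVprod hat (a *: xi) by apply: prodr_ge0 => i _; exact: hat_ge0.
  have w1 : rVprod hat (a *: xi) <= 1.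
    by apply: prodr_ile1 => i _; rewrite hat_ge0 hat_le1.
  set v := 2 - 2 * cos (dotr z xi).
  have v0 : 0 <= v by rewrite /v; have := cos_le1 (dotr z xi); lra.
  have v4 : v <= 4 by rewrite /v; have := cos_geN1 (dotr z xi); lra.
  have vZ : v <= 4 * Z * p xi `^ s.
    apply: (le_trans (one_sub_cos_powR _ s10 s11)).
    rewrite -mulrA ler_wpM2l// (@le_trans _ _ (Z * p xi `^ s1))//; last first.
      by rewrite ler_wpM2l// ler_powR// ge_min lexx.
    rewrite /Z -powRM ?sqr_ge0//; apply: ge0_ler_powR.
    - exact: ltW.
    - by rewrite nnegrE sqr_ge0.
    - by rewrite nnegrE mulr_ge0 ?sqr_ge0.
    - by rewrite (le_trans (dotr_sqr_le _ _))// ler_wpM2l ?sqr_ge0// lerDr.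
  have q0 : 0 <= fourier_re f k xi ^+ 2 + fourier_im f k xi ^+ 2.
    by rewrite addr_ge0 ?sqr_ge0.
  rewrite mulr_ge0 ?mulr_ge0//=.
  apply: (@le_trans _ _ (v * (fourier_re f k xi ^+ 2 + fourier_im f k xi ^+ 2))).
    by rewrite ler_piMl// mulr_ge0.
  rewrite /RHS; set P := p xi `^ s in vZ *.
  move: (fourier_re f k xi) (fourier_im f k xi) (Fre xi) (Fim xi) => r i F G.
  have k1 : r ^+ 2 <= 2 * F ^+ 2 + 2 * (F - r) ^+ 2.
    rewrite -subr_ge0 (_ : _ - _ = (2 * F - r) ^+ 2); [exact: sqr_ge0|ring].
  have k2 : i ^+ 2 <= 2 * G ^+ 2 + 2 * (G - i) ^+ 2.
    rewrite -subr_ge0 (_ : _ - _ = (2 * G - i) ^+ 2); [exact: sqr_ge0|ring].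
  apply: (@le_trans _ _ (v * (2 * F ^+ 2 + 2 * (F - r) ^+ 2 + (2 * G ^+ 2 + 2 * (G - i) ^+ 2)))).
    by rewrite ler_wpM2l// lerD.
  have j1 := ler_wpM2r (addr_ge0 (sqr_ge0 F) (sqr_ge0 G)) vZ.
  have j2 := ler_wpM2r (addr_ge0 (sqr_ge0 (F - r)) (sqr_ge0 (G - i))) v4.
  have -> : v * (2 * F ^+ 2 + 2 * (F - r) ^+ 2 + (2 * G ^+ 2 + 2 * (G - i) ^+ 2)) =
     2 * (v * (F ^+ 2 + G ^+ 2)) + 2 * (v * ((F - r) ^+ 2 + (G - i) ^+ 2)) by ring.
  apply: (le_trans (lerD (ler_wpM2l (ler0n _ 2) j1) (ler_wpM2l (ler0n _ 2) j2))).
  by rewrite le_eqVlt; apply/orP; left; apply/eqP; ring.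
apply: (@le_trans _ _ (\int[lebn]_xi RHS xi)).
  apply: Rint_le => //; last by move=> xi; have /andP[] := bound xi.
  apply: (intg_le _ _ IR) => [|xi]; last by have /andP[b0 ?] := bound xi; rewrite ger0_norm.
  apply: measurable_funM.
    have /intg_measurable mw := intg_rVprod n (@intg_hat R).
    apply: (measurableT_comp mw); apply: measurable_fun_rV => i.
    rewrite (_ : (fun _ => _) = fun x : 'rV[R]_n => a * x 0 i).
      by apply: measurable_funM => //; exact: measurable_rV_coor.
    by apply/funext => x; rewrite !mxE.
  apply: measurable_funM; last by apply: measurable_funD; exact: measurable_funX.
  apply: measurable_funB => //; apply: measurable_funM => //.
  by apply: (measurableT_comp measurable_cos); exact: measurable_dotr2.
rewrite /RHS RintegralD// RintegralD//; [|exact: intgZ|exact: intgZ].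
rewrite RintegralD//; [|exact: intgZ|exact: intgZ].
rewrite !RintegralZl//.
rewrite -mulrDr -/S lerD//; first by rewrite le_eqVlt; apply/orP; left; apply/eqP; ring.
exact: eighths_le.
Unshelve. all: by end_near. Qed.

End sobolev_translation.

(** * The initial datum *)

Section cosine_bump.
Context {R : realType} (l : R) (l0 : 0 < l).
Local Notation leb := (@lebesgue_measure R).

Definition bump_width : R := pi / 2 / l.
Local Notation w := bump_width.

(** Freezing the argument at the first zeros of cos (t l) makes positive powers of the cosine vanish
    outside one arch, and keeps them continuous without a case distinction. *)
Definition bump_clamp (t : R) : R := Num.min (Num.max t (- w)) w.

(** An even power of one arch of the cosine: its Fourier transform satisfies a two-term recursion in
    [m] and decays at least like (1 + v^2)^-m, so finite smoothness of any order is reached by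
    explicit formulas. *)
Definition cos_bump (m : nat) (t : R) : R := cos (bump_clamp t * l) ^+ m.*2.

Lemma bump_width_gt0 : 0 < w.
Proof. by rewrite /bump_width !divr_gt0// pi_gt0. Qed.

Lemma bump_clamp_id t : `|t| <= w -> bump_clamp t = t.
Proof.
rewrite ler_norml => /andP[t1 t2]; rewrite /bump_clamp max_l//.
by rewrite min_l.
Qed.

Lemma cos_bump_ge0 m t : 0 <= cos_bump m t.
Proof. by rewrite /cos_bump -muln2 exprM sqr_ge0. Qed.

Lemma cos_bump_le1 m t : cos_bump m t <= 1.
Proof.
rewrite -(ger0_norm (cos_bump_ge0 m t)) /cos_bump normrX.
by rewrite exprn_ile1// normr_cos.
Qed.

Lemma cos_bumpN m t : cos_bump m (- t) = cos_bump m t.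
Proof.
have w0 := bump_width_gt0.
rewrite /cos_bump (_ : bump_clamp (- t) = - bump_clamp t) ?mulNr ?cosN//.
rewrite /bump_clamp; have [tw|tw] := leP (- t) (- w).
  rewrite (@max_l _ _ t) 1?(@min_l _ _ (- w) w) 1?(@min_r _ _ t w)//; lra.
have [tw'|tw'] := leP t (- w).
  rewrite (@min_r _ _ (- t)) 1?(@min_l _ _ (- w) w); lra.
by rewrite (@min_l _ _ (- t)) 1?(@min_l _ _ t)//; lra.
Qed.

Lemma cos_bump_out m t : w <= `|t| -> cos_bump m.+1 t = 0.
Proof.
move=> wt; have w0 := bump_width_gt0.
have wl : w * l = pi / 2 by rewrite /bump_width divfK// gt_eqF.
rewrite /cos_bump; move: wt; rewrite ler_normr => /orP[wt|wt].
  rewrite /bump_clamp max_l; last lra.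
  by rewrite min_r// wl cos_pihalf expr0n.
rewrite /bump_clamp max_r; last lra.
by rewrite min_l ?mulNr ?cosN ?wl ?cos_pihalf ?expr0n//; lra.
Qed.

Lemma continuous_cos_bump m : continuous (cos_bump m).
Proof.
have cc : continuous bump_clamp.
  move=> x; apply: (@continuous_min _ _ (fun t => Num.max t (- w)) (fun=> w)).
    by apply: (@continuous_max _ _ id (fun=> - w)); [exact: cvg_id|exact: cvg_cst].
  exact: cvg_cst.
rewrite /cos_bump => x; apply: (@continuous_composition _ _ _ (fun t : R => cos (bump_clamp t * l)) (fun y => y ^+ m.*2)).
  apply: (@continuous_composition _ _ _ bump_clamp (fun y : R => cos (y * l))) => //.
  exact: continuous_cosZ.
exact: exprn_continuous.
Qed.

Lemma measurable_cos_bump m : measurable_fun setT (cos_bump m).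
Proof. by apply: continuous_measurable_fun; exact: continuous_cos_bump. Qed.

Lemma intg_cos_bump m : leb.-integrable setT (EFin \o cos_bump m.+1).
Proof.
have w0 := bump_width_gt0.
apply: (@intg_le _ _ _ leb (cos_bump m.+1) (fun t => (1 + w ^+ 2) * (1 + t ^+ 2)^-1)).
- exact: measurable_cos_bump.
- move=> t; rewrite ger0_norm ?cos_bump_ge0//.
  have p1 : 0 < 1 + t ^+ 2 by rewrite ltr_pwDl ?sqr_ge0.
  have [wt|wt] := leP w `|t|.
    by rewrite cos_bump_out// divr_ge0 ?addr_ge0 ?sqr_ge0// ltW.
  rewrite (le_trans (cos_bump_le1 _ _))// ler_pdivlMr// mul1r lerD2l.
  by rewrite -[leLHS]real_normK ?num_real// lerXn2r ?nnegrE// ltW.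
- by apply: intgZ; exact: intg_oneDsqrV.
Qed.

(** An integral over the arch, and not the transform of [cos_bump], so that it makes sense for m = 0
    too, where the recursion starts and [cos_bump] is not compactly supported. *)
Definition cos_moment (m : nat) (v : R) : R :=
  \int[leb]_(t in `[- w, w]) (cos (t * l) ^+ m.*2 * cos (t * v)).

Lemma cos_transform_bump m v : cos_transform (cos_bump m.+1) v = cos_moment m.+1 v.
Proof.
rewrite /cos_transform /cos_moment [RHS]Rintegral_mkcond; apply: eq_Rintegral => t _.
rewrite patchE; case: ifPn => [|].
  by rewrite inE /= in_itv /= -ler_norml => tw; rewrite /cos_bump bump_clamp_id.
rewrite notin_setE /= in_itv /= -ler_norml => /negP; rewrite -ltNge => /ltW tw.
by rewrite cos_bump_out ?mul0r.
Qed.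

Lemma is_derive_exprS (f : R -> R) (df x : R) n : is_derive x (1 : R) f df ->
  is_derive x (1 : R) (fun t => f t ^+ n.+1) (n.+1%:R * f x ^+ n * df).
Proof.
move=> Df; have D := @is_deriveX R R f n.+1 x 1 df Df.
by rewrite exprfctE in D; apply: (is_derive_eq D).
Qed.

Lemma continuous_moment_integrand m v :
  continuous (fun t : R => cos (t * l) ^+ m.*2 * cos (t * v)).
Proof.
apply: continuous_fM; last exact: continuous_cosZ.
apply: (@continuous_composition _ _ _ (fun t : R => cos (t * l)) (fun y => y ^+ m.*2)).
  exact: continuous_cosZ.
exact: exprn_continuous.
Qed.

Lemma intg_moment m v :
  leb.-integrable `[- w, w] (EFin \o (fun t => cos (t * l) ^+ m.*2 * cos (t * v))).
Proof.
apply: continuous_compact_integrable; first exact: segment_compact.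
by apply: continuous_subspaceT; exact: continuous_moment_integrand.
Qed.

(* Two integrations by parts; F below is the resulting antiderivative. *)
Lemma cos_momentS m v : let N := m.*2.+2%:R : R in
  (v ^+ 2 - l ^+ 2 * N ^+ 2) * cos_moment m.+1 v +
  l ^+ 2 * N * (N - 1) * cos_moment m v = 0.
Proof.
move=> N; have w0 := bump_width_gt0.
have wl : w * l = pi / 2 by rewrite /bump_width divfK// gt_eqF.
pose F t := v * (cos (t * l) ^+ m.*2.+2 * sin (t * v)) -
  l * N * (cos (t * l) ^+ m.*2.+1 * sin (t * l) * cos (t * v)).
pose f t := (v ^+ 2 - l ^+ 2 * N ^+ 2) * (cos (t * l) ^+ m.+1.*2 * cos (t * v)) +
  l ^+ 2 * N * (N - 1) * (cos (t * l) ^+ m.*2 * cos (t * v)).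
have mitv : measurable (`[- w, w]%classic : set (measurableTypeR R)) by exact: measurable_itv.
transitivity (\int[leb]_(t in `[- w, w]) f t).
  rewrite /f RintegralD//; last 2 first.
  - exact: (integrableZl _ _ (intg_moment _ _)).
  - exact: (integrableZl _ _ (intg_moment _ _)).
  by rewrite !RintegralZl//; exact: intg_moment.
rewrite (_ : 0 = F w - F (- w)); last first.
  by rewrite /F mulNr cosN wl cos_pihalf !expr0n !mul0r !mulr0 !subrr.
apply: Rint_FTC.
- by rewrite gtrN.
- move=> x; have ds := is_derive_sinZ v x; have dc := is_derive_cosZ v x.
  have dsl := is_derive_sinZ l x; have dcl := is_derive_cosZ l x.
  have d2 := is_derive_exprS m.*2.+1 dcl; have d1 := is_derive_exprS m.*2 dcl.
  apply: is_derive_eq; rewrite /GRing.scale /= /f doubleS.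
  have := cos2Dsin2 (x * l); set c := cos (x * l); set s := sin (x * l) => cs.
  have -> : c ^+ m.*2.+2 = c ^+ m.*2 * (1 - s ^+ 2).
    by rewrite -cs addrK -exprD addn2.
  have E : c ^+ m.*2.+1 = c ^+ m.*2 * c by rewrite exprSr.
  rewrite E.
  have -> : (m.*2.+1%:R : R) = N - 1 by rewrite /N -[m.*2.+2]addn1 natrD addrK.
  have s2 : s ^+ 2 = 1 - c ^+ 2 by rewrite -cs addrC addKr.
  rewrite -[m.*2.+2%:R]/N.
  move: (sin (x * v)) (cos (x * v)) (c ^+ m.*2) (N) => S K P N'.
  ring: s2.
- apply: continuous_fD; apply: continuous_fM => //; try exact: continuous_fcst;
    exact: continuous_moment_integrand.
Qed.

Lemma cos_moment_bounded m v : `|cos_moment m v| <= 2 * w.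
Proof.
have w0 := bump_width_gt0.
have mitv : measurable (`[- w, w]%classic : set (measurableTypeR R)) by exact: measurable_itv.
apply: (le_trans (le_normr_Rintegral mitv (intg_moment m v))).
have I1 : leb.-integrable `[- w, w] (EFin \o (fun=> 1 : R)).
  apply: continuous_compact_integrable; first exact: segment_compact.
  by apply: continuous_subspaceT; exact: continuous_fcst.
apply: (@le_trans _ _ (\int[leb]_(t in `[- w, w]) 1)).
  apply: le_Rintegral => //; first exact: (integrable_norm (intg_moment m v)).
  by move=> t _; rewrite normrM mulr_ile1// ?normr_cos// normrX exprn_ile1// normr_cos.
rewrite Rintegral_cst// mul1r /= lebesgue_measure_itv /= lte_fin (gtrN w0) /=.
by rewrite opprK mulr2n mulrDl mul1r.
Qed.

(** For large v each step of the recursion gains a factor 1 / (1 + v^2); bounded v is absorbed by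
    the constant, using the trivial bound on the moment. *)
Lemma cos_moment_decay m : exists2 C, 0 <= C &
  forall v, `|cos_moment m v| <= C / (1 + v ^+ 2) ^+ m.
Proof.
have w0 := bump_width_gt0.
elim: m => [|m [C C0 IH]].
  exists (2 * w); first by rewrite mulr_ge0// ltW.
  by move=> v; rewrite expr0 divr1; exact: cos_moment_bounded.
set N := m.*2.+2%:R : R.
have N1 : 1 <= N by rewrite /N ler1n.
have NN : 0 <= l ^+ 2 * N * (N - 1).
  by rewrite -mulrA mulr_ge0 ?sqr_ge0// mulr_ge0 ?subr_ge0// (le_trans ler01).
(* Chosen so that b <= v^2 says exactly that the coefficient v^2 - l^2 N^2 of the recursion is at
   least (1 + v^2) / 2. *)
pose b := 2 * l ^+ 2 * N ^+ 2 + 1.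
have b0 : 0 < b by rewrite ltr_wpDl// -mulrA mulr_ge0 // mulr_ge0 ?sqr_ge0.
exists (Num.max (2 * (l ^+ 2 * N * (N - 1)) * C) (2 * w * (1 + b) ^+ m.+1)).
  by rewrite le_max; apply/orP; left; rewrite mulr_ge0// mulr_ge0.
move=> v; have p1 : 0 < 1 + v ^+ 2 by rewrite ltr_pwDl ?sqr_ge0.
have pm k : 0 < (1 + v ^+ 2) ^+ k by rewrite exprn_gt0.
rewrite ler_pdivlMr//; have [vb|vb] := leP b (v ^+ 2); last first.
  rewrite le_max; apply/orP; right; apply: ler_pM => //.
  - exact: ltW.
  - exact: cos_moment_bounded.
  - apply: lerXn2r; rewrite ?nnegrE ?(ltW p1)//; first by rewrite addr_ge0// ltW.
    by rewrite lerD2l ltW.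
rewrite le_max; apply/orP; left.
have D0 : (1 + v ^+ 2) / 2 <= v ^+ 2 - l ^+ 2 * N ^+ 2 by move: vb; rewrite /b; lra.
have Dp : 0 < v ^+ 2 - l ^+ 2 * N ^+ 2 by rewrite (lt_le_trans _ D0)// divr_gt0.
have := cos_momentS m v; rewrite /= -/N => /eqP; rewrite addr_eq0 => /eqP E.
have E' : (v ^+ 2 - l ^+ 2 * N ^+ 2) * `|cos_moment m.+1 v| =
    (l ^+ 2 * N * (N - 1)) * `|cos_moment m v|.
  by rewrite -{1}(gtr0_norm Dp) -normrM E normrN normrM ger0_norm.
have H1 : (1 + v ^+ 2) / 2 * `|cos_moment m.+1 v| <=
    (l ^+ 2 * N * (N - 1)) * `|cos_moment m v| by rewrite -E' ler_wpM2r.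
have H2 : `|cos_moment m v| * (1 + v ^+ 2) ^+ m <= C by rewrite -ler_pdivlMr.
rewrite exprS mulrCA mulrA.
apply: (@le_trans _ _ (2 * (l ^+ 2 * N * (N - 1)) * (`|cos_moment m v| * (1 + v ^+ 2) ^+ m))).
  rewrite [leRHS]mulrA ler_wpM2r ?(ltW (pm m))//; move: H1; lra.
by rewrite ler_wpM2l// mulr_ge0.
Qed.

End cosine_bump.

(** * Sums of pieces supported in disjoint annuli *)

Section annular_sum.
Context {R : realType} {n : nat}.
Local Notation lebn := (lebesgue_rV R n).
Implicit Types F : nat -> 'rV[R]_n -> R.

(* Half-integer radii: the pieces stay within 1/2 of these spheres, so truncating the sum to a
   ball of integer radius keeps or drops each piece as a whole. *)
Definition shell_radius (k : nat) : R := 4 * k%:R + 9 / 2.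

Definition annular F := forall k x, F k x != 0 ->
  `|enorm x - shell_radius k| < 1 / 2.

(* The sum has at most one nonzero term, of index less than |x|. *)
Definition annular_sum F (x : 'rV[R]_n) : R :=
  \sum_(k < (Num.truncn (enorm x)).+1) F k x.

Lemma sum_ord_widen (V : nmodType) (f : nat -> V) (a b : nat) : (a <= b)%N ->
  (forall k, (a <= k)%N -> f k = 0) -> \sum_(k < a) f k = \sum_(k < b) f k.
Proof.
move=> ab f0; rewrite -(big_mkord xpredT f) -(big_mkord xpredT f).
rewrite [RHS](big_cat_nat (leq0n a) ab)/= [X in _ = _ + X]big1_seq ?addr0// => k.
by rewrite mem_index_iota => /andP[_ /andP[ak _]]; exact: f0.
Qed.

Lemma sum_ord_le (f : nat -> R) (a b : nat) : (a <= b)%N -> (forall k, 0 <= f k) ->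
  \sum_(k < a) f k <= \sum_(k < b) f k.
Proof.
move=> ab f0; rewrite -(big_mkord xpredT f) -(big_mkord xpredT f).
by rewrite [leRHS](big_cat_nat (leq0n a) ab)/= lerDl sumr_ge0.
Qed.

Lemma annular_bounds F k x : annular F -> F k x != 0 ->
  (4 * k + 4)%N%:R < enorm x < (4 * k + 5)%N%:R.
Proof.
move=> aF /aF; rewrite ltr_norml /shell_radius !natrD ?natrM => /andP[h1 h2].
by apply/andP; split; lra.
Qed.

Lemma annular_eq0 F j k x : annular F -> F k x != 0 -> j != k -> F j x = 0.
Proof.
move=> aF Fk jk; apply/eqP/negPn/negP => Fj; have /eqP := jk; apply.
have /andP[a1 a2] := annular_bounds aF Fk; have /andP[b1 b2] := annular_bounds aF Fj.
have := lt_trans a1 b2; have := lt_trans b1 a2; rewrite !ltr_nat; lia.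
Qed.

Lemma annular_sumE F N x : annular F -> (Num.truncn (enorm x) < N)%N ->
  annular_sum F x = \sum_(k < N) F k x.
Proof.
move=> aF xN; apply: (@sum_ord_widen _ (F^~ x) _ _ xN) => k xk.
apply/eqP/negPn/negP => /(annular_bounds aF)/andP[h _].
have := lt_trans h (truncnS_gt (enorm x)); rewrite ltr_nat.
by move: (Num.truncn (enorm x)) xk => q; clear; lia.
Qed.

Lemma annular_sum_single F k x : annular F -> F k x != 0 -> annular_sum F x = F k x.
Proof.
move=> aF Fk; rewrite (@annular_sumE _ (maxn k (Num.truncn (enorm x))).+1)//; last lia.
have kN : (k < (maxn k (Num.truncn (enorm x))).+1)%N by lia.
rewrite (bigD1 (Ordinal kN))//= big1 ?addr0// => i ik.
by apply: (annular_eq0 aF Fk); apply: contra ik => /eqP ik; apply/eqP/val_inj.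
Qed.

(** Piece k lives in 4k + 4 < |x| < 4k + 5. A ball of radius j contains it if 4k + 5 <= j, that is,
    k < (j - 1) / 4 with integer division, and otherwise misses it altogether because then 4k + 4 >=
    j. *)
Lemma annular_sum_trunc F (j : nat) x : annular F ->
  (if enorm x <= j%:R then annular_sum F x else 0) = \sum_(k < (j.-1 %/ 4)%N) F k x.
Proof.
move=> aF; case: ifPn => [xj|]; last first.
  rewrite -ltNge => jx; apply/esym/big1 => k _.
  apply/eqP/negPn/negP => /(annular_bounds aF)/andP[_ h].
  have := lt_trans jx h; rewrite ltr_nat.
  have := ltn_ord k; have := leq_trunc_div j.-1 4; lia.
rewrite (@annular_sumE _ (maxn (j.-1 %/ 4) (Num.truncn (enorm x))).+1)//; last lia.
apply/esym/(@sum_ord_widen _ (F^~ x)) => [|k jk]; first lia.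
apply/eqP/negPn/negP => /(annular_bounds aF)/andP[h _].
have := lt_le_trans h xj; rewrite ltr_nat; have := ltn_ceil j.-1 (isT : (0 < 4)%N); lia.
Qed.

Lemma annular_sum_bounded F B : 0 <= B -> annular F -> (forall k x, `|F k x| <= B) ->
  forall x, `|annular_sum F x| <= B.
Proof.
move=> B0 aF FB x; have [[k Fk]|Fx] := pselect (exists k, F k x != 0).
  by rewrite (annular_sum_single aF Fk).
rewrite /annular_sum big1 ?normr0// => k _.
by apply/eqP/negPn/negP => Fk; apply: Fx; exists k.
Qed.

Lemma annular_sum_cvg F x : annular F ->
  (\sum_(k < N) F k x @[N --> \oo]) --> annular_sum F x.
Proof.
move=> aF; apply: cvg_near_cst; exists (Num.truncn (enorm x)).+1 => // N /= xN.
by rewrite -annular_sumE.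
Qed.

Lemma measurable_annular_sum F : annular F -> (forall k, measurable_fun setT (F k)) ->
  measurable_fun setT (annular_sum F).
Proof.
move=> aF mF; apply: (@measurable_fun_cvg _ _ _ _ (fun N x => \sum_(k < N) F k x)).
  by move=> N; apply: measurable_sum => k; exact: mF.
by move=> x _; exact: annular_sum_cvg.
Qed.

Lemma intg_annular_sum F (a : R) : annular F ->
  (forall k, lebn.-integrable setT (EFin \o F k)) -> (forall k x, 0 <= F k x) ->
  (forall k, \int[lebn]_x F k x <= a / 2 ^+ k) ->
  lebn.-integrable setT (EFin \o annular_sum F).
Proof.
move=> aF IF F0 Fa; have mF k : measurable_fun setT (F k) := intg_measurable (IF k).
have a0 : 0 <= a.
  by have := Fa 0; rewrite expr0 divr1; apply: le_trans; apply: Rintegral_ge0.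
apply: (@ge0_intg _ _ _ lebn _ (2 * a)); first exact: measurable_annular_sum.
  by move=> x; rewrite /annular_sum sumr_ge0.
have -> : (\int[lebn]_x (annular_sum F x)%:E =
    \int[lebn]_x limn (fun N => (\sum_(k < N) F k x)%:E))%E.
  apply: eq_integral => x _; apply/esym/cvg_lim => //.
  by apply: cvg_EFin; [exact: nearW|exact: annular_sum_cvg].
rewrite monotone_convergence//; last first.
- move=> x _ N M NM; rewrite lee_fin; exact: (@sum_ord_le (F^~ x)).
- by move=> N x _; rewrite lee_fin sumr_ge0.
- by move=> N; apply/measurable_EFinP; apply: measurable_sum => k; exact: mF.
apply: lime_le.
  apply: ereal_nondecreasing_is_cvgn => N M NM; apply: ge0_le_integral => //.
  - by move=> x _; rewrite lee_fin sumr_ge0.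
  - by apply/measurable_EFinP; apply: measurable_sum => k; exact: mF.
  - by apply/measurable_EFinP; apply: measurable_sum => k; exact: mF.
  - move=> x _; rewrite lee_fin; exact: (@sum_ord_le (F^~ x)).
apply: nearW => N; rewrite Rint_EFin ?lee_fin; last by apply: intg_sum => k; exact: IF.
rewrite Rint_sum//; apply: (@le_trans _ _ (\sum_(k < N) a / 2 ^+ k)).
  by apply: ler_sum => k _.
suff -> : \sum_(k < N) a / 2 ^+ k = 2 * a - 2 * a / 2 ^+ N.
  by rewrite gerBl divr_ge0 ?mulr_ge0// exprn_ge0.
elim: N => [|N IH]; first by rewrite big_ord0 expr0 divr1 subrr.
rewrite big_ord_recr /= IH exprS; field.
by rewrite expf_neq0.
Qed.

End annular_sum.

Section L2.
Context {R : realType} {n : nat}.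
Local Notation lebn := (lebesgue_rV R n).

Lemma Lnorm2E (g : 'rV[R]_n -> R) : lebn.-integrable setT (EFin \o (fun x => g x ^+ 2)) ->
  'N[lebn]_2%:E[(fun x => (g x)%:E)]%E = (Num.sqrt (\int[lebn]_x (g x ^+ 2)))%:E.
Proof.
move=> Ig; rewrite unlock /Lnorm.
have -> : (\int[lebn]_x (`|(g x)%:E| `^ 2) = (\int[lebn]_x (g x ^+ 2))%:E)%E.
  rewrite -(Rint_EFin Ig); apply: eq_integral => x _.
  by rewrite /= ?poweR_EFin powR_mulrn// real_normK ?num_real.
by rewrite poweR_EFin powR12_sqrt// Rintegral_ge0// => x _; exact: sqr_ge0.
Qed.

Lemma Lfun2_intro (g : 'rV[R]_n -> R) : measurable_fun setT g ->
  lebn.-integrable setT (EFin \o (fun x => g x ^+ 2)) -> g \in Lfun lebn 2%:E.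
Proof.
move=> mg Ig; rewrite inE; apply/andP; split; rewrite inE//=.
by rewrite /finite_norm (Lnorm2E Ig) ltry.
Qed.

Lemma Lnorm2_cvg0 (g : nat -> 'rV[R]_n -> R) (e : nat -> R) (P : 'rV[R]_n -> R) :
  (forall j, measurable_fun setT (g j)) ->
  lebn.-integrable setT (EFin \o (fun x => P x ^+ 2)) ->
  (forall j, 0 <= e j) ->
  (forall j x, `|g j x| <= e j * `|P x|) -> (e j @[j --> \oo] --> 0) ->
  'N[lebn]_2%:E[(fun x => (g j x)%:E)]%E @[j --> \oo] --> 0%E.
Proof.
move=> mg IP e0 gP ce.
have gP2 j x : g j x ^+ 2 <= e j ^+ 2 * P x ^+ 2.
  rewrite -real_normK ?num_real// -[P x ^+ 2]real_normK ?num_real// -exprMn.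
  by rewrite lerXn2r ?nnegrE ?mulr_ge0.
have Ig j : lebn.-integrable setT (EFin \o (fun x => g j x ^+ 2)).
  apply: (intg_le _ _ (intgZ (e j ^+ 2) IP)); first exact: measurable_funX.
  by move=> x; rewrite ger0_norm ?sqr_ge0.
under eq_fun do rewrite (Lnorm2E (Ig _)).
apply: cvg_EFin; first exact: nearW.
apply: (@squeeze_cvgr _ _ _ _ (fun=> 0) (fun j => e j * Num.sqrt (\int[lebn]_x (P x ^+ 2)))).
- apply: nearW => j; rewrite /= sqrtr_ge0 /= -[X in X * _](ger0_norm (e0 j)) -sqrtr_sqr -sqrtrM ?sqr_ge0//.
  apply: ler_wsqrtr; apply: (@le_trans _ _ (\int[lebn]_x (e j ^+ 2 * P x ^+ 2))).
    by apply: Rint_le => //; exact: intgZ.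
  by rewrite RintegralZl.
- exact: cvg_cst.
- by rewrite -[X in _ --> X](mul0r (Num.sqrt (\int[lebn]_x (P x ^+ 2)))); apply: cvgM => //; exact: cvg_cst.
Qed.

End L2.

Section enorm.
Context {R : realType} {n : nat}.
Implicit Types x y : 'rV[R]_n.

Lemma enorm_le x (c : R) : 0 <= c -> \sum_(i < n) x 0 i ^+ 2 <= c ^+ 2 -> enorm x <= c.
Proof.
by move=> c0 xc; rewrite -(ger0_norm c0) -sqrtr_sqr /enorm ler_wsqrtr.
Qed.

Lemma enormD x y : enorm (x + y) <= enorm x + enorm y.
Proof.
apply: enorm_le; first by rewrite addr_ge0// enorm_ge0.
have -> : \sum_(i < n) (x + y) 0 i ^+ 2 = enorm x ^+ 2 + 2 * dotr x y + enorm y ^+ 2.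
  rewrite !enorm_sqr /dotr mulr_sumr -!big_split /=; apply: eq_bigr => i _.
  by rewrite mxE; ring.
have xy : dotr x y <= enorm x * enorm y.
  apply: (le_trans (ler_norm _)); rewrite -(ger0_norm (mulr_ge0 (enorm_ge0 x) (enorm_ge0 y))).
  by rewrite -ler_sqr ?nnegrE// !real_normK ?num_real// exprMn dotr_sqr_le.
move: xy; lra.
Qed.

Lemma enormN x : enorm (- x) = enorm x.
Proof. by rewrite /enorm; congr Num.sqrt; apply: eq_bigr => i _; rewrite mxE sqrrN. Qed.

Lemma enormB x y : enorm (x - y) = enorm (y - x).
Proof. by rewrite -opprB enormN. Qed.

Lemma enorm_dist x y : `|enorm x - enorm y| <= enorm (x - y).
Proof.
rewrite ler_norml; apply/andP; split.
  by have := enormD x (y - x); rewrite addrC subrK (enormB y); lra.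
by have := enormD y (x - y); rewrite addrC subrK; lra.
Qed.

Lemma enorm0 : enorm (0 : 'rV[R]_n) = 0.
Proof. by rewrite /enorm big1 ?sqrtr0// => i _; rewrite mxE expr0n. Qed.

Lemma coord_le_enorm x i : `|x 0 i| <= enorm x.
Proof.
rewrite -ler_sqr ?nnegrE ?enorm_ge0// real_normK ?num_real// enorm_sqr.
by rewrite (bigD1 i)//= lerDl sumr_ge0// => j _; rewrite sqr_ge0.
Qed.

Lemma enorm_delta (i : 'I_n) (a : R) : enorm (a *: delta_mx 0 i) = `|a|.
Proof.
rewrite /enorm (bigD1 i)//= big1 => [|j ji]; rewrite !mxE !eqxx /=.
  by rewrite mulr1 addr0 sqrtr_sqr.
by rewrite (negbTE ji) mulr0 expr0n.
Qed.

Lemma enorm_coord_le x (c : R) : 0 <= c -> (forall i, `|x 0 i| <= c) -> enorm x <= n%:R * c.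
Proof.
move=> c0 xc; apply: enorm_le; first by rewrite mulr_ge0.
apply: (@le_trans _ _ (\sum_(i < n) c ^+ 2)).
  apply: ler_sum => i _; rewrite -real_normK ?num_real// lerXn2r ?nnegrE//.
rewrite sumr_const card_ord -[leLHS]mulr_natl exprMn ler_wpM2r ?sqr_ge0//.
by rewrite -natrX ler_nat; nia.
Qed.

(** Controls the radial Sobolev weight by a product over the coordinates, the form in which the
    decay of the bump transform is known. *)
Lemma one_sum_le_prod I (s : seq I) (a : I -> R) : (forall i, 0 <= a i) ->
  1 + \sum_(i <- s) a i <= \prod_(i <- s) (1 + a i).
Proof.
move=> a0; elim: s => [|i s IH]; first by rewrite !big_nil addr0.
rewrite !big_cons; apply: (@le_trans _ _ ((1 + a i) * (1 + \sum_(j <- s) a j))).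
  have : 0 <= a i * \sum_(j <- s) a j by rewrite mulr_ge0// sumr_ge0.
  by rewrite mulrDr mulr1 mulrDl mul1r; lra.
by rewrite ler_wpM2l// addr_ge0.
Qed.

End enorm.

Section initial_datum.
Context {R : realType} (d : nat).
Local Notation n := d.+2.
Local Notation lebn := (lebesgue_rV R n).

(** Makes the half-width of the arch 1 / (8n), so that the product bump is supported in the
    Euclidean ball of radius 1/8. *)
Definition bump_freq : R := 4 * n%:R * pi.
Local Notation l := bump_freq.

Lemma bump_freq_gt0 : 0 < l.
Proof. by rewrite /bump_freq !mulr_gt0// pi_gt0. Qed.

Lemma bump_widthE : bump_width l = (8 * n%:R)^-1.
Proof.
have p0 : (pi : R) != 0 by rewrite gt_eqF ?pi_gt0.
have n0 : (n%:R : R) != 0 by rewrite pnatr_eq0.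
rewrite /bump_width /bump_freq; move: (pi : R) (n%:R : R) p0 n0 => p q p0 n0; field.
by rewrite n0.
Qed.

Definition bump (m : nat) (x : 'rV[R]_n) : R := rVprod (cos_bump l m.+1) x.

Lemma bump_coord m x i : bump m x != 0 -> `|x 0 i| < (8 * n%:R)^-1.
Proof.
apply: contraNT; rewrite -leNgt -bump_widthE => h.
by rewrite /bump /rVprod (bigD1 i)//= cos_bump_out ?mul0r// bump_freq_gt0.
Qed.

Lemma bump_enorm m x : bump m x != 0 -> enorm x <= 1 / 8.
Proof.
move=> xm; have n0 : 0 < (8 * n%:R)^-1 :> R by rewrite invr_gt0 mulr_gt0.
rewrite (le_trans (enorm_coord_le (ltW n0) _))//; first by move=> i; exact/ltW/bump_coord/xm.
by rewrite invfM mulrCA divff ?pnatr_eq0// mulr1 mul1r.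
Qed.

Lemma bump_ge0 m x : 0 <= bump m x.
Proof. by rewrite /bump prodr_ge0// => i _; exact: cos_bump_ge0. Qed.

Lemma bump_le1 m x : bump m x <= 1.
Proof.
rewrite /bump /rVprod; apply: prodr_ile1 => i _.
by rewrite cos_bump_ge0 cos_bump_le1.
Qed.

Lemma continuous_bump m : continuous (bump m).
Proof.
rewrite /bump /rVprod; apply: continuous_fprod => i.
apply: (@continuous_composition _ _ _ (fun x : 'rV[R]_n => x ord0 i)).
  exact: continuous_coord.
exact: (@continuous_cos_bump R l m.+1).
Qed.

Lemma intg_bump m : lebn.-integrable setT (EFin \o bump m).
Proof. by apply: intg_rVprod; exact: (intg_cos_bump bump_freq_gt0). Qed.

(** The centres lie on the diagonal of the plane of the shears, so that each of the two coordinates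
    read by the shears singles out the piece; dividing by sqrt 2 puts them at distance
    [shell_radius k] from the origin. *)
Definition center_coord (k : nat) : R := shell_radius k / Num.sqrt 2.

Definition center (k : nat) : 'rV[R]_n :=
  \row_i (if (i < 2)%N then center_coord k else 0).

Lemma shell_radius_gt0 k : 0 < shell_radius k :> R.
Proof. by rewrite /shell_radius ltr_wpDl// ?divr_gt0// mulr_ge0. Qed.

Lemma enorm_center k : enorm (center k) = shell_radius k.
Proof.
rewrite /enorm !big_ord_recl /= big1 ?addr0 => [|i _]; last by rewrite mxE /= expr0n.
rewrite !mxE /= /center_coord expr_div_n sqr_sqrtr//.
have -> : shell_radius k ^+ 2 / 2 + shell_radius k ^+ 2 / 2 = shell_radius k ^+ 2 :> R by field.
by rewrite sqrtr_sqr gtr0_norm// shell_radius_gt0.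
Qed.

Definition datum_piece (m k : nat) (x : 'rV[R]_n) : R := bump m (x - center k) / 2 ^+ k.

Lemma datum_piece_ge0 m k x : 0 <= datum_piece m k x.
Proof. by rewrite /datum_piece divr_ge0 ?bump_ge0// exprn_ge0. Qed.

Lemma datum_piece_le1 m k x : datum_piece m k x <= 1.
Proof.
rewrite /datum_piece ler_pdivrMr ?exprn_gt0// mul1r (le_trans (bump_le1 _ _))//.
by rewrite exprn_ege1// ler1n.
Qed.

Lemma datum_piece_neq0 m k x : datum_piece m k x != 0 -> bump m (x - center k) != 0.
Proof. by apply: contraNN => /eqP E; rewrite /datum_piece E mul0r. Qed.

Lemma datum_piece_enorm m k x : datum_piece m k x != 0 -> enorm (x - center k) <= 1 / 8.
Proof. by move/datum_piece_neq0/bump_enorm. Qed.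

Lemma annular_datum m : annular (datum_piece m).
Proof.
move=> k x /datum_piece_enorm xk; rewrite -enorm_center.
by rewrite (le_lt_trans (enorm_dist _ _))// (le_lt_trans xk)//; lra.
Qed.

Lemma continuous_datum_piece m k : continuous (datum_piece m k).
Proof.
rewrite /datum_piece; apply: continuous_fM; last exact: continuous_fcst.
apply: (@continuous_composition _ _ _ (fun x : 'rV[R]_n => x - center k)).
  exact: continuous_addr.
exact: continuous_bump.
Qed.

Lemma intg_datum_piece m k : lebn.-integrable setT (EFin \o datum_piece m k).
Proof.
have := intgZ (2 ^+ k)^-1 (integrable_scaling ler01 (translation_scaling (- center k)) (intg_bump m)).
by congr (_.-integrable _ (_ \o _)); apply/funext => x; rewrite /datum_piece mulrC.
Qed.

Lemma Rint_datum_piece m k :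
  \int[lebn]_x datum_piece m k x = \int[lebn]_x bump m x / 2 ^+ k.
Proof.
have st := translation_scaling (- center k).
transitivity (\int[lebn]_x ((2 ^+ k)^-1 * bump m (x - center k))).
  by apply: eq_Rintegral => x _; rewrite /datum_piece mulrC.
rewrite RintegralZl//; last exact: (integrable_scaling ler01 st (intg_bump m)).
rewrite (Rintegral_scaling ler01 st (intg_bump m)) mul1r mulrC//.
Qed.

Definition datum (m : nat) : 'rV[R]_n -> R := annular_sum (datum_piece m).

Lemma datum_bounded m x : `|datum m x| <= 1.
Proof.
apply: annular_sum_bounded => //; first exact: annular_datum.
by move=> k y; rewrite ger0_norm ?datum_piece_ge0// datum_piece_le1.
Qed.

Lemma intg_datum m : lebn.-integrable setT (EFin \o datum m).
Proof.
apply: (@intg_annular_sum _ _ _ (\int[lebn]_x bump m x)).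
- exact: annular_datum.
- exact: intg_datum_piece.
- exact: datum_piece_ge0.
- by move=> k; rewrite Rint_datum_piece.
Qed.

Lemma datum_L2 m : datum m \in Lfun lebn 2%:E.
Proof.
have mt := intg_measurable (intg_datum m).
apply: Lfun2_intro => //; exact: (intg_mulb (intg_datum m) mt (datum_bounded m)).
Qed.

Section fourier.
Variable m : nat.

Definition bump_transform (xi : 'rV[R]_n) : R :=
  \prod_(i < n) cos_transform (cos_bump l m.+1) (xi 0 i).

Lemma measurable_bump_transform : measurable_fun setT bump_transform.
Proof.
apply: measurable_prod => i _.
have mq := measurable_cos_transform (intg_cos_bump bump_freq_gt0 m).
exact: (measurableT_comp mq (measurable_rV_coor i)).
Qed.

(** All pieces are scaled translates of one bump, so the transform of the datum is that of the bump
    times the series of 2^-k exp(-i p_k.xi). These are the partial sums of that series, with [c] the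
    cosine or the sine. *)
Definition modulation (c : R -> R) (N : nat) (xi : 'rV[R]_n) : R :=
  \sum_(k < N) c (dotr (center k) xi) / 2 ^+ k.

Lemma dotrBl (x y z : 'rV[R]_n) : dotr (x - y) z = dotr x z - dotr y z.
Proof.
by rewrite /dotr -sumrB; apply: eq_bigr => i _; rewrite !mxE mulrBl.
Qed.

Lemma Rint_datum_piece_cos_sin k xi :
  \int[lebn]_x (datum_piece m k x * cos (dotr x xi)) =
    cos (dotr (center k) xi) / 2 ^+ k * bump_transform xi /\
  \int[lebn]_x (datum_piece m k x * sin (dotr x xi)) =
    sin (dotr (center k) xi) / 2 ^+ k * bump_transform xi.
Proof.
have l0 := bump_freq_gt0.
have st := translation_scaling (- center k).
have [Ec Es] := Rint_rVprod_cos_sin xi (intg_cos_bump l0 m) (cos_bumpN l0 m.+1).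
have Ic := intg_rVprod_cos xi (intg_cos_bump l0 m).
have Is := intg_rVprod_sin xi (intg_cos_bump l0 m).
have D x : dotr x xi = dotr (x - center k) xi + dotr (center k) xi.
  by rewrite dotrBl subrK.
split.
- transitivity (\int[lebn]_x ((cos (dotr (center k) xi) / 2 ^+ k) *
      (bump m (x - center k) * cos (dotr (x - center k) xi)) -
    (sin (dotr (center k) xi) / 2 ^+ k) *
      (bump m (x - center k) * sin (dotr (x - center k) xi)))).
    apply: eq_Rintegral => x _; rewrite [dotr x xi]D cosD /datum_piece.
    move: (cos _) (sin _) (cos _) (sin _) (bump _ _) => a b a' b' t.
    by move: ((2 ^+ k)^-1) => z; ring.
  rewrite RintegralB//; last 2 first.
  - by apply: intgZ; exact: (integrable_scaling ler01 st Ic).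
  - by apply: intgZ; exact: (integrable_scaling ler01 st Is).
  rewrite RintegralZl//; last exact: (integrable_scaling ler01 st Ic).
  rewrite RintegralZl//; last exact: (integrable_scaling ler01 st Is).
  rewrite (Rintegral_scaling ler01 st Ic) (Rintegral_scaling ler01 st Is).
  by rewrite Ec Es !mul1r mulr0 subr0.
- transitivity (\int[lebn]_x ((sin (dotr (center k) xi) / 2 ^+ k) *
      (bump m (x - center k) * cos (dotr (x - center k) xi)) +
    (cos (dotr (center k) xi) / 2 ^+ k) *
      (bump m (x - center k) * sin (dotr (x - center k) xi)))).
    apply: eq_Rintegral => x _; rewrite [dotr x xi]D sinD /datum_piece.
    move: (cos _) (sin _) (cos _) (sin _) (bump _ _) => a b a' b' t.
    by move: ((2 ^+ k)^-1) => z; ring.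
  rewrite RintegralD//; last 2 first.
  - by apply: intgZ; exact: (integrable_scaling ler01 st Ic).
  - by apply: intgZ; exact: (integrable_scaling ler01 st Is).
  rewrite RintegralZl//; last exact: (integrable_scaling ler01 st Ic).
  rewrite RintegralZl//; last exact: (integrable_scaling ler01 st Is).
  rewrite (Rintegral_scaling ler01 st Ic) (Rintegral_scaling ler01 st Is).
  by rewrite Ec Es !mul1r mulr0 addr0.
Qed.

Lemma fourier_datum j xi :
  fourier_re (datum m) j xi = modulation cos (j.-1 %/ 4) xi * bump_transform xi /\
  fourier_im (datum m) j xi = - (modulation sin (j.-1 %/ 4) xi * bump_transform xi).
Proof.
have E (c : R -> R) : \int[lebn]_(x in [set x | enorm x <= j%:R]) (datum m x * c (dotr x xi)) =
    \int[lebn]_x (\sum_(k < (j.-1 %/ 4)%N) datum_piece m k x * c (dotr x xi)).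
  rewrite Rintegral_mkcond; apply: eq_Rintegral => x _.
  rewrite -mulr_suml -(annular_sum_trunc _ _ (@annular_datum m)) patchE.
  by case: ifPn; rewrite ?inE ?notin_setE /= => h; [rewrite h|rewrite ifN ?mul0r//; exact/negP].
rewrite /fourier_re /fourier_im /modulation !E; split.
  rewrite Rint_sum; last by move=> k; apply: intg_cosm; [exact: intg_datum_piece|exact: measurable_dotr].
  by rewrite mulr_suml; apply: eq_bigr => k _; exact: (Rint_datum_piece_cos_sin k xi).1.
rewrite Rint_sum; last by move=> k; apply: intg_sinm; [exact: intg_datum_piece|exact: measurable_dotr].
by rewrite mulr_suml; congr (- _); apply: eq_bigr => k _; exact: (Rint_datum_piece_cos_sin k xi).2.
Qed.

Definition full_modulation (c : R -> R) xi := limn (modulation c ^~ xi).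

Lemma modulation_diff (c : R -> R) N M xi : (forall x, `|c x| <= 1) -> (N <= M)%N ->
  `|modulation c M xi - modulation c N xi| <= 2 / 2 ^+ N - 2 / 2 ^+ M.
Proof.
move=> c1 /subnK <-; elim: (M - N)%N => [|q IH]; first by rewrite add0n !subrr normr0.
rewrite addSn {1}/modulation big_ord_recr /= -/(modulation c (q + N) xi).
rewrite addrAC (le_trans (ler_normD _ _))//.
have : `|c (dotr (center (q + N)) xi) / 2 ^+ (q + N)| <= 1 / 2 ^+ (q + N).
  by rewrite normrM [`|_^-1|]ger0_norm ?invr_ge0 ?exprn_ge0// ler_wpM2r ?invr_ge0 ?exprn_ge0.
move: IH; rewrite exprS invfM; move: (2 ^+ N)^-1 (2 ^+ (q + N))^-1 => x y.
lra.
Qed.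

Lemma modulation_cvg (c : R -> R) xi : (forall x, `|c x| <= 1) ->
  modulation c N xi @[N --> \oo] --> full_modulation c xi.
Proof.
move=> c1; suff : cvgn (modulation c ^~ xi) by [].
have -> : modulation c ^~ xi = series (fun k => c (dotr (center k) xi) / 2 ^+ k).
  by apply/funext => N; rewrite /modulation /series /= big_mkord.
apply: normed_cvg.
apply: (@series_le_cvg _ _ (geometric 1 2^-1)) => //.
- by move=> k /=; exact: normr_ge0.
- by move=> k /=; rewrite mul1r exprn_ge0// invr_ge0.
- move=> k /=; rewrite normrM [`|_^-1|]ger0_norm ?invr_ge0 ?exprn_ge0// exprVn.
  by rewrite ler_wpM2r ?invr_ge0 ?exprn_ge0.
- by apply: is_cvg_geometric_series; rewrite ger0_norm ?invr_ge0// invf_lt1// ltr1n.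
Qed.

Lemma full_modulation_diff (c : R -> R) N xi : (forall x, `|c x| <= 1) ->
  `|full_modulation c xi - modulation c N xi| <= 2 / 2 ^+ N.
Proof.
move=> c1; have cc := @modulation_cvg c xi c1.
have cd : `|modulation c M xi - modulation c N xi| @[M --> \oo] -->
    `|full_modulation c xi - modulation c N xi|.
  by apply: cvg_norm; apply: cvgB => //; exact: cvg_cst.
rewrite -(cvg_lim _ cd)//; apply: limr_le; first by apply/cvg_ex; eexists; exact: cd.
exists N => // M /= NM; rewrite (le_trans (modulation_diff _ c1 NM))//.
by rewrite gerBl divr_ge0// exprn_ge0.
Qed.

Lemma measurable_modulation (c : R -> R) N : measurable_fun setT c ->
  measurable_fun setT (modulation c N).
Proof.
move=> mc; apply: measurable_sum => k; apply: measurable_funM; last exact: measurable_cst.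
apply: (measurableT_comp mc).
have := measurable_dotr (center k); congr (measurable_fun _ _).
by apply/funext => x; rewrite /dotr; apply: eq_bigr => i _; rewrite mulrC.
Qed.

Lemma measurable_full_modulation (c : R -> R) : measurable_fun setT c ->
  (forall x, `|c x| <= 1) -> measurable_fun setT (full_modulation c).
Proof.
move=> mc c1; apply: (@measurable_fun_cvg _ _ _ _ (modulation c)) => [N|xi _].
  exact: measurable_modulation.
exact: modulation_cvg.
Qed.

Lemma full_modulation_bounded (c : R -> R) xi : (forall x, `|c x| <= 1) ->
  `|full_modulation c xi| <= 2.
Proof.
move=> c1; have := @full_modulation_diff c 0 xi c1.
by rewrite /modulation big_ord0 subr0 expr0 divr1.
Qed.

Lemma bump_transform_decay : exists2 C, 0 <= C & forall xi,
  `|bump_transform xi| <= C * rVprod (fun t => (1 + t ^+ 2)^-1 ^+ m.+1) xi.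
Proof.
have [C C0 HC] := cos_moment_decay bump_freq_gt0 m.+1.
exists (C ^+ n); first by rewrite exprn_ge0.
move=> xi; rewrite /bump_transform normr_prod /rVprod.
have -> : C ^+ n = \prod_(i < n) C by rewrite prodr_const card_ord.
rewrite -big_split /=; apply: ler_prod => i _; rewrite normr_ge0 /=.
by rewrite cos_transform_bump ?bump_freq_gt0// exprVn HC.
Qed.

End fourier.

Definition cauchy_kernel (xi : 'rV[R]_n) : R := rVprod (fun t => (1 + t ^+ 2)^-1) xi.

Lemma cauchy_kernel_bounds xi : 0 <= cauchy_kernel xi <= 1.
Proof.
have p t : 0 <= (1 + t ^+ 2)^-1 :> R by rewrite invr_ge0 addr_ge0 ?sqr_ge0.
apply/andP; split; first by apply: prodr_ge0.
apply: prodr_ile1 => i _; rewrite p invf_le1 ?lerDl ?sqr_ge0//.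
by rewrite ltr_pwDl ?sqr_ge0.
Qed.

Lemma intg_cauchy_kernel_sqr :
  lebn.-integrable setT (EFin \o (fun xi => cauchy_kernel xi ^+ 2)).
Proof.
have I := intg_rVprod n (@intg_oneDsqrV R).
apply: (intg_le _ _ I) => [|xi].
  by apply: measurable_funX; exact: (intg_measurable I).
have /andP[k0 k1] := cauchy_kernel_bounds xi.
rewrite ger0_norm ?sqr_ge0// expr2 -[leRHS]mulr1.
by rewrite ler_wpM2l.
Qed.

Lemma cauchy_kernel_Lfun2 (g : 'rV[R]_n -> R) (B : R) : measurable_fun setT g ->
  (forall xi, `|g xi| <= B * cauchy_kernel xi) -> g \in Lfun lebn 2%:E.
Proof.
move=> mg gB; apply: Lfun2_intro => //.
apply: (intg_le _ _ (intgZ (B ^+ 2) intg_cauchy_kernel_sqr)).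
  exact: measurable_funX.
move=> xi; rewrite ger0_norm ?sqr_ge0// -exprMn -real_normK ?num_real//.
by rewrite lerXn2r ?nnegrE// (le_trans _ (gB xi)).
Qed.

Lemma sobolev_datum (sigma : R) : 0 < sigma -> exists m, sobolev sigma (datum m).
Proof.
(* The Sobolev weight is then at most the product of the (1 + xi_i^2)^m, and the decay of order m +
   1 of the bump transform leaves a factor 1 / (1 + xi_i^2) for each coordinate, which is square
   integrable. *)
move=> s0; pose m := (Num.truncn (sigma / 2)).+1; exists m.
have sm : sigma / 2 <= m%:R by rewrite ltW// truncnS_gt.
split; first exact: datum_L2.
have [C C0 HC] := bump_transform_decay m.
pose Fc (c : R -> R) xi := full_modulation c xi * bump_transform m xi.
have W1 (xi : 'rV[R]_n) : 1 <= 1 + enorm xi ^+ 2 by rewrite lerDl sqr_ge0.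
have W xi : (1 + enorm xi ^+ 2) `^ (sigma / 2) <= \prod_(i < n) (1 + xi 0 i ^+ 2) ^+ m.
  rewrite (le_trans (ler_powR (W1 xi) sm))// powR_mulrn ?(le_trans ler01)//.
  have WP : 1 + enorm xi ^+ 2 <= \prod_(i < n) (1 + xi 0 i ^+ 2).
    by rewrite enorm_sqr one_sum_le_prod// => i; exact: sqr_ge0.
  have W2 := le_trans (W1 xi) WP.
  by rewrite prodrXl lerXn2r ?nnegrE ?(le_trans ler01).
have W0 (xi : 'rV[R]_n) : 1 <= (1 + enorm xi ^+ 2) `^ (sigma / 2).
  by rewrite -[X in X <= _](powRr0 (1 + enorm xi ^+ 2)) ler_powR// divr_ge0// ltW.
have D xi : (1 + enorm xi ^+ 2) `^ (sigma / 2) * `|bump_transform m xi| <= C * cauchy_kernel xi.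
  apply: (@le_trans _ _ (\prod_(i < n) (1 + xi 0 i ^+ 2) ^+ m *
     (C * rVprod (fun t => (1 + t ^+ 2)^-1 ^+ m.+1) xi))).
    by apply: ler_pM => //; exact: powR_ge0.
  rewrite mulrCA; apply: ler_wpM2l => //.
  rewrite /rVprod -big_split /=; apply: ler_prod => i _.
  have p0 : 0 < 1 + xi 0 i ^+ 2 by rewrite ltr_pwDl ?sqr_ge0.
  rewrite exprS mulrCA -exprMn divff ?gt_eqF// expr1n mulr1 lexx andbT.
  by rewrite invr_ge0 ltW.
have D1 xi : `|bump_transform m xi| <= C * cauchy_kernel xi.
  by rewrite (le_trans _ (D xi))// ler_peMl.
have mW : measurable_fun setT (fun xi : 'rV[R]_n => (1 + enorm xi ^+ 2) `^ (sigma / 2)).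
  apply: (@measurableT_comp _ _ _ _ _ _ (fun t : R => t `^ (sigma / 2))).
    exact: measurable_powR.
  by apply: measurable_funD => //; apply: measurable_funX; exact: measurable_enorm.
have mF (c : R -> R) : measurable_fun setT c -> (forall x, `|c x| <= 1) -> measurable_fun setT (Fc c).
  move=> mc c1; apply: measurable_funM; last exact: measurable_bump_transform.
  exact: measurable_full_modulation.
have Fb (c : R -> R) : (forall x, `|c x| <= 1) -> forall xi, `|Fc c xi| <= 2 * `|bump_transform m xi|.
  by move=> c1 xi; rewrite normrM ler_wpM2r// full_modulation_bounded.
have L (c : R -> R) : measurable_fun setT c -> (forall x, `|c x| <= 1) -> Fc c \in Lfun lebn 2%:E.
  move=> mc c1; apply: (@cauchy_kernel_Lfun2 _ (2 * C)); first exact: mF.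
  by move=> xi; rewrite (le_trans (Fb _ c1 xi))// -mulrA ler_wpM2l.
have LW (c : R -> R) : measurable_fun setT c -> (forall x, `|c x| <= 1) ->
    (fun xi => (1 + enorm xi ^+ 2) `^ (sigma / 2) * Fc c xi) \in Lfun lebn 2%:E.
  move=> mc c1; apply: (@cauchy_kernel_Lfun2 _ (2 * C)).
    by apply: measurable_funM => //; exact: mF.
  move=> xi; rewrite normrM [X in X * _]ger0_norm ?powR_ge0//.
  apply: (@le_trans _ _ ((1 + enorm xi ^+ 2) `^ (sigma / 2) * (2 * `|bump_transform m xi|))).
    by apply: ler_wpM2l; [exact: powR_ge0|exact: Fb].
  by rewrite mulrCA -mulrA ler_wpM2l.
have e0 : (2 / 2 ^+ (j.-1 %/ 4)%N : R) @[j --> \oo] --> 0.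
  have g0 : (2 / 2 ^+ k : R) @[k --> \oo] --> 0.
    rewrite (_ : (fun k => _) = geometric 2 2^-1); last first.
      by apply/funext => k /=; rewrite exprVn.
    by apply: cvg_geometric; rewrite ger0_norm ?invr_ge0// invf_lt1// ltr1n.
  apply: (@cvg_comp _ _ _ (fun j => (j.-1 %/ 4)%N) (fun k => (2 / 2 ^+ k : R)) _ \oo) g0.
  move=> A [N _ NA]; exists (4 * N + 4)%N => // j /= jN; apply: NA => /=.
  by rewrite leq_divRL//; lia.
have mFour (c : R -> R) (j : nat) : measurable_fun setT c ->
    measurable_fun setT (fun xi => modulation c (j.-1 %/ 4) xi * bump_transform m xi).
  move=> mc; apply: measurable_funM; last exact: measurable_bump_transform.
  exact: measurable_modulation.
have Conv (c : R -> R) : measurable_fun setT c -> (forall x, `|c x| <= 1) ->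
    'N[lebn]_2%:E[(fun xi => (Fc c xi - modulation c (j.-1 %/ 4) xi * bump_transform m xi)%:E)]%E
      @[j --> \oo] --> 0%E.
  move=> mc c1; apply: (@Lnorm2_cvg0 _ _
      (fun j xi => Fc c xi - modulation c (j.-1 %/ 4) xi * bump_transform m xi)
      (fun j => C * (2 / 2 ^+ (j.-1 %/ 4)%N)) cauchy_kernel).
  - by move=> j; apply: measurable_funB; [exact: mF|exact: mFour].
  - exact: intg_cauchy_kernel_sqr.
  - by move=> j; rewrite mulr_ge0// divr_ge0// exprn_ge0.
  - move=> j xi; rewrite -mulrBl normrM mulrAC mulrC.
    have /andP[k0 _] := cauchy_kernel_bounds xi; rewrite (ger0_norm k0).
    by apply: ler_pM => //; exact: full_modulation_diff.
  - by rewrite -[X in _ --> X](mulr0 C); apply: cvgM => //; exact: cvg_cst.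
pose msin (x : R) := - sin x.
have mm : measurable_fun setT msin by apply: measurable_funN; exact: measurable_sin.
have m1 x : `|msin x| <= 1 by rewrite normrN normr_sin.
exists (Fc cos), (Fc msin); split; last 2 first.
- by apply: LW; [exact: measurable_cos|exact: normr_cos].
- exact: LW.
split.
- by apply: L; [exact: measurable_cos|exact: normr_cos].
- exact: L.
- under eq_fun => j do under eq_fun => xi do rewrite (fourier_datum m j xi).1.
  by apply: Conv; [exact: measurable_cos|exact: normr_cos].
- have E j xi : fourier_im (datum m) j xi = modulation msin (j.-1 %/ 4) xi * bump_transform m xi.
    rewrite (fourier_datum m j xi).2 -mulNr /modulation -sumrN.
    by congr (_ * _); apply: eq_bigr => k _; rewrite /msin mulNr.
  under eq_fun => j do under eq_fun => xi do rewrite E.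
  exact: Conv.
Qed.

End initial_datum.

(** * Shear flows *)

Section spline_step.
Context {R : realType}.

Definition pos (t : R) : R := Num.max 0 t.

Lemma pos_ge0 t : 0 <= pos t. Proof. by rewrite /pos le_max lexx. Qed.

Lemma continuous_pos : continuous pos.
Proof.
by move=> x; apply: (@continuous_max _ _ (fun=> 0) id); [exact: cvg_cst|exact: cvg_id].
Qed.

(** Suited to functions defined by cases: one polynomial inequality replaces the discussion of
    one-sided limits. *)
Lemma is_derive_quadratic (f : R -> R) (x df C : R) :
  (forall h, `|f (x + h) - f x - h * df| <= C * h ^+ 2) -> is_derive x (1 : R) f df.
Proof.
move=> H; have C0 : 0 <= C.
  by have := H 1; rewrite expr1n mulr1; apply: le_trans.
have L : (h^-1 *: (f (h *: (1 : R) + x) - f x) @[h --> (0 : R)^']) --> df.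
  apply/cvgrPdist_le => e e0.
  have D0 : 0 < e / (C + 1) by rewrite divr_gt0// ltr_wpDl.
  near=> h.
  have h0 : h != 0 by near: h; exact: nbhs_dnbhs_neq.
  have hC : `|h| < e / (C + 1).
    near: h; apply: (@dnbhs0_lt _ R); exact: D0.
  have -> : h *: (1 : R) + x = x + h by rewrite /GRing.scale /= mulr1 addrC.
  rewrite -normrN opprB /GRing.scale /=.
  have -> : h^-1 * (f (x + h) - f x) - df = h^-1 * (f (x + h) - f x - h * df).
    by rewrite [RHS]mulrBr mulKf.
  rewrite normrM normfV ler_pdivrMl ?normr_gt0//.
  rewrite (le_trans (H h))// -real_normK ?num_real// expr2 mulrCA ler_wpM2l//.
  move: hC; rewrite ltr_pdivlMr ?ltr_wpDl// => hC.
  have : 0 <= `|h| by []. move: hC; move: `|h| => a; nra.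
apply: DeriveDef; first by apply/cvg_ex; exists df.
by rewrite /derive; apply: cvg_lim.
Unshelve. all: by end_near. Qed.

Lemma is_derive_pos_sqr (x : R) : is_derive x (1 : R) (fun t => pos t ^+ 2) (2 * pos x).
Proof.
apply: (@is_derive_quadratic _ _ _ 1) => h; rewrite mul1r /pos.
by have [a|a] := leP 0 x; have [b|b] := leP 0 (x + h); rewrite ler_norml; apply/andP; split; nra.
Qed.

(** The quadratic spline with knots 0, 1/2, 1, a C^1 step from 0 to 1. A flow has to be
    differentiable at every time, also where one phase ends and the next begins, which rules out a
    piecewise linear step. *)
Definition spline (t : R) : R :=
  2 * (pos t ^+ 2 - 2 * pos (t - 1 / 2) ^+ 2 + pos (t - 1) ^+ 2).

Definition dspline (t : R) : R := 4 * (pos t - 2 * pos (t - 1 / 2) + pos (t - 1)).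

Lemma is_derive_comp_affine (f df : R -> R) (a b x : R) :
  (forall t : R, is_derive t (1 : R) f (df t)) ->
  is_derive x (1 : R) (fun t => f (a * t + b)) (a * df (a * x + b)).
Proof.
move=> Df; have D1 : is_derive x (1 : R) (fun t => a * t + b) a.
  apply: (@is_derive_quadratic _ _ _ 0) => h.
  by rewrite mul0r (_ : _ - _ - _ = 0) ?normr0//; ring.
have := @is_derive1_comp R f (fun t => a * t + b) x _ _ (Df _) D1.
by rewrite mulrC.
Qed.

Lemma is_derive_spline (x : R) : is_derive x (1 : R) spline (dspline x).
Proof.
have S (b : R) : is_derive x (1 : R) (fun t => pos (t - b) ^+ 2) (2 * pos (x - b)).
  have := @is_derive_comp_affine (fun t => pos t ^+ 2) _ 1 (- b) x is_derive_pos_sqr.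
  by rewrite !mul1r; under eq_fun do rewrite mul1r.
have S0 := is_derive_pos_sqr x; have S1 := S (1 / 2); have S2 := S 1.
rewrite /spline; apply: is_derive_eq; rewrite /dspline /GRing.scale /=; ring.
Qed.

Lemma continuous_dspline : continuous dspline.
Proof.
have S (b : R) : continuous (fun t => pos (t - b)).
  apply: (@continuous_composition _ _ _ (fun t => t - b) pos _ continuous_pos).
  by move=> y; apply: cvgB; [exact: cvg_id|exact: cvg_cst].
rewrite /dspline; apply: continuous_fM; first exact: continuous_fcst.
apply: continuous_fD => //; apply: continuous_fB; first exact: continuous_pos.
by apply: continuous_fM => //; exact: continuous_fcst.
Qed.

Lemma spline_le0 t : t <= 0 -> spline t = 0.
Proof. by move=> t0; rewrite /spline /pos !max_l; [ring|lra|lra|lra]. Qed.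

Lemma spline_ge1 t : 1 <= t -> spline t = 1.
Proof. by move=> t0; rewrite /spline /pos !max_r; [field|lra|lra|lra]. Qed.

Lemma dspline_out t : (t <= 0) || (1 <= t) -> dspline t = 0.
Proof.
by case/orP => t0; rewrite /dspline /pos; [rewrite !max_l|rewrite !max_r]; try lra; field.
Qed.

Lemma spline_bounds t : 0 <= spline t <= 1.
Proof.
rewrite /spline /pos; have [a|a] := leP 0 t; have [b|b] := leP 0 (t - 1 / 2);
  have [c|c] := leP 0 (t - 1); apply/andP; split; nra.
Qed.

Lemma dspline_bounds t : 0 <= dspline t <= 2.
Proof.
rewrite /dspline /pos; have [a|a] := leP 0 t; have [b|b] := leP 0 (t - 1 / 2);
  have [c|c] := leP 0 (t - 1); apply/andP; split; lra.
Qed.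

End spline_step.

(** [pprof] is the total displacement as a function of the coordinate read. [pfirst] tells that the
    first of the two coordinates is moved and the second is read. *)
Record phase (R : realType) := Phase {
  pstart : R; plen : R; pfirst : bool; pprof : R -> R }.

HB.instance Definition _ (R : realType) := gen_eqMixin (phase R).

Section phases.
Context {R : realType} (d : nat).
Local Notation n := d.+2.
Local Notation lebn := (lebesgue_rV R n).
Implicit Types (p q : phase R) (L : seq (phase R)) (x : 'rV[R]_n) (t : R).

Definition i0 : 'I_n := ord0.
Definition i1 : 'I_n := lift ord0 ord0.

(* The coordinate moved by a phase, and the one its displacement depends on. *)
Definition pmove p : 'I_n := if pfirst p then i0 else i1.
Definition pread p : 'I_n := if pfirst p then i1 else i0.

Lemma pmove_neq p : pread p != pmove p.
Proof. by rewrite /pmove /pread; case: pfirst. Qed.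

Definition pstep p t : R := spline ((t - pstart p) / plen p).
Definition pspeed p t : R := dspline ((t - pstart p) / plen p) / plen p.

Definition pdisp p x : R := pprof p (x 0 (pread p)).

Definition pshear p (s : R) x : 'rV[R]_n := shear (pmove p) (fun x => s * pdisp p x) x.

Lemma pshearE p s x : pshear p s x = x + (s * pdisp p x) *: delta_mx 0 (pmove p).
Proof. by []. Qed.

Lemma pdisp_move p x s : pdisp p (x + s *: delta_mx 0 (pmove p)) = pdisp p x.
Proof.
by rewrite /pdisp !mxE eqxx /= (negbTE (pmove_neq p)) mulr0 addr0.
Qed.

Lemma pshearK p s x : pshear p (- s) (pshear p s x) = x.
Proof.
by rewrite 2!pshearE pdisp_move -addrA -scalerDl mulNr subrr scale0r addr0.
Qed.

(** Every shear is applied with the fraction [pstep p t] of its displacement: all of it for past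
    phases, none for future ones. *)
Fixpoint flow L t x : 'rV[R]_n :=
  if L is p :: L' then flow L' t (pshear p (pstep p t) x) else x.

Fixpoint flow_inv L t x : 'rV[R]_n :=
  if L is p :: L' then pshear p (- pstep p t) (flow_inv L' t x) else x.

Definition field L t x : 'rV[R]_n :=
  \sum_(p <- L) (pspeed p t * pdisp p x) *: delta_mx 0 (pmove p).

Lemma flow_cat L L' t x : flow (L ++ L') t x = flow L' t (flow L t x).
Proof. by elim: L x => //= p L IH x. Qed.

Lemma flow_inv_cat L L' t x : flow_inv (L ++ L') t x = flow_inv L t (flow_inv L' t x).
Proof. by elim: L => //= p L ->. Qed.

Lemma flowK L t : cancel (flow L t) (flow_inv L t).
Proof. by elim: L => //= p L IH x; rewrite IH pshearK. Qed.

Lemma flow_invK L t : cancel (flow_inv L t) (flow L t).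
Proof. by elim: L => //= p L IH x; rewrite -{1}(opprK (pstep p t)) pshearK IH. Qed.

Fixpoint timely (a b : R) L : Prop :=
  if L is p :: L' then
    [/\ 0 < plen p, a <= pstart p & timely (pstart p + plen p) b L']
  else a <= b.

Lemma timely_le a b L : timely a b L -> a <= b.
Proof.
elim: L a => //= p L IH a [p0 ap /IH]; apply: le_trans.
by rewrite (le_trans ap)// lerDl ltW.
Qed.

Lemma timely_weaken a a' b L : a' <= a -> timely a b L -> timely a' b L.
Proof.
case: L => [|p L] /= aa; first exact: le_trans.
by move=> [p0 ap tL]; split => //; exact: le_trans aa ap.
Qed.

Lemma timely_cat a b c L L' : timely a b L -> timely b c L' -> timely a c (L ++ L').
Proof.
move=> + H; elim: L a => [a /= ab|p L IH a /= [p0 ap /IH]]; last by [].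
exact: timely_weaken ab H.
Qed.

Lemma timely_mem a b L p : timely a b L -> p \in L ->
  [/\ 0 < plen p, a <= pstart p & pstart p + plen p <= b].
Proof.
elim: L a => //= q L IH a [q0 aq tL]; rewrite inE => /predU1P[->|pL].
  by split => //; exact: timely_le tL.
have [p0 qp pb] := IH _ tL pL; split => //.
by rewrite (le_trans aq)// (le_trans _ qp)// lerDl ltW.
Qed.

Lemma pstep_before p t : 0 < plen p -> t <= pstart p -> pstep p t = 0.
Proof.
move=> p0 tp; rewrite /pstep spline_le0// pmulr_lle0 ?invr_gt0//; lra.
Qed.

Lemma pstep_after p t : 0 < plen p -> pstart p + plen p <= t -> pstep p t = 1.
Proof.
move=> p0 tp; rewrite /pstep spline_ge1// ler_pdivlMr// mul1r; lra.
Qed.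

Lemma pspeed_before p t : 0 < plen p -> t <= pstart p -> pspeed p t = 0.
Proof.
move=> p0 tp; rewrite /pspeed dspline_out ?mul0r//.
by apply/orP; left; rewrite pmulr_lle0 ?invr_gt0//; lra.
Qed.

Lemma pspeed_after p t : 0 < plen p -> pstart p + plen p <= t -> pspeed p t = 0.
Proof.
move=> p0 tp; rewrite /pspeed dspline_out ?mul0r//.
by apply/orP; right; rewrite ler_pdivlMr// mul1r; lra.
Qed.

Lemma pstep_bounds p t : 0 <= pstep p t <= 1. Proof. exact: spline_bounds. Qed.

Lemma pspeed_bounds p t : 0 < plen p -> 0 <= pspeed p t <= 2 / plen p.
Proof.
move=> p0; have /andP[a b] := dspline_bounds ((t - pstart p) / plen p).
by rewrite /pspeed divr_ge0 ?(ltW p0)//= ler_wpM2r// invr_ge0 ltW.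
Qed.

Lemma is_derive_pstep p t : is_derive t (1 : R) (pstep p) (pspeed p t).
Proof.
have := is_derive_comp_affine (plen p)^-1 (- (pstart p / plen p)) t (@is_derive_spline R).
have E s : (plen p)^-1 * s - pstart p / plen p = (s - pstart p) / plen p by ring.
rewrite E [X in is_derive _ _ _ X]mulrC; under eq_fun do rewrite E.
by [].
Qed.

Lemma continuous_pspeed p : continuous (pspeed p).
Proof.
rewrite /pspeed; apply: continuous_fM; last exact: continuous_fcst.
apply: (@continuous_composition _ _ _ (fun t => (t - pstart p) / plen p) dspline _ continuous_dspline).
apply: continuous_fM; last exact: continuous_fcst.
by move=> y; apply: cvgB; [exact: cvg_id|exact: cvg_cst].
Qed.

(** The displacements that the phases give to the trajectory of [x], each evaluated where the
    earlier phases have left it. With these as coefficients the trajectory is a linear combination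
    of the step functions and can be differentiated term by term. *)
Fixpoint weights L x : seq R :=
  if L is p :: L' then pdisp p x :: weights L' (pshear p 1 x) else [::].

Definition wsum (f : phase R -> R) L (w : seq R) : 'rV[R]_n :=
  \sum_(pw <- zip L w) (f pw.1 * pw.2) *: delta_mx 0 (pmove pw.1).

Lemma wsum0 f L w : (forall p, p \in L -> f p = 0) -> wsum f L w = 0.
Proof.
elim: L w => [|p L IH] [|c w] f0; rewrite /wsum /= ?big_nil// big_cons /=.
rewrite f0 ?mem_head// mul0r scale0r add0r; apply: IH => q qL.
by apply: f0; rewrite inE qL orbT.
Qed.

Lemma wsum_cons f p L c w :
  wsum f (p :: L) (c :: w) = (f p * c) *: delta_mx 0 (pmove p) + wsum f L w.
Proof. by rewrite /wsum /= big_cons. Qed.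

Lemma flow_id L t x : (forall p, p \in L -> pstep p t * pdisp p x = 0) -> flow L t x = x.
Proof.
elim: L => //= p L IH H; rewrite pshearE H ?mem_head// scale0r addr0.
by apply: IH => q qL; apply: H; rewrite inE qL orbT.
Qed.

Lemma flow_before a b L t x : timely a b L -> t <= a -> flow L t x = x.
Proof.
move=> tL ta; apply: flow_id => p /(timely_mem tL)[p0 ap _].
by rewrite pstep_before ?mul0r// (le_trans ta).
Qed.

Lemma field_before a b L t x : timely a b L -> t <= a -> field L t x = 0.
Proof.
move=> tL ta; rewrite /field big1_seq// => p /= /(timely_mem tL)[p0 ap _].
by rewrite pspeed_before ?mul0r ?scale0r// (le_trans ta).
Qed.

Lemma field_after a b L t x : timely a b L -> b <= t -> field L t x = 0.
Proof.
move=> tL bt; rewrite /field big1_seq// => p /= /(timely_mem tL)[p0 _ pb].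
by rewrite pspeed_after ?mul0r ?scale0r// (le_trans pb).
Qed.

(* A phase starts only after the previous ones are complete, so the weights do not depend on time. *)
Lemma flowE a b L t x : timely a b L ->
  flow L t x = x + wsum (pstep^~ t) L (weights L x).
Proof.
elim: L a x => [a x _|p L IH a x /= [p0 ap tL]]; first by rewrite /wsum big_nil addr0.
rewrite wsum_cons (IH _ _ tL) pshearE -addrA; congr (_ + (_ + _)).
have [tp|tp] := leP t (pstart p + plen p).
  by rewrite !wsum0// => q /(timely_mem tL)[q0 pq _]; rewrite pstep_before// (le_trans tp).
by rewrite (pstep_after p0 (ltW tp)) pshearE.
Qed.

Lemma field_flowE a b L t x : timely a b L ->
  field L t (flow L t x) = wsum (pspeed^~ t) L (weights L x).
Proof.
elim: L a x => [a x _|p L IH a x /= [p0 ap tL]]; first by rewrite /wsum /field !big_nil.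
rewrite wsum_cons /field big_cons -/(field _ _ _) (IH _ _ tL).
have [tp|tp] := leP t (pstart p + plen p).
  (* While a phase is active it changes only the coordinate that it does not read, so its own
     displacement is constant along the trajectory. *)
  rewrite (flow_before _ tL tp) [in pdisp _ (pshear _ _ _)]pshearE pdisp_move.
  by rewrite !wsum0// => q /(timely_mem tL)[q0 pq _]; rewrite pspeed_before// (le_trans tp).
by rewrite (pspeed_after p0 (ltW tp)) !mul0r !scale0r (pstep_after p0 (ltW tp)).
Qed.

Lemma pdisp_bound_enorm p s x b : 0 <= s <= 1 -> (forall y, `|pprof p y| <= b) ->
  enorm (pshear p s x - x) <= b.
Proof.
move=> /andP[s0 s1] pb; rewrite pshearE addrAC subrr add0r enorm_delta normrM.
by rewrite (ger0_norm s0) (le_trans _ (pb (x 0 (pread p))))// ler_piMl.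
Qed.

Lemma flow_disp L t x b : (forall p, p \in L -> forall y, `|pprof p y| <= b) ->
  enorm (flow L t x - x) <= (size L)%:R * b.
Proof.
elim: L x => [x _|p L IH x Lb /=]; first by rewrite subrr enorm0 mul0r.
rewrite -[X in enorm X](subrKA (pshear p (pstep p t) x)) (le_trans (enormD _ _))//.
rewrite -natr1 mulrDl mul1r lerD//; first by apply: IH => q qL; apply: Lb; rewrite inE qL orbT.
by apply: pdisp_bound_enorm; [exact: pstep_bounds|apply: Lb; rewrite mem_head].
Qed.

Lemma measurable_pshear d' (T : measurableType d') p (s : T -> R) (x : T -> 'rV[R]_n) :
  measurable_fun setT (pprof p) -> measurable_fun setT s -> measurable_fun setT x ->
  measurable_fun setT (fun z => pshear p (s z) (x z)).
Proof.
move=> mp ms mx; apply: measurable_fun_rV => i.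
under eq_fun do rewrite shearE.
have mc j : measurable_fun setT (fun z => x z 0 j).
  exact: (measurableT_comp (measurable_rV_coor j) mx).
apply: measurable_funD => //; apply: measurable_funM; last exact: measurable_cst.
by apply: measurable_funM => //; apply: (measurableT_comp mp).
Qed.

Lemma measurable_pstep p : measurable_fun setT (pstep p).
Proof.
apply: continuous_measurable_fun => t; apply: differentiable_continuous.
by apply/derivable1_diffP; have D := is_derive_pstep p t.
Qed.

Definition regular L := forall p, p \in L -> continuous (pprof p).

Lemma regular_cons p L : regular (p :: L) -> continuous (pprof p) /\ regular L.
Proof.
move=> rL; split; first by apply: rL; rewrite mem_head.
by move=> q qL; apply: rL; rewrite inE qL orbT.
Qed.

Lemma measurable_flow d' (T : measurableType d') L (t : T -> R) (x : T -> 'rV[R]_n) :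
  regular L -> measurable_fun setT t -> measurable_fun setT x ->
  measurable_fun setT (fun z => flow L (t z) (x z)).
Proof.
elim: L x => [x _ //|p L IH x /regular_cons[cp rL] mt mx] /=.
apply: (IH (fun z => pshear p (pstep p (t z)) (x z))) => //; apply: measurable_pshear => //.
  exact: continuous_measurable_fun.
exact: (measurableT_comp (measurable_pstep p)).
Qed.

Lemma measurable_flow_inv d' (T : measurableType d') L (t : T -> R) (x : T -> 'rV[R]_n) :
  regular L -> measurable_fun setT t -> measurable_fun setT x ->
  measurable_fun setT (fun z => flow_inv L (t z) (x z)).
Proof.
elim: L => [_ //|p L IH /regular_cons[cp rL] mt mx] /=.
apply: measurable_pshear; last exact: IH.
  exact: continuous_measurable_fun.
by apply: measurable_funN; exact: (measurableT_comp (measurable_pstep p)).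
Qed.

Lemma measurable_field_list d' (T : measurableType d') L (t : T -> R) (x : T -> 'rV[R]_n) :
  regular L -> measurable_fun setT t -> measurable_fun setT x ->
  measurable_fun setT (fun z => field L (t z) (x z)).
Proof.
move=> + mt mx; elim: L => [_|p L IH /regular_cons[cp rL]].
  by rewrite /field; under eq_fun do rewrite big_nil; exact: measurable_cst.
apply: measurable_fun_rV => i; rewrite /field.
under eq_fun do rewrite big_cons mxE; apply: measurable_funD; last first.
  exact: (measurableT_comp (measurable_rV_coor i) (IH rL)).
under eq_fun do rewrite mxE; apply: measurable_funM; last exact: measurable_cst.
apply: measurable_funM.
  apply: (measurableT_comp _ mt); apply: continuous_measurable_fun; exact: continuous_pspeed.
apply: (measurableT_comp (continuous_measurable_fun cp)).
exact: (measurableT_comp (measurable_rV_coor _) mx).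
Qed.

Lemma continuous_pshear (T : topologicalType) p s (x : T -> 'rV[R]_n) :
  continuous (pprof p) -> continuous x -> continuous (fun z => pshear p s (x z)).
Proof.
move=> cp cx; apply: continuous_rV => i; under eq_fun do rewrite shearE.
have cc j : continuous (fun z => x z 0 j).
  exact: (@continuous_composition _ _ _ x (fun x => x ord0 j) cx (@continuous_coord _ _ _)).
apply: continuous_fD => //; apply: continuous_fM; last exact: continuous_fcst.
apply: continuous_fM; first exact: continuous_fcst.
exact: (@continuous_composition _ _ _ _ (pprof p) (cc _) cp).
Qed.

Lemma continuous_flow_inv L t : regular L -> continuous (flow_inv L t).
Proof.
elim: L => [_ x|p L IH /regular_cons[cp rL]] /=; first exact: cvg_id.
by apply: continuous_pshear => //; exact: IH.
Qed.

Lemma pshear_scaling p s : measurable_fun setT (pprof p) ->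
  measure_scaling lebn 1 (pshear p s).
Proof.
move=> mp; apply: shear_scaling => [|x r]; last by rewrite pdisp_move.
apply: measurable_funM; first exact: measurable_cst.
exact: (measurableT_comp mp (measurable_rV_coor _)).
Qed.

Lemma flow_scaling L t : regular L -> measure_scaling lebn 1 (flow L t).
Proof.
elim: L => [_|p L IH /regular_cons[cp rL]] /=; first exact: measure_scaling_id.
apply: (measure_scaling_comp (IH rL)).
by apply: pshear_scaling; exact: continuous_measurable_fun.
Qed.

Lemma flow_inv_scaling L t : regular L -> measure_scaling lebn 1 (flow_inv L t).
Proof.
elim: L => [_|p L IH /regular_cons[cp rL]] /=; first exact: measure_scaling_id.
apply: measure_scaling_comp (IH rL).
by apply: pshear_scaling; exact: continuous_measurable_fun.
Qed.

End phases.

(** * The velocity field and its flow *)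

Section levels.
Context {R : realType} (d : nat).
Local Notation n := d.+2.
Local Notation lebn := (lebesgue_rV R n).
Implicit Types (p q : phase R) (x : 'rV[R]_n) (t : R).
Local Notation i0 := (i0 d).
Local Notation i1 := (i1 d).

(** What the flow needs to know about the phases. By [level_disp] all levels together move a point
    by at most the sum of the 2^-k-4, which is 1/8. The constants [lip] are allowed to grow with k:
    they serve the uniqueness of the flow, whereas the modulus of continuity is treated
    separately. *)
Record level_system (lev : nat -> seq (phase R)) (amp lip : nat -> R) : Prop := LevelSystem {
  level_timely : forall k, timely (2 ^- k.+1) (2 ^- k) (lev k);
  level_regular : forall k p, p \in lev k -> continuous (pprof p);
  level_support : forall k p y, p \in lev k ->
    1 / 2 <= `|y - center_coord k| -> pprof p y = 0;
  level_amp : forall k p y, p \in lev k -> `|pprof p y| <= amp k;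
  level_disp : forall k, (size (lev k))%:R * amp k <= 2 ^- k.+4;
  level_speed : forall k p t y, p \in lev k -> `|pspeed p t * pprof p y| <= 1;
  level_lip0 : forall k, 0 <= lip k;
  level_lip : forall k p t y z, p \in lev k ->
    `|pspeed p t * (pprof p y - pprof p z)| <= lip k * `|y - z|
}.

Variables (lev : nat -> seq (phase R)) (amp lip : nat -> R).
Hypothesis H : level_system lev amp lip.

(* In chronological order: level k takes place between times 2^-k-1 and 2^-k. *)
Fixpoint phases (K : nat) : seq (phase R) :=
  if K is k.+1 then lev k ++ phases k else [::].

Lemma phases_timely K : timely (2 ^- K) 1 (phases K).
Proof.
elim: K => [|K IH] /=; first by rewrite expr0 invr1.
exact: timely_cat (level_timely H K) IH.
Qed.

Lemma phases_mem K p : p \in phases K -> exists2 k, (k < K)%N & p \in lev k.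
Proof.
elim: K => //= K IH; rewrite mem_cat => /orP[pK|/IH[k kK pk]]; first by exists K.
by exists k => //; exact: ltnW.
Qed.

Lemma phases_regular K : regular (phases K).
Proof. by move=> p /phases_mem[k _]; exact: (level_regular H). Qed.

(** A shear of level k acts on a whole strip around [center_coord k] in the coordinate read, not
    only near the k-th centre. The points outside the strips of both coordinates are fixed by the
    level. *)
Definition far k x := 1 / 2 <= `|x 0 i0 - center_coord k| /\ 1 / 2 <= `|x 0 i1 - center_coord k|.

Lemma center_coord_ge k : k%:R + 3 / 2 <= center_coord k :> R.
Proof.
have s2 : 0 < Num.sqrt 2 :> R by rewrite sqrtr_gt0.
have s3 : Num.sqrt 2 <= 3 / 2 :> R.
  by rewrite -[leRHS]ger0_norm// -sqrtr_sqr ler_wsqrtr//; lra.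
have k0 : 0 <= k%:R :> R by [].
rewrite /center_coord ler_pdivlMr// /shell_radius.
move: k0 s2 s3; move: (k%:R) (Num.sqrt 2) => a s; nra.
Qed.

(** The source of local finiteness: the strips of level k miss the ball of radius k + 1, so only
    finitely many levels act on a bounded set. *)
Lemma far_enorm k x : enorm x <= k%:R + 1 -> far k x.
Proof.
move=> xk; have c := center_coord_ge k.
by split; [have h := coord_le_enorm x i0|have h := coord_le_enorm x i1];
  rewrite distrC ler_normr; apply/orP; left;
  move: h; rewrite ler_norml => /andP[_ h]; lra.
Qed.

Lemma far_pdisp k p x : p \in lev k -> far k x -> pdisp p x = 0.
Proof.
move=> pk [f0 f1]; rewrite /pdisp /pread.
by case: pfirst; apply: (level_support H pk).
Qed.

Lemma far_flow k t x : far k x -> flow (lev k) t x = x.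
Proof. by move=> fx; apply: flow_id => p pk; rewrite (far_pdisp pk) ?mulr0. Qed.

Lemma far_flow_inv k t x : far k x -> flow_inv (lev k) t x = x.
Proof. by move=> fx; rewrite -{1}(far_flow t fx) flowK. Qed.

Lemma far_field k t x : far k x -> field (lev k) t x = 0.
Proof.
move=> fx; rewrite /field big1_seq// => p /= pk.
by rewrite (far_pdisp pk fx) mulr0 scale0r.
Qed.

Lemma level_flow_disp k t x : enorm (flow (lev k) t x - x) <= 2 ^- k.+4.
Proof.
by rewrite (le_trans (flow_disp _ _ (fun p pk y => level_amp H y pk)))// (level_disp H).
Qed.

Lemma phases_disp K t x : enorm (flow (phases K) t x - x) <= 1 / 8 - 2 ^- K.+3.
Proof.
elim: K x => [|K IH] x /=.
  by rewrite subrr enorm0 subr_ge0; rewrite !exprS expr0; lra.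
rewrite flow_cat -[X in enorm X](subrKA (flow (lev K) t x)) (le_trans (enormD _ _))//.
have := level_flow_disp K t x; have := IH (flow (lev K) t x).
have -> : 2 ^- K.+4 = 2 ^- K.+3 / 2 :> R by rewrite exprS invfM mulrC.
lra.
Qed.

Lemma phases_disp_lt K t x : enorm (flow (phases K) t x - x) <= 1 / 8.
Proof. by rewrite (le_trans (phases_disp _ _ _))// gerBl invr_ge0 exprn_ge0. Qed.

Lemma phases_inv_disp K t x : enorm (flow_inv (phases K) t x - x) <= 1 / 8.
Proof.
have := phases_disp_lt K t (flow_inv (phases K) t x).
by rewrite flow_invK enormB.
Qed.

Lemma flow_stable K j t x : enorm x <= K%:R ->
  flow (phases (j + K)) t x = flow (phases K) t x.
Proof.
move=> xK; elim: j => // j IH; rewrite addSn /= flow_cat far_flow//.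
apply: far_enorm; rewrite (le_trans xK)// natrD; have : 0 <= j%:R :> R by []. lra.
Qed.

Lemma flow_inv_stable K j t x : enorm x <= K%:R ->
  flow_inv (phases (j + K)) t x = flow_inv (phases K) t x.
Proof.
move=> xK; elim: j => // j IH; rewrite addSn /= flow_inv_cat IH far_flow_inv//.
(* The inverse of the lower levels moves x by at most 1/8, which keeps it within radius K + 1, where
   the added level is the identity. *)
apply: far_enorm; have h := phases_inv_disp K t x.
rewrite -[X in enorm X](subrK x) (le_trans (enormD _ _))// natrD.
have : 0 <= j%:R :> R by []. lra.
Qed.

Lemma field_stable K j t x : enorm x <= K%:R ->
  field (phases (j + K)) t x = field (phases K) t x.
Proof.
move=> xK; elim: j => // j IH; rewrite addSn /= /field big_cat /= -/(field _ _ _).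
rewrite -[X in _ + X = _]/(field _ _ _) IH far_field ?add0r//.
apply: far_enorm; rewrite (le_trans xK)// natrD; have : 0 <= j%:R :> R by []. lra.
Qed.

Lemma field_time_stable K j t x : 2 ^- K <= t ->
  field (phases (j + K)) t x = field (phases K) t x.
Proof.
move=> tK; elim: j => // j IH; rewrite addSn /= /field big_cat /= -/(field _ _ _).
rewrite -[X in _ + X = _]/(field _ _ _) IH (field_after _ (level_timely H _)) ?add0r//.
rewrite (le_trans _ tK)// lef_pV2 ?posrE ?exprn_gt0// ler_weXn2l ?ler1n//; lia.
Qed.

Definition space_bound x : nat := (Num.truncn (enorm x)).+1.
Definition time_bound t : nat := (Num.truncn t^-1).+1.

Lemma space_boundP x : enorm x <= (space_bound x)%:R.
Proof. exact: ltW (truncnS_gt _). Qed.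

Lemma time_boundP t : 0 < t -> 2 ^- time_bound t <= t.
Proof.
move=> t0; rewrite -[leRHS]invrK lef_pV2 ?posrE ?exprn_gt0 ?invr_gt0//.
rewrite (le_trans (ltW (truncnS_gt t^-1)))// -natrX ler_nat ltnW//.
exact: ltn_expl.
Qed.

Definition phi t x := flow (phases (space_bound x)) t x.
Definition phi_inv t x := flow_inv (phases (space_bound x)) t x.
(** Levels that are over by time t have speed 0, so the velocity can be cut off by time, which gives
    the same list of phases for all x. Displacements persist, so [phi] is cut off by position. *)
Definition u t x := field (phases (time_bound t)) t x.

Lemma phiE K t x : enorm x <= K%:R -> phi t x = flow (phases K) t x.
Proof.
move=> xK; rewrite /phi -(flow_stable K t (space_boundP x)) -(flow_stable (space_bound x) t xK).
by rewrite addnC.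
Qed.

Lemma phi_invE K t x : enorm x <= K%:R -> phi_inv t x = flow_inv (phases K) t x.
Proof.
move=> xK; rewrite /phi_inv -(flow_inv_stable K t (space_boundP x)).
by rewrite -(flow_inv_stable (space_bound x) t xK) addnC.
Qed.

Lemma phi_disp t x : enorm (phi t x - x) <= 1 / 8.
Proof. exact: phases_disp_lt. Qed.

Lemma phi_inv_disp t x : enorm (phi_inv t x - x) <= 1 / 8.
Proof. exact: phases_inv_disp. Qed.

Lemma phiK t : cancel (phi t) (phi_inv t).
Proof.
move=> x; have xK : enorm x <= (space_bound x).+1%:R by rewrite (le_trans (space_boundP x))// ler_nat.
(* One level more than [space_bound x] covers the image as well, since points move by at most
   1/8. *)
have yK : enorm (phi t x) <= (space_bound x).+1%:R.
  rewrite -[X in enorm X](subrK x) (le_trans (enormD _ _))//.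
  have := phi_disp t x; have := space_boundP x; rewrite -(natr1 (space_bound x)); lra.
by rewrite (phi_invE _ yK) (phiE _ xK) flowK.
Qed.

Lemma phi_invK t : cancel (phi_inv t) (phi t).
Proof.
move=> x; have xK : enorm x <= (space_bound x).+1%:R by rewrite (le_trans (space_boundP x))// ler_nat.
have yK : enorm (phi_inv t x) <= (space_bound x).+1%:R.
  rewrite -[X in enorm X](subrK x) (le_trans (enormD _ _))//.
  have := phi_inv_disp t x; have := space_boundP x; rewrite -(natr1 (space_bound x)); lra.
by rewrite (phiE _ yK) (phi_invE _ xK) flow_invK.
Qed.

Lemma field_le0 K t x : t <= 0 -> field (phases K) t x = 0.
Proof.
move=> t0; apply: (field_before _ (phases_timely K)).
by rewrite (le_trans t0)// invr_ge0 exprn_ge0.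
Qed.

Lemma uE K t x : enorm x <= K%:R -> u t x = field (phases K) t x.
Proof.
move=> xK; rewrite /u; have [t0|t0] := leP t 0; first by rewrite !field_le0.
rewrite -(field_time_stable K _ (time_boundP t0)) -(field_stable (time_bound t) t xK).
by rewrite addnC.
Qed.

Lemma field_single a b L t : timely a b L ->
  (forall x, field L t x = 0) \/ exists2 p, p \in L &
    forall x, field L t x = (pspeed p t * pdisp p x) *: delta_mx 0 (pmove d p).
Proof.
elim: L a => [a _|p L IH a /= [p0 ap tL]]; first by left => x; rewrite /field big_nil.
have [tp|tp] := leP t (pstart p + plen p).
  right; exists p; rewrite ?mem_head// => x.
  by rewrite /field big_cons -/(field _ _ _) (field_before _ tL tp) addr0.
have E x : field (p :: L) t x = field L t x.
  by rewrite /field big_cons (pspeed_after p0 (ltW tp)) mul0r scale0r add0r.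
have [Z|[q qL Eq]] := IH _ tL; first by left=> x; rewrite E.
by right; exists q => [|x]; rewrite ?inE ?qL ?orbT// E.
Qed.

(** At each time at most one phase is active. Size, modulus of continuity and divergence of the
    field thus reduce to those of a single shear. *)
Lemma u_single t : (forall x, u t x = 0) \/ exists k p, p \in lev k /\
    forall x, u t x = (pspeed p t * pdisp p x) *: delta_mx 0 (pmove d p).
Proof.
have [Z|[p /phases_mem[k _ pk] E]] := field_single t (phases_timely (time_bound t)).
  by left.
by right; exists k, p.
Qed.

Lemma enorm_u_le1 t x : enorm (u t x) <= 1.
Proof.
have [->|[k [p [pk ->]]]] := u_single t; first by rewrite enorm0.
by rewrite enorm_delta; exact: (level_speed H _ _ pk).
Qed.

Lemma has_modulus_u (omega : R -> R) (C : R) : 0 < C -> (forall r, 0 <= r -> 0 <= omega r) ->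
  (forall k p t y z r, p \in lev k -> `|y - z| <= r ->
     `|pspeed p t * (pprof p y - pprof p z)| <= C * omega r) ->
  has_modulus omega u.
Proof.
move=> C0 w0 M; exists C => // t x y _.
have [E|[k [p [pk E]]]] := u_single t.
  by rewrite !E subrr enorm0 mulr_ge0 ?(ltW C0)// w0// enorm_ge0.
rewrite !E -scalerBl -mulrBr enorm_delta; apply: M pk _.
by have := coord_le_enorm (x - y) (pread d p); rewrite !mxE.
Qed.

Lemma field_lipschitz K : exists2 c, 0 <= c & forall t x y,
  enorm (field (phases K) t x - field (phases K) t y) <= c * enorm (x - y).
Proof.
exists (\sum_(k < K) lip k); first by rewrite sumr_ge0// => k _; exact: (level_lip0 H).
move=> t x y; have [E|[p /phases_mem[k kK pk] E]] := field_single t (phases_timely K).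
  by rewrite !E subrr enorm0 mulr_ge0 ?enorm_ge0// sumr_ge0// => k _; exact: (level_lip0 H).
rewrite !E -scalerBl -mulrBr enorm_delta (le_trans (level_lip H _ _ _ pk))//.
apply: ler_pM => //; first exact: (level_lip0 H).
  by rewrite (bigD1 (Ordinal kK))//= lerDl sumr_ge0// => j _; exact: (level_lip0 H).
by have := coord_le_enorm (x - y) (pread d p); rewrite !mxE.
Qed.

Lemma measurable_rV_cvg d' (T : measurableType d') (F : nat -> T -> 'rV[R]_n) (f : T -> 'rV[R]_n) :
  (forall K, measurable_fun setT (F K)) ->
  (forall z, exists N, forall K, (N <= K)%N -> F K z = f z) -> measurable_fun setT f.
Proof.
move=> mF Ff; apply: measurable_fun_rV => i.
apply: (@measurable_fun_cvg _ _ _ _ (fun K z => F K z 0 i)) => [K|z _].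
  exact: (measurableT_comp (measurable_rV_coor i) (mF K)).
by apply: cvg_near_cst; have [N HN] := Ff z; exists N => // K /= NK; rewrite HN.
Qed.

Lemma measurable_phi d' (T : measurableType d') (t : T -> R) (x : T -> 'rV[R]_n) :
  measurable_fun setT t -> measurable_fun setT x ->
  measurable_fun setT (fun z => phi (t z) (x z)).
Proof.
move=> mt mx; apply: (measurable_rV_cvg (F := fun K z => flow (phases K) (t z) (x z))).
  by move=> K; apply: measurable_flow => //; exact: phases_regular.
move=> z; exists (space_bound (x z)) => K zK; apply/esym/phiE.
by rewrite (le_trans (space_boundP _))// ler_nat.
Qed.

Lemma measurable_phi_inv d' (T : measurableType d') (t : T -> R) (x : T -> 'rV[R]_n) :
  measurable_fun setT t -> measurable_fun setT x ->
  measurable_fun setT (fun z => phi_inv (t z) (x z)).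
Proof.
move=> mt mx; apply: (measurable_rV_cvg (F := fun K z => flow_inv (phases K) (t z) (x z))).
  by move=> K; apply: measurable_flow_inv => //; exact: phases_regular.
move=> z; exists (space_bound (x z)) => K zK; apply/esym/phi_invE.
by rewrite (le_trans (space_boundP _))// ler_nat.
Qed.

Lemma measurable_u d' (T : measurableType d') (t : T -> R) (x : T -> 'rV[R]_n) :
  measurable_fun setT t -> measurable_fun setT x ->
  measurable_fun setT (fun z => u (t z) (x z)).
Proof.
move=> mt mx; apply: (measurable_rV_cvg (F := fun K z => field (phases K) (t z) (x z))).
  by move=> K; apply: measurable_field_list => //; exact: phases_regular.
move=> z; exists (space_bound (x z)) => K zK; apply/esym/uE.
by rewrite (le_trans (space_boundP _))// ler_nat.
Qed.

Lemma measurable_field_u : measurable_field u.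
Proof.
apply: (measurable_funS measurableT) => //.
by apply: measurable_u; [exact: measurable_fst|exact: measurable_snd].
Qed.

(* The preimage of A is contained in the lower limit of the preimages under F K. *)
Lemma measure_preimage_le (f : 'rV[R]_n -> 'rV[R]_n) (F : nat -> 'rV[R]_n -> 'rV[R]_n) A :
  (forall K, measure_scaling lebn 1 (F K)) ->
  (forall x, exists N, forall K, (N <= K)%N -> F K x = f x) ->
  measurable A -> (lebn (f @^-1` A) <= lebn A)%E.
Proof.
move=> sF Ff mA.
have mf : measurable_fun setT f by apply: (measurable_rV_cvg (F := F)) => // K; exact: (sF K).1.
pose G N := \bigcap_(K in [set K | (N <= K)%N]) (F K @^-1` A).
have mFA K : measurable (F K @^-1` A) by rewrite -[X in measurable X]setTI; exact: (sF K).1.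
have mG N : measurable (G N) by apply: bigcap_measurable => //; exists N => /=.
have sub : f @^-1` A `<=` \bigcup_N G N.
  by move=> x fx; have [N HN] := Ff x; exists N => // K /= NK; rewrite HN.
have ndG : nondecreasing_seq G.
  by move=> N M NM; apply/subsetPset => x Gx K /= MK; apply: Gx => /=; exact: leq_trans MK.
have mUG : measurable (\bigcup_N G N) by exact: bigcup_measurable.
apply: (@le_trans _ _ (lebn (\bigcup_N G N))).
  by apply: le_measure; rewrite ?inE// -[X in measurable X]setTI; exact: mf.
have cG := @nondecreasing_cvg_mu _ _ _ lebn _ mG mUG ndG.
rewrite -(cvg_lim _ cG)//; apply: lime_le; first by apply/cvg_ex; eexists; exact: cG.
apply: nearW => N /=; rewrite -[leRHS]mul1e -((sF N).2 _ mA).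
by apply: le_measure; rewrite ?inE// => x; apply => /=.
Qed.

Lemma phi_measure_le t A : measurable A -> (lebn (phi t @^-1` A) <= lebn A)%E.
Proof.
apply: (measure_preimage_le (F := fun K => flow (phases K) t)) => [K|x].
  by apply: flow_scaling; exact: phases_regular.
exists (space_bound x) => K zK; apply/esym/phiE.
by rewrite (le_trans (space_boundP _))// ler_nat.
Qed.

Lemma phi_inv_measure_le t A : measurable A -> (lebn (phi_inv t @^-1` A) <= lebn A)%E.
Proof.
apply: (measure_preimage_le (F := fun K => flow_inv (phases K) t)) => [K|x].
  by apply: flow_inv_scaling; exact: phases_regular.
exists (space_bound x) => K zK; apply/esym/phi_invE.
by rewrite (le_trans (space_boundP _))// ler_nat.
Qed.

Lemma measurable_phi1 t : measurable_fun setT (phi t).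
Proof. exact: (measurable_phi (measurable_cst t) (@measurable_id _ _ setT)). Qed.

Lemma measurable_phi_inv1 t : measurable_fun setT (phi_inv t).
Proof. exact: (measurable_phi_inv (measurable_cst t) (@measurable_id _ _ setT)). Qed.

(** Approximation by finitely many levels gives only an inequality between measures; the same
    inequality for the inverse map gives the converse. *)
Lemma phi_scaling t : measure_scaling lebn 1 (phi t).
Proof.
split=> [|A mA]; first exact: measurable_phi1.
rewrite mul1e; apply/le_anti/andP; split; first exact: phi_measure_le.
have mp : measurable (phi t @^-1` A).
  by rewrite -[X in measurable X]setTI; exact: measurable_phi1.
have := phi_inv_measure_le t mp; apply: le_trans.
have -> // : phi_inv t @^-1` (phi t @^-1` A) = A.
by apply/seteqP; split => x /=; rewrite phi_invK.
Qed.

Lemma phi_inv_scaling t : measure_scaling lebn 1 (phi_inv t).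
Proof.
split=> [|A mA]; first exact: measurable_phi_inv1.
have mp : measurable (phi_inv t @^-1` A).
  by rewrite -[X in measurable X]setTI; exact: measurable_phi_inv1.
rewrite mul1e; apply/le_anti/andP; split; first exact: phi_inv_measure_le.
have := phi_measure_le t mp; apply: le_trans.
have -> // : phi t @^-1` (phi_inv t @^-1` A) = A.
by apply/seteqP; split => x /=; rewrite phiK.
Qed.

End levels.

Section derivatives.
Context {R : realType}.

Lemma is_derive_cvg (f : R -> R) (t l : R) : is_derive t (1 : R) f l <->
  (h^-1 * (f (t + h) - f t) @[h --> (0 : R)^'] --> l).
Proof.
have E : (fun h : R => h^-1 *: (f (h *: (1 : R) + t) - f t)) =
    (fun h => h^-1 * (f (t + h) - f t)).
  by apply/funext => h; rewrite /GRing.scale /= mulr1 (addrC t).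
split=> [D|L].
  have d1 := @ex_derive _ _ _ _ _ _ _ D.
  have := @derive_val _ _ _ _ _ _ _ D; rewrite /derive E => <-.
  by move: d1; rewrite /derivable E.
apply: DeriveDef; first by rewrite /derivable E; apply/cvg_ex; exists l.
by rewrite /derive E; apply: cvg_lim.
Qed.

(** The mean value theorem for exp(-c s) D(s). The derivative is required in the open interval only,
    because at time 0 a flow has just a one-sided derivative. *)
Lemma gronwall (D dD : R -> R) (c T : R) : 0 <= T ->
  {within `[0, T], continuous D} ->
  (forall s, 0 < s -> s < T -> is_derive s (1 : R) D (dD s)) ->
  (forall s, 0 < s -> s < T -> dD s <= c * D s) -> D 0 = 0 -> D T <= 0.
Proof.
rewrite le_eqVlt => /predU1P[<- _ _ _ ->//|T0] cD dDE dDle D0.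
pose G s := expR (- c * s) * D s.
have cG : {within `[0, T], continuous G}.
  apply: continuous_fM => //; apply: continuous_subspaceT => s.
  apply: (@continuous_composition _ _ _ (fun s : R => - c * s) expR).
    by apply: continuous_fM; [exact: continuous_fcst|move=> y; exact: cvg_id].
  exact: continuous_expR.
have dG s : s \in `]0, T[%R ->
    is_derive s (1 : R) G (expR (- c * s) * dD s + D s * (expR (- c * s) * - c)).
  rewrite in_itv /= => /andP[s0 sT]; have dDs := dDE s s0 sT.
  have de : is_derive s (1 : R) (fun s => expR (- c * s)) (expR (- c * s) * - c).
    have Dl : is_derive s (1 : R) (fun s => - c * s) (- c).
      by apply: (@is_derive_quadratic _ _ _ _ 0) => h; rewrite mul0r (_ : _ - _ - _ = 0) ?normr0//; ring.
    exact: (@is_derive1_comp R expR (fun s => - c * s) s _ _ (is_derive_expR _) Dl).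
  by apply: is_derive_eq; rewrite /GRing.scale /=.
have [xi xiT] := MVT T0 dG cG; move: xiT; rewrite in_itv /= => /andP[x0 xT].
rewrite /G D0 mulr0 !subr0 => E.
have : expR (- c * T) * D T <= 0.
  have -> : expR (- c * T) * D T = expR (- c * xi) * (dD xi - c * D xi) * T by rewrite E; ring.
  rewrite mulrC mulr_ge0_le0 ?(ltW T0)// mulr_ge0_le0 ?expR_ge0//.
  by have := dDle _ x0 xT; lra.
by rewrite pmulr_rle0// expR_gt0.
Qed.

End derivatives.

Section flow_equation.
Context {R : realType} (d : nat).
Local Notation n := d.+2.
Local Notation lebn := (lebesgue_rV R n).
Implicit Types (p q : phase R) (x : 'rV[R]_n) (t : R).
Variables (lev : nat -> seq (phase R)) (amp lip : nat -> R).
Hypothesis H : level_system lev amp lip.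
Local Notation phi := (@phi R d lev).
Local Notation u := (@u R d lev).
Local Notation phases := (phases lev).
Local Notation wsum := (wsum d).

Lemma wsum_coord (f : phase R -> R) L (w : seq R) (i : 'I_n) :
  wsum f L w 0 i = \sum_(pw <- zip L w) f pw.1 * pw.2 * (i == pmove d pw.1)%:R.
Proof.
by rewrite /wsum summxE; apply: eq_bigr => pw _; rewrite !mxE.
Qed.

Lemma is_derive_wsum L (w : seq R) (i : 'I_n) t :
  is_derive t (1 : R) (fun s => wsum (pstep^~ s) L w 0 i) (wsum (pspeed^~ t) L w 0 i).
Proof.
rewrite wsum_coord; under eq_fun do rewrite wsum_coord.
elim: (zip L w) => [|pw z IH].
  by rewrite big_nil; under eq_fun do rewrite big_nil; exact: is_derive_cst.
rewrite big_cons; under eq_fun do rewrite big_cons.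
have Dp := is_derive_pstep pw.1 t.
have Dq : is_derive t (1 : R) (fun s => pstep pw.1 s * pw.2 * (i == pmove d pw.1)%:R)
    (pspeed pw.1 t * pw.2 * (i == pmove d pw.1)%:R).
  by apply: is_derive_eq; rewrite /GRing.scale /=; ring.
exact: (is_deriveD Dq IH).
Qed.

Lemma continuous_wsum L (w : seq R) (i : 'I_n) :
  continuous (fun t => wsum (pspeed^~ t) L w 0 i).
Proof.
under eq_fun do rewrite wsum_coord; apply: continuous_fsum => pw.
apply: continuous_fM; last exact: continuous_fcst.
by apply: continuous_fM; [exact: continuous_pspeed|exact: continuous_fcst].
Qed.

Definition path_weights x := weights (phases (space_bound x).+1) x.

Lemma phi_path t x :
  phi t x = x + wsum (pstep^~ t) (phases (space_bound x).+1) (path_weights x).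
Proof.
rewrite -(flowE _ _ (phases_timely H _)); apply: (phiE H).
by rewrite (le_trans (space_boundP x))// ler_nat.
Qed.

Lemma u_path t x :
  u t (phi t x) = wsum (pspeed^~ t) (phases (space_bound x).+1) (path_weights x).
Proof.
rewrite -(field_flowE _ _ (phases_timely H _)) -(phiE H); last first.
  by rewrite (le_trans (space_boundP x))// ler_nat.
apply: (uE H); rewrite -[X in enorm X](subrK x) (le_trans (enormD _ _))//.
have := phi_disp H t x; have := space_boundP x; rewrite -(natr1 (space_bound x)); lra.
Qed.

Lemma is_derive_phi t x i :
  is_derive t (1 : R) (fun s => phi s x 0 i) (u t (phi t x) 0 i).
Proof.
rewrite u_path; under eq_fun do rewrite phi_path mxE.
have := is_deriveD (is_derive_cst (x 0 i) t (1 : R))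
  (is_derive_wsum (phases (space_bound x).+1) (path_weights x) i t).
by rewrite add0r.
Qed.

Lemma phi0 x : phi 0 x = x.
Proof.
apply: (flow_before _ (phases_timely H _)).
by rewrite invr_ge0 exprn_ge0.
Qed.

Lemma phi_is_flow : is_flow u phi.
Proof.
move=> x; split=> [|t t0]; first exact: phi0.
apply: cvg_rV => i; have /is_derive_cvg D := is_derive_phi t x i.
under eq_fun do rewrite 3!mxE.
apply: cvg_trans D; apply: cvg_app; exact: cvg_within.
Qed.

Section uniqueness.
Variable psi : R -> 'rV[R]_n -> 'rV[R]_n.
Hypothesis psi_flow : is_flow u psi.

Lemma flow_quotient_coord x t i : 0 <= t ->
  h^-1 * (psi (t + h) x 0 i - psi t x 0 i)
    @[h --> within [set h | 0 <= t + h] (0 : R)^'] --> u t (psi t x) 0 i.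
Proof.
move=> t0; have [_ /(_ t t0) L] := psi_flow x.
have := @cvg_comp _ _ _ _ (fun y : 'rV[R]_n => y ord0 i) _ _ _ L (@continuous_coord _ _ i _).
rewrite [X in X @ _ --> _ -> _](_ : _ =
    (fun h => h^-1 * (psi (t + h) x 0 i - psi t x 0 i)))//.
by apply/funext => h /=; rewrite !mxE.
Qed.

Lemma is_derive_psi x t i : 0 < t ->
  is_derive t (1 : R) (fun s => psi s x 0 i) (u t (psi t x) 0 i).
Proof.
move=> t0; apply/is_derive_cvg.
have L := @flow_quotient_coord x t i (ltW t0); apply: cvg_trans L; apply: cvg_app.
move=> A /= [e /= e0 eA]; exists (Num.min e t) => /=; first by rewrite lt_min e0 t0.
move=> h /=; rewrite lt_min => /andP[he ht] h0; apply: (eA h he h0) => /=.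
by move: ht; rewrite sub0r normrN ltr_norml => /andP[]; lra.
Qed.

Lemma psi_right_continuous x i :
  psi s x 0 i @[s --> (0 : R)^'+] --> psi 0 x 0 i.
Proof.
have L := @flow_quotient_coord x 0 i (lexx 0).
have L' : h^-1 * (psi (0 + h) x 0 i - psi 0 x 0 i) @[h --> (0 : R)^'+] --> u 0 (psi 0 x) 0 i.
  apply: cvg_trans L; apply: cvg_app.
  move=> A /= [e /= e0 eA]; exists e => //= h he h0; apply: (eA h he) => /=.
    by rewrite gt_eqF.
  by rewrite add0r ltW.
have Z : (h : R) @[h --> (0 : R)^'+] --> (0 : R) by apply: cvg_within.
have W : (h * (h^-1 * (psi (0 + h) x 0 i - psi 0 x 0 i)) + psi 0 x 0 i) @[h --> (0 : R)^'+]
    --> psi 0 x 0 i.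
  rewrite -[X in _ --> X]add0r -[X in _ --> X + _](mul0r (u 0 (psi 0 x) 0 i)).
  by apply: cvgD; [exact: cvgM|exact: cvg_cst].
apply: cvg_trans W; apply: near_eq_cvg.
near=> h; have h0 : 0 < h by near: h; exact: nbhs_right_gt.
by rewrite mulrA divff ?gt_eqF// mul1r subrK add0r.
Unshelve. all: by end_near. Qed.

Lemma psi_continuous x i T : 0 < T -> {within `[0, T], continuous (fun s => psi s x 0 i)}.
Proof.
move=> T0; have C s : 0 < s -> {for s, continuous (fun s => psi s x 0 i)}.
  move=> s0; apply: differentiable_continuous; apply/derivable1_diffP.
  by have D := is_derive_psi x i s0.
apply/(continuous_within_itvP _ T0); split.
- by move=> s; rewrite in_itv /= => /andP[s0 _]; exact: C.
- exact: psi_right_continuous.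
- by apply: cvg_within_filter; exact: C.
Qed.

(** An arbitrary flow carries no a priori bound; continuity on a compact time interval confines each
    trajectory to a ball, where [u] coincides with the Lipschitz field of a finite list of
    phases. *)
Lemma psi_bounded x T : 0 < T -> exists K : nat, forall s, 0 <= s <= T -> enorm (psi s x) <= K%:R.
Proof.
move=> T0; have c2 : {within `[0, T], continuous (fun s => \sum_(i < n) psi s x 0 i ^+ 2)}.
  by apply: continuous_fsum => i; apply: continuous_fM; exact: psi_continuous.
have [c _ Hc] := EVT_max (ltW T0) c2.
exists (Num.truncn (enorm (psi c x))).+1 => s sT; rewrite (le_trans _ (ltW (truncnS_gt _)))//.
by rewrite ler_wsqrtr// Hc// in_itv.
Qed.

Lemma flow_unique t x : 0 <= t -> psi t x = phi t x.
Proof.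
rewrite le_eqVlt => /predU1P[<-|T0]; first by rewrite phi0 (psi_flow x).1.
have [K HK] := psi_bounded x T0.
(* A radius containing both trajectories up to time t, so that both solve the equation of the same
   finite list of phases. *)
pose K' := (K + (space_bound x).+1)%N.
have [c c0 Hc] := field_lipschitz d H K'.
have uE1 s : 0 < s -> s < t -> u s (psi s x) = field (phases K') s (psi s x).
  move=> s0 st; apply: (uE H); rewrite (le_trans (HK s _)) ?ler_nat ?leq_addr//.
  by rewrite !ltW.
have uE2 s : u s (phi s x) = field (phases K') s (phi s x).
  apply: (uE H); rewrite -[X in enorm X](subrK x) (le_trans (enormD _ _))//.
  apply: (@le_trans _ _ (space_bound x).+1%:R); last by rewrite ler_nat leq_addl.
  have := phi_disp H s x; have := space_boundP x; rewrite -(natr1 (space_bound x)); lra.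
pose D s := \sum_(i < n) (psi s x 0 i - phi s x 0 i) ^+ 2.
pose dD s := \sum_(i < n) 2 * (psi s x 0 i - phi s x 0 i) *
  (u s (psi s x) 0 i - u s (phi s x) 0 i).
have Dt : D t <= 0.
  apply: (@gronwall _ D dD (2 * c)); first exact: ltW.
  - apply: continuous_fsum => i; apply: continuous_fM; apply: continuous_fB;
      try exact: psi_continuous; apply: continuous_subspaceT => s;
      apply: differentiable_continuous; apply/derivable1_diffP;
      by have D0 := is_derive_phi s x i.
  - move=> s s0 st; have := @is_derive_sum _ _ _ _
      (fun i => fun s => (psi s x 0 i - phi s x 0 i) ^+ 2) s 1
      (fun i => 2 * (psi s x 0 i - phi s x 0 i) * (u s (psi s x) 0 i - u s (phi s x) 0 i)).
    rewrite (_ : \sum_(i < n) _ = D); last by apply/funext => r; rewrite fct_sumE.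
    apply=> i; have D1 := is_derive_psi x i s0; have D2 := is_derive_phi s x i.
    by have D3 := is_deriveB D1 D2; have := is_derive_exprS 1 D3; rewrite expr1.
  - move=> s s0 st; have -> : dD s = 2 * dotr (psi s x - phi s x) (u s (psi s x) - u s (phi s x)).
      rewrite /dD /dotr mulr_sumr; apply: eq_bigr => i _; rewrite !mxE; ring.
    have -> : D s = enorm (psi s x - phi s x) ^+ 2.
      by rewrite enorm_sqr; apply: eq_bigr => i _; rewrite !mxE.
    rewrite -mulrA ler_wpM2l// uE1// uE2; have := Hc s (psi s x) (phi s x).
    set y := psi s x - phi s x; set v := field _ _ _ - _ => yv; have y0 := enorm_ge0 y; have v0 := enorm_ge0 v.
    rewrite (le_trans (ler_norm _))// -ler_sqr ?nnegrE ?normr_ge0 ?mulr_ge0 ?sqr_ge0//.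
    rewrite real_normK ?num_real// (le_trans (dotr_sqr_le _ _))//.
    have -> : (c * enorm y ^+ 2) ^+ 2 = enorm y ^+ 2 * (c * enorm y) ^+ 2 by ring.
    by rewrite ler_wpM2l ?sqr_ge0// lerXn2r ?nnegrE ?enorm_ge0 ?mulr_ge0 ?enorm_ge0.
  - by rewrite /D big1// => i _; rewrite phi0 (psi_flow x).1 subrr expr0n.
apply/rowP => i; apply/eqP; rewrite -subr_eq0 -sqrf_eq0 eq_le sqr_ge0 andbT.
apply: le_trans Dt; rewrite /D (bigD1 i)//= lerDl sumr_ge0// => j _; exact: sqr_ge0.
Qed.

End uniqueness.

End flow_equation.

(** * Test functions, divergence and weak solutions *)

Section test_functions.
Context {R : realType} {V : normedModType R}.
Implicit Types (f psi : V -> R) (x v : V).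

Lemma compact_support_bounded f (K : set V) : continuous f -> compact K ->
  (forall x, ~ K x -> f x = 0) -> exists2 B, 0 <= B & forall x, `|f x| <= B.
Proof.
move=> cf cK f0.
have cfK : compact (f @` K).
  by apply: continuous_compact => //; exact: continuous_subspaceT.
have [M [Mr HM]] := compact_bounded cfK.
exists (`|M| + 1); first by rewrite addr_ge0.
move=> x; have [Kx|/f0 ->] := pselect (K x); last by rewrite normr0 addr_ge0.
apply: (HM (`|M| + 1)); last by exists x.
by rewrite (le_lt_trans (ler_norm M))// ltrDl.
Qed.

Lemma derive_eq0_out psi (K : set V) x v : compact K -> (forall y, ~ K y -> psi y = 0) ->
  ~ K x -> 'D_v psi x = 0.
Proof.
move=> cK psi0 Kx; have clK := compact_closed (@norm_hausdorff _ V) cK.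
have Nx : \forall y \near x, ~ K y.
  by apply: open_nbhs_nbhs; split => //; exact: closed_openC.
have -> : 'D_v psi x = 'D_v (fun=> 0 : R) x.
  by apply: near_eq_derive; near=> y; rewrite psi0//; near: y.
by rewrite derive_cst.
Unshelve. all: by end_near. Qed.

Section test_function.
Variable psi : V -> R.
Hypothesis tpsi : test_function psi.

Lemma test_continuous : continuous psi.
Proof. by have [/(_ [::])[]] := tpsi. Qed.

Lemma test_derivable x v : derivable psi x v.
Proof. by have [/(_ [::])[_ +]] := tpsi; exact. Qed.

Lemma test_derive_continuous v : continuous ('D_v psi).
Proof. by have [/(_ [:: v])[]] := tpsi. Qed.

Lemma test_bounded : exists2 B, 0 <= B & forall x, `|psi x| <= B.
Proof.
have [_ [K cK psi0]] := tpsi.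
exact: (compact_support_bounded test_continuous cK psi0).
Qed.

Lemma test_derive_bounded v : exists2 B, 0 <= B & forall x, `|'D_v psi x| <= B.
Proof.
have [_ [K cK psi0]] := tpsi.
apply: (compact_support_bounded (@test_derive_continuous v) cK) => x.
exact: derive_eq0_out.
Qed.

Lemma test_support : exists2 r, 0 <= r & forall x, r < `|x| ->
  psi x = 0 /\ forall v, 'D_v psi x = 0.
Proof.
have [_ [K cK psi0]] := tpsi; have [M [Mr HM]] := compact_bounded cK.
exists (`|M| + 1); first by rewrite addr_ge0.
move=> x Mx; have Kx : ~ K x.
  move=> Kx; have /= := HM (`|M| + 1) _ x Kx; rewrite leNgt Mx => /(_ _)/negP; apply => //.
  by rewrite (le_lt_trans (ler_norm M))// ltrDl.
by split=> [|v]; [exact: psi0|exact: (derive_eq0_out _ cK psi0)].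
Qed.

Lemma is_derive_line x v (s : R) :
  is_derive s (1 : R) (fun r => psi (x + r *: v)) ('D_v psi (x + s *: v)).
Proof.
apply/is_derive_cvg; have := @test_derivable (x + s *: v) v.
rewrite /derivable => /cvgP; rewrite -/(derive psi _ _).
have E : (fun h : R => h^-1 *: (psi (h *: v + (x + s *: v)) - psi (x + s *: v))) =
    (fun h => h^-1 * (psi (x + (s + h) *: v) - psi (x + s *: v))).
  apply/funext => h; rewrite [in RHS]scalerDl [in RHS]addrA.
  by rewrite [h *: v + _]addrC.
by rewrite -E.
Qed.

Lemma mean_value_line x v (s : R) : exists2 r, `|r| <= `|s| &
  psi (x + s *: v) - psi x = s * 'D_v psi (x + r *: v).
Proof.
have D r := is_derive_line x v r.
have C (a b : R) : {within `[a, b], continuous (fun r => psi (x + r *: v))}.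
  apply: continuous_subspaceT => r; apply: differentiable_continuous.
  by apply/derivable1_diffP; have Dr := D r.
have E0 : psi x = psi (x + 0 *: v) by rewrite scale0r addr0.
have [s0|s0] := leP 0 s.
  have [r + E] := MVT_segment s0 (fun r _ => D r) (C 0 s).
  rewrite in_itv /= => /andP[r0 rs]; exists r; first by rewrite !ger0_norm.
  by rewrite E0 E subr0 mulrC.
have [r + E] := MVT_segment (ltW s0) (fun r _ => D r) (C s 0).
rewrite in_itv /= => /andP[rs r0]; exists r; first by rewrite !ler0_norm ?lerN2// ltW.
by rewrite E0 -opprB E sub0r mulrN opprK mulrC.
Qed.

(** Test functions come with continuous directional derivatives rather than differentials. The chain
    rule along a path is assembled from increments in one fixed direction at a time, each treated by
    the mean value theorem from a moving base point [c h]. *)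
Lemma chain_rule_term (c : R -> V) (c0 : V) (s : R -> R) (ds : R) v :
  (c h @[h --> (0 : R)^'] --> c0) -> (h^-1 * s h @[h --> (0 : R)^'] --> ds) ->
  h^-1 * (psi (c h + s h *: v) - psi (c h)) @[h --> (0 : R)^'] --> ds * 'D_v psi c0.
Proof.
move=> cc cs; have /choice[r Hr] h : exists r, `|r| <= `|s h| /\
    psi (c h + s h *: v) - psi (c h) = s h * 'D_v psi (c h + r *: v).
  by have [r r1 r2] := mean_value_line (c h) v (s h); exists r.
have s0 : s h @[h --> (0 : R)^'] --> (0 : R).
  have Z : (h : R) @[h --> (0 : R)^'] --> (0 : R) by apply: cvg_within.
  have W : h * (h^-1 * s h) @[h --> (0 : R)^'] --> (0 : R).
    by rewrite -[X in _ --> X](mul0r ds); exact: cvgM.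
  apply: cvg_trans W; apply: near_eq_cvg; near=> h.
  have h0 : h != 0 by near: h; exact: nbhs_dnbhs_neq.
  by rewrite mulrA divff ?mul1r.
have r0 : r h @[h --> (0 : R)^'] --> (0 : R).
  apply/cvgr0Pnorm_le => e e0; near=> h; have [rs _] := Hr h; rewrite (le_trans rs)//.
  by near: h; have /cvgr0Pnorm_le/(_ e e0) := s0.
under eq_fun do rewrite (Hr _).2 mulrA.
apply: cvgM => //; apply: (@cvg_comp _ _ _ (fun h => c h + r h *: v) ('D_v psi) _ (nbhs c0)).
  have W : c h + r h *: v @[h --> (0 : R)^'] --> c0 + 0 *: v.
    by apply: cvgD => //; apply: cvgZ => //; exact: cvg_cst.
  by rewrite scale0r addr0 in W.
exact: test_derive_continuous.
Unshelve. all: by end_near. Qed.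

End test_function.
End test_functions.

Section divergence.
Context {R : realType} (d : nat).
Local Notation n := d.+2.
Local Notation lebn := (lebesgue_rV R n).

Lemma cauchy_kernel_box (x : 'rV[R]_n) (r : R) : (forall i, `|x 0 i| <= r) ->
  1 <= (1 + r ^+ 2) ^+ n * cauchy_kernel x.
Proof.
move=> xr; rewrite /cauchy_kernel /rVprod.
have -> : (1 + r ^+ 2) ^+ n = \prod_(i < n) (1 + r ^+ 2) by rewrite prodr_const card_ord.
rewrite -big_split /=.
apply: (@le_trans _ _ (\prod_(i < n) (1 : R))); first by rewrite big1.
apply: ler_prod => i _; rewrite ler01 /= ler_pdivlMr ?ltr_pwDl ?sqr_ge0// mul1r lerD2l.
by rewrite -real_normK ?num_real// lerXn2r ?nnegrE// (le_trans _ (xr i)).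
Qed.

Lemma coord_le_norm (x : 'rV[R]_n) i : `|x 0 i| <= `|x|.
Proof. by rewrite [leRHS]mx_normrE; exact: (le_bigmax _ _ (0, i)). Qed.

Lemma intg_cauchy_kernel : lebn.-integrable setT (EFin \o @cauchy_kernel R d).
Proof. exact: (intg_rVprod n (@intg_oneDsqrV R)). Qed.

Lemma compact_support_dominated (f : 'rV[R]_n -> R) (B r : R) : 0 <= B -> 0 <= r ->
  (forall x, `|f x| <= B) -> (forall x, r < `|x| -> f x = 0) ->
  forall x, `|f x| <= B * (1 + r ^+ 2) ^+ n * cauchy_kernel x.
Proof.
move=> B0 r0 fB f0 x; have /andP[k0 _] := cauchy_kernel_bounds x.
have [xr|/f0 ->] := leP `|x| r; last first.
  by rewrite normr0 mulr_ge0// mulr_ge0// exprn_ge0// addr_ge0 ?sqr_ge0.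
rewrite (le_trans (fB x))// -mulrA ler_peMr// cauchy_kernel_box// => i.
exact: le_trans (coord_le_norm x i) xr.
Qed.

(** Since [g] is constant along e_i, translation invariance makes the integral of [g] against every
    difference quotient of [psi] in this direction vanish; dominated convergence then passes to the
    derivative. *)
Lemma divergence_shear (i : 'I_n) (g psi : 'rV[R]_n -> R) : test_function psi ->
  measurable_fun setT g -> (forall x, `|g x| <= 1) ->
  (forall x s, g (x + s *: delta_mx 0 i) = g x) ->
  \int[lebn]_x (g x * 'D_(delta_mx 0 i) psi x) = 0.
Proof.
move=> tpsi mg g1 gi; set e := delta_mx 0 i.
have [r r0 Hr] := test_support tpsi; have [B B0 HB] := test_derive_bounded tpsi e.
have [C C0 HC] := test_bounded tpsi.
pose h (k : nat) : R := k.+1%:R^-1.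
have h0 k : h k != 0 by rewrite invr_eq0 pnatr_eq0.
have h1 k : `|h k| <= 1 by rewrite ger0_norm ?invr_ge0// invf_le1 ?ltr0n// ler1n.
pose F k x := g x * ((h k)^-1 * (psi (x + h k *: e) - psi x)).
have mpsi : measurable_fun setT psi by apply: continuous_measurable_rV; exact: test_continuous.
have st k := translation_scaling (h k *: e : 'rV[R]_n).
have Igpsi : lebn.-integrable setT (EFin \o (fun x => g x * psi x)).
  apply: (intg_le _ _ (intgZ (C * (1 + r ^+ 2) ^+ n) intg_cauchy_kernel)).
    exact: measurable_funM.
  move=> x; rewrite normrM; apply: (@le_trans _ _ `|psi x|); first by rewrite ler_piMl.
  by apply: compact_support_dominated => // y /Hr[].
have E k : F k = (fun x => (h k)^-1 *
    ((fun x => g x * psi x) (x + h k *: e) - g x * psi x)).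
  by apply/funext => x; rewrite /F gi; ring.
have I0 k : \int[lebn]_x F k x = 0.
  have I1 := integrable_scaling ler01 (st k) Igpsi.
  rewrite (E k) RintegralZl//; last exact: intgB.
  rewrite RintegralB// (Rintegral_scaling ler01 (st k) Igpsi).
  by rewrite mul1r subrr mulr0.
have cv : \int[lebn]_x F k x @[k --> \oo] --> \int[lebn]_x (g x * 'D_e psi x).
  (* Steps [h k] are at most 1 in size, so all difference quotients are supported in the ball
     enlarged by |e|. *)
  pose r' := r + `|e|.
  apply: (@Rdct _ _ _ lebn F _ (fun x => B * (1 + r' ^+ 2) ^+ n * cauchy_kernel x)).
  - move=> k; rewrite (E k); apply: measurable_funM; first exact: measurable_cst.
    apply: measurable_funB; last exact: measurable_funM.
    exact: (intg_measurable (integrable_scaling ler01 (st k) Igpsi)).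
  - by apply: intgZ; exact: intg_cauchy_kernel.
  - move=> x k; rewrite /F normrM.
    apply: (@le_trans _ _ `|(h k)^-1 * (psi (x + h k *: e) - psi x)|); first by rewrite ler_piMl.
    apply: (@compact_support_dominated (fun x => (h k)^-1 * (psi (x + h k *: e) - psi x))) => //.
    + by rewrite addr_ge0.
    + move=> y; have [s _ ->] := mean_value_line tpsi y e (h k).
      by rewrite mulKf.
    + move=> y ry; have ry1 : r < `|y| by apply: le_lt_trans ry; rewrite lerDl.
      have ry2 : r < `|y + h k *: e|.
        have := ler_normB (y + h k *: e) (h k *: e); rewrite addrK normrZ.
        have : `|h k| * `|e| <= `|e| by rewrite ler_piMl.
        by move: ry; rewrite /r'; lra.
      by rewrite (Hr _ ry1).1 (Hr _ ry2).1 subr0 mulr0.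
  - move=> x; apply: cvgM; first exact: cvg_cst.
    have D := is_derive_line tpsi x e 0; move/is_derive_cvg : D.
    rewrite scale0r addr0 => D.
    have hd : h k @[k --> \oo] --> (0 : R)^'.
      move=> A /= [eps /= eps0 epsA].
      have /cvgr0Pnorm_lt/(_ _ eps0)[N _ HN] := @cvg_harmonic R.
      exists N => // k /= Nk; apply: epsA => //=.
      by rewrite sub0r normrN; exact: HN.
    by have := cvg_comp _ _ hd D; under eq_fun do rewrite /= add0r.
have c0 : \int[lebn]_x F k x @[k --> \oo] --> (0 : R).
  by under eq_fun do rewrite I0; exact: cvg_cst.
exact: (cvg_unique _ cv c0).
Qed.

Variables (lev : nat -> seq (phase R)) (amp lip : nat -> R).
Hypothesis H : level_system lev amp lip.

Lemma divergence_free_u : divergence_free (@u R d lev).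
Proof.
move=> t t0 psi tpsi; have [E|[k [p [pk E]]]] := u_single d H t.
  transitivity (\int[lebn]_(x in setT) (0 : R)).
    by apply: eq_Rintegral => x _; rewrite big1// => i _; rewrite E mxE mul0r.
  by rewrite /Rintegral integral0.
transitivity (\int[lebn]_x (pspeed p t * pdisp p x * 'D_(delta_mx 0 (pmove d p)) psi x)).
  apply: eq_Rintegral => x _; rewrite (bigD1 (pmove d p))//= E !mxE !eqxx mulr1.
  by rewrite big1 ?addr0// => i /negbTE ip; rewrite !mxE ip !(mulr0, mul0r).
apply: divergence_shear => //.
- apply: measurable_funM; first exact: measurable_cst.
  have cp : continuous (pprof p) := level_regular H pk.
  exact: (measurableT_comp (continuous_measurable_fun cp) (measurable_rV_coor _)).
- by move=> x; exact: (level_speed H _ _ pk).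
- by move=> x s; rewrite pdisp_move.
Qed.

End divergence.

Lemma cvg_pairs {T : Type} {U W : topologicalType} (F : set_system T) (FF : Filter F)
    (f : T -> U) (g : T -> W) (a : U) (b : W) :
  f t @[t --> F] --> a -> g t @[t --> F] --> b ->
  (f t, g t) @[t --> F] --> (a, b).
Proof. by move=> fa gb; exact: cvg_pair. Qed.

(** * The datum carried by the flow as a weak solution *)

Section weak_solution.
Context {R : realType} (d : nat).
Local Notation n := d.+2.
Local Notation leb := (@lebesgue_measure R).
Local Notation lebn := (lebesgue_rV R n).
Local Notation lebtx := (leb \x lebn)%E.
Variables (lev : nat -> seq (phase R)) (amp lip : nat -> R).
Hypothesis H : level_system lev amp lip.
Local Notation phi := (@phi R d lev).
Local Notation phi_inv := (@phi_inv R d lev).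
Local Notation u := (@u R d lev).
Local Notation i0 := (i0 d).
Local Notation i1 := (i1 d).
Implicit Types (x : 'rV[R]_n) (t : R).

Lemma ord_cases (i : 'I_n) : [\/ i = i0, i = i1 | i != i0 /\ i != i1].
Proof.
have [->|a] := eqVneq i i0; first by constructor 1.
have [->|b] := eqVneq i i1; first by constructor 2.
by constructor 3.
Qed.

Lemma phi_coord_other t x i : i != i0 -> i != i1 -> phi t x 0 i = x 0 i.
Proof.
move=> /negbTE a /negbTE b; rewrite (phi_path H) mxE wsum_coord big1 ?addr0// => pw _.
by rewrite /pmove; case: pfirst; rewrite ?a ?b mulr0.
Qed.

Lemma u_coord_other t x i : i != i0 -> i != i1 -> u t x 0 i = 0.
Proof.
move=> /negbTE a /negbTE b; rewrite /u /field summxE big1 // => p _.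
by rewrite !mxE /pmove; case: pfirst; rewrite ?a ?b mulr0.
Qed.

Lemma sum_two (V : nmodType) (f : 'I_n -> V) :
  (forall i, i != i0 -> i != i1 -> f i = 0) -> \sum_(i < n) f i = f i0 + f i1.
Proof.
move=> f0; rewrite (bigD1 i0)//= (bigD1 i1)//= big1 ?addr0// => i /andP[a b].
exact: f0.
Qed.

Lemma continuous_phi_coord x i : continuous (fun t => phi t x 0 i).
Proof.
move=> t; apply: differentiable_continuous; apply/derivable1_diffP.
by have D := is_derive_phi H t x i.
Qed.

Lemma continuous_phi_time x : continuous (fun t => phi t x).
Proof. by apply: continuous_rV => i; exact: continuous_phi_coord. Qed.

Lemma continuous_path x : continuous (fun t => (t, phi t x) : R * 'rV[R]_n).
Proof. by move=> t; apply: cvg_pairs; [exact: cvg_id|exact: continuous_phi_time]. Qed.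

Section test.
Variable psi : R * 'rV[R]_n -> R.
Hypothesis tpsi : test_function psi.

Definition transport_op (p : R * 'rV[R]_n) : R :=
  'D_(1, 0) psi p + \sum_(i < n) u p.1 p.2 0 i * 'D_(0, delta_mx 0 i) psi p.

Lemma is_derive_along_path x t :
  is_derive t (1 : R) (fun s => psi (s, phi s x)) (transport_op (t, phi t x)).
Proof.
apply/is_derive_cvg; rewrite /transport_op /= sum_two; last first.
  by move=> i a b; rewrite u_coord_other ?mul0r.
pose del i h := phi (t + h) x 0 i - phi t x 0 i.
have Ldel i : h^-1 * del i h @[h --> (0 : R)^'] --> u t (phi t x) 0 i.
  by have /is_derive_cvg := is_derive_phi H t x i.
have Zdel i : del i h @[h --> (0 : R)^'] --> (0 : R).
  have C := @continuous_phi_coord x i t.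
  have Z : t + h @[h --> (0 : R)^'] --> t.
    rewrite -[X in _ --> X]addr0; apply: cvgD; first exact: cvg_cst.
    by apply: cvg_within.
  rewrite -[X in _ --> X](subrr (phi t x 0 i)); apply: cvgB; last exact: cvg_cst.
  exact: (@cvg_comp _ _ _ (fun h => t + h) (fun s => phi s x 0 i) _ (nbhs t) _ Z C).
have phiD h : phi (t + h) x = phi t x + del i0 h *: delta_mx 0 i0 + del i1 h *: delta_mx 0 i1.
  apply/rowP => i; rewrite !mxE eqxx /=; have [->|->|[a b]] := ord_cases i.
  - by rewrite eqxx /del mulr1 mulr0 addr0 addrC subrK.
  - by rewrite eqxx /del mulr1 mulr0 addr0 addrC subrK.
  - by rewrite (negbTE a) (negbTE b) !mulr0 !addr0 !phi_coord_other.
(* The increment from (t, phi t x) to (t + h, phi (t + h) x) is split into three moves, along the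
   first coordinate, then along the second, then in time; the other coordinates do not change. *)
have T1 := @chain_rule_term _ _ _ tpsi (fun h => (t, phi (t + h) x)) (t, phi t x) id 1 (1, 0).
have T2 := @chain_rule_term _ _ _ tpsi (fun h => (t, phi t x + del i0 h *: delta_mx 0 i0)) (t, phi t x)
  (del i1) (u t (phi t x) 0 i1) (0, delta_mx 0 i1).
have T3 := @chain_rule_term _ _ _ tpsi (fun h => (t, phi t x)) (t, phi t x)
  (del i0) (u t (phi t x) 0 i0) (0, delta_mx 0 i0).
have {}T1 := T1 _ _; have {}T2 := T2 _ (Ldel i1); have {}T3 := T3 (@cvg_cst _ _ _ _ _) (Ldel i0).
have C1 : (t, phi (t + h) x) @[h --> (0 : R)^'] --> (t, phi t x).
  apply: cvg_pairs; first exact: cvg_cst.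
  have Z : t + h @[h --> (0 : R)^'] --> t.
    rewrite -[X in _ --> X]addr0; apply: cvgD; first exact: cvg_cst.
    by apply: cvg_within.
  exact: (@cvg_comp _ _ _ (fun h => t + h) (fun s => phi s x) _ (nbhs t) _ Z (@continuous_phi_time x t)).
have C2 : (t, phi t x + del i0 h *: delta_mx 0 i0) @[h --> (0 : R)^'] --> (t, phi t x).
  apply: cvg_pairs; first exact: cvg_cst.
  have W : phi t x + del i0 h *: delta_mx 0 i0 @[h --> (0 : R)^'] --> phi t x + 0 *: delta_mx 0 i0.
    by apply: cvgD; [exact: cvg_cst|apply: cvgZ => //; exact: cvg_cst].
  by rewrite scale0r addr0 in W.
have C3 : h^-1 * id h @[h --> (0 : R)^'] --> (1 : R).
  apply: (@cvg_trans _ ((fun=> 1 : R) h @[h --> (0 : R)^'])); last exact: cvg_cst.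
  apply: near_eq_cvg; near=> h; have h0 : h != 0 by near: h; exact: nbhs_dnbhs_neq.
  by rewrite /= mulVf.
have W := cvgD (cvgD (T1 C1 C3) (T3 _)) (T2 C2).
rewrite mul1r in W; rewrite addrA.
suff E h : h^-1 * (psi (t + h, phi (t + h) x) - psi (t, phi t x)) =
  h^-1 * (psi ((t, phi (t + h) x) + h *: (1, 0)) - psi (t, phi (t + h) x)) +
  h^-1 * (psi ((t, phi t x) + del i0 h *: (0, delta_mx 0 i0)) - psi (t, phi t x)) +
  h^-1 * (psi ((t, phi t x + del i0 h *: delta_mx 0 i0) + del i1 h *: (0, delta_mx 0 i1)) -
    psi (t, phi t x + del i0 h *: delta_mx 0 i0)).
  by under eq_fun do rewrite E; exact: W.
rewrite -2!mulrDr; congr (_ * _).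
have -> : ((t, phi (t + h) x) : R * 'rV[R]_n) + h *: ((1, 0) : R * 'rV[R]_n) = (t + h, phi (t + h) x).
  by congr (_, _); rewrite /= ?scaler0 ?addr0// /GRing.scale /= mulr1.
have -> : ((t, phi t x) : R * 'rV[R]_n) + del i0 h *: ((0, delta_mx 0 i0) : R * 'rV[R]_n) =
    (t, phi t x + del i0 h *: delta_mx 0 i0).
  by congr (_, _); rewrite /= scaler0 addr0.
have -> : ((t, phi t x + del i0 h *: delta_mx 0 i0) : R * 'rV[R]_n) +
    del i1 h *: ((0, delta_mx 0 i1) : R * 'rV[R]_n) = (t, phi (t + h) x).
  by rewrite phiD; congr (_, _); rewrite /= scaler0 addr0.
move: (psi _) (psi _) (psi _) (psi _) => a b c e; ring.
Unshelve. all: by end_near. Qed.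

Lemma continuous_transport_path x : continuous (fun t => transport_op (t, phi t x)).
Proof.
have CD v : continuous (fun t => 'D_v psi (t, phi t x)).
  exact: (@continuous_composition _ _ _ _ _ (@continuous_path x) (@test_derive_continuous _ _ _ tpsi v)).
rewrite /transport_op; apply: continuous_fD => //; apply: continuous_fsum => i.
apply: continuous_fM => //=; under eq_fun do rewrite (u_path H).
exact: continuous_wsum.
Qed.

Lemma measurable_transport_op :
  measurable_fun [set: measurableTypeR R * 'rV[R]_n] (transport_op : _ -> measurableTypeR R).
Proof.
have mD v : measurable_fun [set: measurableTypeR R * 'rV[R]_n] ('D_v psi : _ -> measurableTypeR R).
  by apply: continuous_measurable_prod; exact: test_derive_continuous.
have mu : measurable_fun [set: measurableTypeR R * 'rV[R]_n] (fun p => u p.1 p.2).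
  by apply: (measurable_u H); [exact: measurable_fst|exact: measurable_snd].
have mui i := measurableT_comp (measurable_rV_coor i) mu.
rewrite (_ : transport_op = fun p => 'D_(1, 0) psi p +
    (u p.1 p.2 0 i0 * 'D_(0, delta_mx 0 i0) psi p + u p.1 p.2 0 i1 * 'D_(0, delta_mx 0 i1) psi p)).
  apply: measurable_funD; first exact: mD.
  by apply: measurable_funD; apply: measurable_funM; first [exact: mD|exact: mui].
apply/funext => p; rewrite /transport_op sum_two// => i a b.
by rewrite u_coord_other ?mul0r.
Qed.

Lemma transport_op_bounded : exists2 B, 0 <= B & forall p, `|transport_op p| <= B.
Proof.
have [B0 B00 HB0] := test_derive_bounded tpsi (1, 0).
have [B1 B10 HB1] := test_derive_bounded tpsi (0, delta_mx 0 i0).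
have [B2 B20 HB2] := test_derive_bounded tpsi (0, delta_mx 0 i1).
exists (B0 + (B1 + B2)); first by rewrite !addr_ge0.
move=> p; rewrite /transport_op sum_two; last by move=> i a b; rewrite u_coord_other ?mul0r.
have U i : `|u p.1 p.2 0 i| <= 1 by rewrite (le_trans (coord_le_enorm _ _))// (enorm_u_le1 H).
rewrite (le_trans (ler_normD _ _))// lerD// (le_trans (ler_normD _ _))// lerD// normrM.
  by rewrite (le_trans _ (HB1 p))// ler_piMl.
by rewrite (le_trans _ (HB2 p))// ler_piMl.
Qed.

Lemma transport_op_support : exists2 r, 0 <= r & forall p, r < p.1 ->
  psi p = 0 /\ transport_op p = 0.
Proof.
have [r r0 Hr] := test_support tpsi; exists r => // p rp.
have rp' : r < `|p|.
  apply: (lt_le_trans rp); rewrite (le_trans (ler_norm _))//.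
  by rewrite [leRHS]prod_normE le_max lexx.
have [-> D0] := Hr p rp'; split => //; rewrite /transport_op D0 add0r big1// => i _.
by rewrite D0 mulr0.
Qed.

End test.

Lemma path_scaling : measure_scaling lebtx 1 (fun p => (p.1, phi p.1 p.2)).
Proof.
apply: measure_scaling_skewr => [|t]; last exact: (@phi_scaling R d lev amp lip H t).
by apply: (measurable_phi H); [exact: measurable_fst|exact: measurable_snd].
Qed.

Lemma path_inv_scaling : measure_scaling lebtx 1 (fun p => (p.1, phi_inv p.1 p.2)).
Proof.
apply: measure_scaling_skewr => [|t]; last exact: (@phi_inv_scaling R d lev amp lip H t).
by apply: (measurable_phi_inv H); [exact: measurable_fst|exact: measurable_snd].
Qed.

Variable theta0 : 'rV[R]_n -> R.
Hypothesis I0 : lebn.-integrable setT (EFin \o theta0).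

Definition theta t x := theta0 (phi_inv t x).

Let ind T (t : measurableTypeR R) : R := \1_(`[0, T]) t.

Lemma intg_theta_window (T : R) :
  lebtx.-integrable setT (EFin \o (fun p => ind T p.1 * theta p.1 p.2)).
Proof.
have I1 : leb.-integrable setT (EFin \o ind T) by exact: integrable_indic_itv.
have I2 := intg_tensor I1 I0.
exact: (integrable_scaling ler01 path_inv_scaling I2).
Qed.

Lemma measurable_window (T : R) :
  measurable ([set t : measurableTypeR R | 0 <= t <= T] `*` [set: 'rV[R]_n]).
Proof.
apply: measurableX => //; rewrite (_ : [set t | _] = `[0, T]%classic); first exact: measurable_itv.
by apply/seteqP; split => t /=; rewrite in_itv.
Qed.

Lemma measurable_halfline :
  measurable ([set t : measurableTypeR R | 0 <= t] `*` [set: 'rV[R]_n]).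
Proof.
apply: measurableX => //; rewrite (_ : [set t | _] = `[0, +oo[%classic); first exact: measurable_itv.
by apply/seteqP; split => t /=; rewrite in_itv /= andbT.
Qed.

Lemma ind_in T t : 0 <= t <= T -> ind T t = 1.
Proof. by move=> tT; rewrite /ind indicE mem_set//= in_itv. Qed.

Lemma ind_out T t : ~~ (0 <= t <= T) -> ind T t = 0.
Proof. by move=> tT; rewrite /ind indicE memNset//= in_itv /=; exact/negP. Qed.

(** The change of variables (t, x) -> (t, phi t x) preserves measure and turns the space-time
    integral into one over trajectories, along which [transport_op psi] is the total time derivative
    of [psi]. Fubini's theorem and the fundamental theorem of calculus leave - theta0 x * psi (0,
    x). *)
Lemma theta_weak_solution : weak_solution u theta0 theta.
Proof.
split=> [T T0|psi tpsi D F].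
  have := @integrableS _ _ _ lebtx _ _ _ measurableT (measurable_window T) (@subsetT _ _) (intg_theta_window T).
  apply: eq_integrable => //; first exact: measurable_window.
  by move=> [t x]; rewrite inE => -[/= tT _]; rewrite ind_in ?mul1r.
(* [theta] is integrable on bounded time windows. The test function vanishes after time r, so the
   window up to r + 1 loses nothing and [psi] is 0 at its end. *)
have [r r0 Hr] := transport_op_support tpsi; pose T := r + 1.
have [B B0 HB] := transport_op_bounded tpsi; have mW := measurable_transport_op tpsi.
pose G (p : measurableTypeR R * 'rV[R]_n) := ind T p.1 * theta p.1 p.2 * transport_op psi p.
have IG : lebtx.-integrable setT (EFin \o G).
  exact: (intg_mulb (intg_theta_window T) mW HB).
have FG p : D p -> F p = G p.
  move=> [/= p0 _]; rewrite /F /G -/(transport_op psi p); have [pT|pT] := leP p.1 T.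
    by rewrite ind_in ?mul1r ?p0.
  have rp : r < p.1 by rewrite (lt_trans _ pT)// ltrDl.
  by rewrite (Hr p rp).2 !mulr0.
split.
  have := @integrableS _ _ _ lebtx _ _ _ measurableT measurable_halfline (@subsetT _ _) IG.
  apply: eq_integrable => //; first exact: measurable_halfline.
  by move=> p; rewrite inE => Dp /=; rewrite FG.
have [C C0 HC] := test_bounded tpsi.
have E1 : \int[lebtx]_(p in D) F p = \int[lebtx]_p G p.
  rewrite Rintegral_mkcond; apply: eq_Rintegral => p _; rewrite patchE.
  case: ifPn => [|]; first by rewrite inE => /FG.
  rewrite notin_setE => Dp; rewrite /G ind_out ?mul0r//.
  by apply/negP => /andP[p0 _]; apply: Dp.
have E2 : \int[lebtx]_p G p = \int[lebtx]_p G (p.1, phi p.1 p.2).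
  by rewrite (Rintegral_scaling ler01 path_scaling IG) mul1r.
pose J (p : measurableTypeR R * 'rV[R]_n) := ind T p.1 * theta0 p.2 * transport_op psi (p.1, phi p.1 p.2).
have E3 : (fun p => G (p.1, phi p.1 p.2)) = J.
  by apply/funext => p; rewrite /G /J /theta /= (phiK H).
have IJ : lebtx.-integrable setT (EFin \o J).
  by have := integrable_scaling ler01 path_scaling IG; rewrite -E3.
have mpath x : measurable_fun setT (fun t : measurableTypeR R => transport_op psi (t, phi t x)).
  by apply: continuous_measurable_fun; exact: continuous_transport_path.
have Iind : leb.-integrable setT (EFin \o ind T) by exact: integrable_indic_itv.
have IJx x : leb.-integrable setT (fun t => (J (t, x))%:E).
  have := intgZ (theta0 x) (intg_mulb Iind (mpath x) (fun t => HB (t, phi t x))).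
  by congr (_.-integrable _ _); apply/funext => t; rewrite /J /=; congr EFin; ring.
have E4 x : \int[leb]_t J (t, x) = - (theta0 x * psi (0, x)).
  transitivity (\int[leb]_t (theta0 x * (ind T t * transport_op psi (t, phi t x)))).
    by apply: eq_Rintegral => t _; rewrite /J /=; ring.
  rewrite RintegralZl//; last exact: (intg_mulb Iind (mpath x) (fun t => HB (t, phi t x))).
  rewrite -mulrN; congr (_ * _).
  transitivity (\int[leb]_(t in `[0, T]) transport_op psi (t, phi t x)).
    rewrite [RHS]Rintegral_mkcond; apply: eq_Rintegral => t _; rewrite patchE.
    case: ifPn; first by rewrite inE /= in_itv /= => tT; rewrite ind_in ?mul1r.
    by rewrite notin_setE /= in_itv /= => /negP tT; rewrite ind_out ?mul0r.
  transitivity (psi (T, phi T x) - psi (0, phi 0 x)).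
    apply: (@Rint_FTC _ (fun t => psi (t, phi t x))); first by rewrite /T ltr_wpDl.
      by move=> t; exact: is_derive_along_path.
    exact: continuous_transport_path.
  by rewrite (Hr (T, phi T x) _).1 ?sub0r ?(phi0 H)//= /T ltrDl.
have Ipsi0 : lebn.-integrable setT (EFin \o (fun x => theta0 x * psi (0, x))).
  apply: (intg_mulb I0 _ (fun x => HC (0, x))).
  apply: continuous_measurable_rV.
  apply: (@continuous_composition _ _ _ (fun x : 'rV[R]_n => (0, x) : R * 'rV[R]_n)).
    by move=> x; exact: (@cvg_pairs _ R 'rV[R]_n (nbhs x) _ (fun=> 0) id 0 x (cvg_cst _) cvg_id).
  exact: test_continuous.
rewrite E1 E2 E3 (Rfubini2 IJ IJx).
rewrite (_ : (fun y => \int[leb]_x J (x, y)) = (fun x => -1 * (theta0 x * psi (0, x)))); last first.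
  by apply/funext => x; rewrite E4 mulN1r.
by rewrite RintegralZl// mulN1r addNr.
Qed.

End weak_solution.

(** * Growth of translation differences under shears *)

Section sawtooth.
Context {R : realType}.

(** The distance of [t] to the nearest integer. *)
Definition saw (t : R) : R :=
  Num.min (t - (Num.floor t)%:~R) ((Num.floor t)%:~R + 1 - t).

Lemma floor_bounds (t : R) : (Num.floor t)%:~R <= t < (Num.floor t)%:~R + 1.
Proof. by have := floor_itv t; rewrite intrD. Qed.

Lemma saw_bounds t : 0 <= saw t <= 1 / 2.
Proof.
have /andP[a b] := floor_bounds t; rewrite /saw le_min ge_min.
apply/andP; split; first by apply/andP; split; lra.
have [c|c] := leP (t - (Num.floor t)%:~R) (1 / 2); first by [].
by rewrite orFb; lra.
Qed.

Lemma saw_le t (m : int) : saw t <= `|t - m%:~R|.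
Proof.
have /andP[a b] := floor_bounds t; rewrite /saw ge_min.
have [mt|mt] := leP m (Num.floor t).
  have : m%:~R <= (Num.floor t)%:~R :> R by rewrite ler_int.
  by move=> h; rewrite ger0_norm; [apply/orP; left|]; lra.
have : (Num.floor t + 1)%:~R <= m%:~R :> R by rewrite ler_int; lia.
by rewrite intrD => h; rewrite ler0_norm; [apply/orP; right|]; lra.
Qed.

Lemma saw_attained t : exists m : int, saw t = `|t - m%:~R|.
Proof.
have /andP[a b] := floor_bounds t; rewrite /saw.
have [c|c] := leP (t - (Num.floor t)%:~R) ((Num.floor t)%:~R + 1 - t).
  by exists (Num.floor t); rewrite ger0_norm//; lra.
by exists (Num.floor t + 1); rewrite intrD ler0_norm; lra.
Qed.

Lemma saw_lip t s : `|saw t - saw s| <= `|t - s|.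
Proof.
have [m Em] := saw_attained t; have [m' Em'] := saw_attained s.
have h1 := saw_le s m; have h2 := saw_le t m'.
have e1 := ler_normD (s - t) (t - m%:~R); have e2 := ler_normD (t - s) (s - m'%:~R).
rewrite addrA subrK (distrC s t) in e1; rewrite addrA subrK in e2.
by rewrite ler_norml; apply/andP; split; lra.
Qed.

Lemma sawE t (m : int) : 0 <= t - m%:~R <= 1 / 2 -> saw t = t - m%:~R.
Proof.
move=> /andP[a b]; apply/le_anti/andP; split.
  by rewrite (le_trans (saw_le t m))// ger0_norm.
have [m' ->] := saw_attained t; have [mm|mm] := leP m' m.
  have : m'%:~R <= m%:~R :> R by rewrite ler_int.
  by move=> h; rewrite ger0_norm; lra.
have : (m + 1)%:~R <= m'%:~R :> R by rewrite ler_int; lia.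
by rewrite intrD => h; rewrite ler0_norm; lra.
Qed.

(* Every point lies in the first quarter of a tooth of one of four translates of the sawtooth. *)
Lemma quarter_cover (t : R) : exists (j : 'I_4) (m : int), 0 <= t - j%:R / 4 - m%:~R <= 1 / 4.
Proof.
have /andP[a b] := floor_bounds t; set m := Num.floor t in a b *.
have [h1|h1] := leP t (m%:~R + 1 / 4); first by exists 0, m; rewrite /= mul0r; lra.
have [h2|h2] := leP t (m%:~R + 1 / 2).
  by exists (inord 1), m; rewrite inordK//; apply/andP; split; lra.
have [h3|h3] := leP t (m%:~R + 3 / 4).
  by exists (inord 2), m; rewrite inordK//; apply/andP; split; lra.
by exists (inord 3), m; rewrite inordK//; apply/andP; split; lra.
Qed.

Variables (c M r : R).

(** A sawtooth of period and slope r and 1. The minimum with a cone of slope 1 confines it to |y -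
    c| <= 1/2 while keeping it 1-Lipschitz, and leaves it unchanged for |y - c| <= 1/2 - r/2, since
    its height is at most r/2. *)
Definition tooth (a y : R) : R :=
  Num.min (r * saw ((y - a) / r)) (pos (1 / 2 - `|y - c|)).

(** The sign is chosen for the inverse shear, which transports the datum and then moves points by +
    M * tooth. *)
Definition profile (a y : R) : R := - (M * tooth a y).

Hypotheses (M0 : 0 <= M) (r0 : 0 < r).

Lemma tooth_bounds a y : 0 <= tooth a y <= r / 2.
Proof.
have /andP[s0 s1] := saw_bounds ((y - a) / r); rewrite /tooth le_min ge_min pos_ge0 andbT.
rewrite mulr_ge0 ?(ltW r0)//=; apply/orP; left.
by rewrite ler_wpM2l ?(ltW r0)//; move: s1; rewrite div1r.
Qed.

Lemma min_lip (a b a' b' e : R) : `|a - a'| <= e -> `|b - b'| <= e ->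
  `|Num.min a b - Num.min a' b'| <= e.
Proof.
rewrite !ler_norml => /andP[? ?] /andP[? ?].
by have [?|?] := leP a b; have [?|?] := leP a' b'; apply/andP; split; lra.
Qed.

Lemma pos_lip (a b : R) : `|pos a - pos b| <= `|a - b|.
Proof.
rewrite /pos; have [?|?] := leP 0 a; have [?|?] := leP 0 b; rewrite ?subrr ?normr0//.
- by rewrite subr0 !ger0_norm//; lra.
- by rewrite sub0r normrN ger0_norm// -[leRHS]normrN opprB ger0_norm; lra.
Qed.

Lemma tooth_lip a y z : `|tooth a y - tooth a z| <= `|y - z|.
Proof.
apply: min_lip; last first.
  rewrite (le_trans (pos_lip _ _))//.
  have -> : 1 / 2 - `|y - c| - (1 / 2 - `|z - c|) = - (`|y - c| - `|z - c|) by ring.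
  by rewrite normrN (le_trans (ler_dist_dist _ _))// opprB addrA subrK.
rewrite -mulrBr normrM (gtr0_norm r0).
apply: (@le_trans _ _ (r * `|(y - a) / r - (z - a) / r|)).
  by rewrite ler_wpM2l ?(ltW r0)// saw_lip.
rewrite -mulrBl opprB addrA subrK normrM normfV (gtr0_norm r0) mulrC divfK//.
by rewrite gt_eqF.
Qed.

(** Lipschitz with constant M on small scales, of oscillation at most M r on large ones. It is this
    minimum that the modulus of continuity has to dominate. *)
Lemma profile_lip a y z e : `|y - z| <= e -> `|profile a y - profile a z| <= M * Num.min e r.
Proof.
move=> yz; rewrite /profile -opprD normrN -mulrBr normrM (ger0_norm M0) ler_wpM2l//.
rewrite le_min (le_trans (tooth_lip a y z))//=.
have /andP[a1 a2] := tooth_bounds a y; have /andP[b1 b2] := tooth_bounds a z.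
by rewrite ler_norml; apply/andP; split; lra.
Qed.

Lemma lipschitz_continuous (f : R -> R) (K : R) :
  (forall y z, `|f y - f z| <= K * `|y - z|) -> continuous f.
Proof.
move=> fK y; apply/cvgrPdist_le => e e0.
have K1 : 0 < `|K| + 1 by rewrite ltr_wpDl.
exists (e / (`|K| + 1)) => /=; first by rewrite divr_gt0.
move=> z /= yz; rewrite (le_trans (fK y z))//.
apply: (@le_trans _ _ ((`|K| + 1) * `|y - z|)).
  by rewrite ler_wpM2r// (le_trans (ler_norm K))// lerDl.
by rewrite mulrC -ler_pdivlMr// ltW.
Qed.

Lemma continuous_profile a : continuous (profile a).
Proof.
apply: (@lipschitz_continuous _ M) => y z.
by rewrite (le_trans (profile_lip a (lexx _)))// ler_wpM2l// ge_min lexx.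
Qed.

Lemma profile_out a y : 1 / 2 <= `|y - c| -> profile a y = 0.
Proof.
move=> yc; rewrite /profile /tooth /pos [X in Num.min _ X]max_l; last by rewrite subr_le0.
rewrite min_r ?mulr0 ?oppr0//; have /andP[s0 _] := saw_bounds ((y - a) / r).
by rewrite mulr_ge0// ltW.
Qed.

Lemma profile_le a y : `|profile a y| <= M * r.
Proof.
have /andP[a1 a2] := tooth_bounds a y.
by rewrite /profile normrN normrM (ger0_norm M0) ler_wpM2l// ger0_norm//; lra.
Qed.

(** From the first quarter of a tooth, a shift by at most another quarter of the period does not
    leave the rising half. *)
Lemma tooth_rise a y s (m : int) : 0 <= s -> s <= r / 4 ->
  0 <= (y - a) / r - m%:~R <= 1 / 4 -> `|y - c| <= 1 / 2 - r ->
  tooth a (y + s) - tooth a y = s.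
Proof.
move=> s0 s1 /andP[h1 h2] yc.
have E1 : r * saw ((y - a) / r) = y - a - r * m%:~R.
  rewrite (@sawE _ m) ?h1 ?(le_trans h2)//; last lra.
  by rewrite mulrBr mulrCA divff ?gt_eqF// mulr1.
have sr : 0 <= s / r <= 1 / 4.
  by rewrite divr_ge0 ?(ltW r0)//= ler_pdivrMr//; lra.
have D : (y + s - a) / r = (y - a) / r + s / r by rewrite -mulrDl; congr (_ / _); ring.
have E2 : r * saw ((y + s - a) / r) = y + s - a - r * m%:~R.
  rewrite (@sawE _ m) ?D; last by apply/andP; split; lra.
  by rewrite -D mulrBr mulrCA divff ?gt_eqF// mulr1.
have P x : `|x - c| <= 1 / 2 - r / 2 -> tooth a x = r * saw ((x - a) / r).
  move=> xc; rewrite /tooth min_l//; have /andP[_ b] := saw_bounds ((x - a) / r).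
  rewrite /pos le_max; apply/orP; right.
  have : r * saw ((x - a) / r) <= r / 2 by rewrite ler_wpM2l ?(ltW r0)//; move: b; rewrite div1r.
  lra.
rewrite !P ?E1 ?E2; first ring.
  by rewrite (le_trans yc)//; lra.
have := ler_normD (y - c) s; rewrite (ger0_norm s0) addrAC; lra.
Qed.

End sawtooth.

Section variation.
Context {R : realType} (d : nat).
Local Notation n := d.+2.
Local Notation lebn := (lebesgue_rV R n).
Local Notation i0 := (i0 d).
Local Notation i1 := (i1 d).
Local Notation pmove := (pmove d).
Local Notation pread := (pread d).
Implicit Types (f : 'rV[R]_n -> R) (x z : 'rV[R]_n).

Definition variation z f : R := \int[lebn]_x ((f (x + z) - f x) ^+ 2).

Section bounded_integrable.
Variables (f : 'rV[R]_n -> R) (B : R).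
Hypotheses (If : lebn.-integrable setT (EFin \o f)) (fB : forall x, `|f x| <= B).

Lemma intg_sqr : lebn.-integrable setT (EFin \o (fun x => f x ^+ 2)).
Proof. exact: (intg_mulb If (intg_measurable If) fB). Qed.

Lemma intg_increment z : lebn.-integrable setT (EFin \o (fun x => f (x + z) - f x)).
Proof.
by apply: intgB => //; exact: (integrable_scaling ler01 (translation_scaling z) If).
Qed.

Lemma intg_variation z : lebn.-integrable setT (EFin \o (fun x => (f (x + z) - f x) ^+ 2)).
Proof.
have Ig := intg_increment z.
apply: (intg_mulb Ig (intg_measurable Ig) (B := B + B)) => x.
by rewrite (le_trans (ler_normB _ _))// lerD.
Qed.

Lemma variation_double z : variation (z + z) f <= 4 * variation z f.
Proof.
have Iz := intg_variation z; have st := translation_scaling z.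
have Iz' := integrable_scaling ler01 st Iz.
apply: (@le_trans _ _ (\int[lebn]_x (2 * (f (x + z + z) - f (x + z)) ^+ 2 +
    2 * (f (x + z) - f x) ^+ 2))).
  apply: Rint_le => [||x]; first exact: intg_variation.
    by apply: intgD; apply: intgZ => //; exact: Iz'.
  rewrite addrA; move: (f _) (f _) (f _) => a b c.
  by have := sqr_ge0 (c - a - (a - b)); rewrite !expr2; nra.
rewrite RintegralD//; last 2 first.
- by apply: intgZ; exact: Iz'.
- exact: intgZ.
rewrite !RintegralZl//.
by rewrite (Rintegral_scaling ler01 st Iz) mul1r -/(variation z f); lra.
Qed.

(** Read backwards, it bounds the variation at a small shift from below by the variation at a large
    one, losing a factor 4 per doubling. *)
Lemma variation_pow2 q z : variation (2 ^+ q *: z) f <= 4 ^+ q * variation z f.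
Proof.
elim: q => [|q IH]; first by rewrite !expr0 scale1r mul1r.
have -> : 2 ^+ q.+1 *: z = 2 ^+ q *: z + 2 ^+ q *: z.
  by rewrite exprS -scalerA scaler_nat mulr2n.
rewrite (le_trans (variation_double _))// exprS -mulrA.
by rewrite ler_wpM2l.
Qed.

Lemma variation_disjoint z : (forall x, f (x + z) * f x = 0) ->
  variation z f = 2 * \int[lebn]_x (f x ^+ 2).
Proof.
move=> f0; have st := translation_scaling z; have I2 := intg_sqr.
transitivity (\int[lebn]_x (f (x + z) ^+ 2 + f x ^+ 2)).
  apply: eq_Rintegral => x _; rewrite sqrrB; have := f0 x.
  by move: (f _) (f _) => a b ->; rewrite mul0rn subr0.
rewrite RintegralD//; last exact: (integrable_scaling ler01 st I2).
by rewrite (Rintegral_scaling ler01 st I2); ring.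
Qed.

End bounded_integrable.

Lemma exists_ge_mean (I : finType) (v : I -> R) (s : R) : (0 < #|I|)%N ->
  s <= \sum_i v i -> exists i, #|I|%:R^-1 * s <= v i.
Proof.
move=> I0 sv; apply: contrapT => /forallNP H; move: sv; apply/negP; rewrite -ltNge.
have I1 : 0 < #|I|%:R :> R by rewrite ltr0n.
have [i _] : exists i : I, true by case/card_gt0P : I0 => i _; exists i.
apply: (@lt_le_trans _ _ (\sum_(i : I) #|I|%:R^-1 * s)).
  apply: ltr_sum => [|j _]; last by rewrite ltNge; apply/negP/H.
  by apply/hasP; exists i; rewrite ?mem_index_enum.
by rewrite sumr_const -[leLHS]mulr_natl mulrA divff ?mul1r// gt_eqF.
Qed.

Section one_phase.
Variables (c M r : R).
Hypotheses (M0 : 0 <= M) (r0 : 0 < r) (r1 : r <= 1 / 8).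

Let r2 : 1 / 4 <= 1 / 2 - r. Proof. by move: r1; lra. Qed.
Let r3 : 1 / 4 + r / 4 <= 1 / 2 - r. Proof. by move: r1; lra. Qed.

Definition tooth_phase (s len : R) (b : bool) (a : R) : phase R :=
  Phase s len b (profile c M r a).

Lemma tooth_phase_inv s len b a x : pshear (tooth_phase s len b a) (-1) x =
  x + (M * tooth c r a (x 0 (pread (tooth_phase s len b a)))) *:
    delta_mx 0 (pmove (tooth_phase s len b a)).
Proof. by rewrite pshearE /pdisp /= /profile mulN1r opprK. Qed.

Lemma measurable_profile a : measurable_fun setT (profile c M r a).
Proof. by apply: continuous_measurable_fun; exact: continuous_profile. Qed.

(* On a rising tooth the inverse shear maps x + z and x to points that differ by
   z + M z_j e_i, with j the coordinate read and i the one moved. *)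
Lemma variation_phase s len b f B z :
  let p a := tooth_phase s len b a in
  lebn.-integrable setT (EFin \o f) -> (forall x, `|f x| <= B) ->
  (forall x, f x != 0 -> `|x 0 (pread (p 0)) - c| <= 1 / 4) ->
  0 <= z 0 (pread (p 0)) <= r / 4 ->
  exists a, 4^-1 * variation (z + (M * z 0 (pread (p 0))) *: delta_mx 0 (pmove (p 0))) f <=
    variation z (fun x => f (pshear (p a) (-1) x)).
Proof.
move=> p If fB fs /andP[z0 z1]; set z' := z + _.
have sc t a : measure_scaling lebn 1 (pshear (p a) t).
  by apply: pshear_scaling; exact: measurable_profile.
pose al (j : 'I_4) : R := j%:R / 4 * r.
pose G a x := (f (pshear (p a) (-1) (x + z)) - f (pshear (p a) (-1) x)) ^+ 2.
have Ip a : lebn.-integrable setT (EFin \o (fun x => f (pshear (p a) (-1) x))).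
  exact: (integrable_scaling ler01 (sc (-1) a) If).
have IG a : lebn.-integrable setT (EFin \o G a) by exact: (intg_variation (Ip a) (fun x => fB _) z).
have IGs a : lebn.-integrable setT (EFin \o (fun y => G a (pshear (p a) 1 y))).
  exact: (integrable_scaling ler01 (sc 1 a) (IG a)).
have [j Hj] : exists j : 'I_4, #|'I_4|%:R^-1 * variation z' f <=
    variation z (fun x => f (pshear (p (al j)) (-1) x)); last first.
  by exists (al j); rewrite card_ord in Hj.
apply: exists_ge_mean; first by rewrite card_ord.
have -> : \sum_(j < 4) variation z (fun x => f (pshear (p (al j)) (-1) x)) =
    \int[lebn]_y (\sum_(j < 4) G (al j) (pshear (p (al j)) 1 y)).
  rewrite Rint_sum//; apply: eq_bigr => j _.
  by rewrite (Rintegral_scaling ler01 (sc 1 (al j)) (IG (al j))) mul1r.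
(* After the substitution by the forward shears it suffices to find, at every y, one of the four
   translates whose term is the full integrand for the shift z'. *)
apply: Rint_le => [||y]; first exact: (intg_variation If fB).
  by apply: intg_sum => j; exact: IGs.
have S0 j : 0 <= G (al j) (pshear (p (al j)) 1 y) by exact: sqr_ge0.
have [E|E] := eqVneq ((f (y + z') - f y) ^+ 2) 0; first by rewrite E sumr_ge0.
(* A nonzero increment puts y or y + z' in the support of f. In either case the coordinate of y that
   is read stays where the sawtooth is not cut off, because z is at most r / 4 in that
   coordinate. *)
have yc : `|y 0 (pread (p 0)) - c| <= 1 / 2 - r.
  have [f1|f1] := eqVneq (f y) 0; last by rewrite (le_trans (fs y f1)).
  have f2 : f (y + z') != 0 by apply: contra_neq E => ->; rewrite f1 subrr expr0n.
  have := fs _ f2; rewrite !mxE eqxx /= (negbTE (pmove_neq d (p 0))) mulr0 addr0.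
  rewrite addrAC => h; rewrite -(addrK (z 0 (pread (p 0))) (y 0 (pread (p 0)) - c)).
  by rewrite (le_trans (ler_normB _ _))// (ger0_norm z0) (le_trans (lerD h z1)).
have [j [m jm]] := quarter_cover (y 0 (pread (p 0)) / r).
rewrite (bigD1 j)//= ler_wpDr//; first by rewrite sumr_ge0// => k _; exact: S0.
rewrite /G.
have pK : pshear (p (al j)) (-1) (pshear (p (al j)) 1 y) = y by rewrite pshearK.
have xr : (pshear (p (al j)) 1 y) 0 (pread (p 0)) = y 0 (pread (p 0)).
  by rewrite shearE (negbTE (pmove_neq d (p 0))) mulr0 addr0.
suff -> : pshear (p (al j)) (-1) (pshear (p (al j)) 1 y + z) = y + z' by rewrite pK.
rewrite -{2}pK; move: xr; set x := pshear _ 1 y => xr.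
rewrite 2!tooth_phase_inv -[pread _]/(pread (p 0)) -[pmove _]/(pmove (p 0)).
have -> : (x + z) 0 (pread (p 0)) = y 0 (pread (p 0)) + z 0 (pread (p 0)) by rewrite mxE xr.
have tr : tooth c r (al j) (y 0 (pread (p 0)) + z 0 (pread (p 0))) =
    tooth c r (al j) (y 0 (pread (p 0))) + z 0 (pread (p 0)).
  have am : 0 <= (y 0 (pread (p 0)) - al j) / r - m%:~R <= 1 / 4.
    by rewrite mulrBl /al mulfK ?gt_eqF.
  by apply/eqP; rewrite -subr_eq0 opprD addrA (tooth_rise r0 z0 z1 am yc) subrr.
rewrite tr xr /z' mulrDr scalerDl.
exact: addrACA.
Qed.

End one_phase.

Fixpoint full_inv (l : seq (phase R)) x : 'rV[R]_n :=
  if l is p :: l' then pshear p (-1) (full_inv l' x) else x.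

Definition plane_vec (ab : R * R) : 'rV[R]_n := ab.1 *: delta_mx 0 i0 + ab.2 *: delta_mx 0 i1.

Lemma plane_vec0 ab : plane_vec ab 0 i0 = ab.1.
Proof. by rewrite !mxE /= !mulr1 mulr0 addr0. Qed.

Lemma plane_vec1 ab : plane_vec ab 0 i1 = ab.2.
Proof. by rewrite !mxE /= mulr0 mulr1 add0r. Qed.

Section many_phases.
Variables (c M r delta len : R).
Hypotheses (M1 : 1 <= M) (r0 : 0 < r) (r1 : r <= 1 / 8) (delta0 : 0 <= delta) (len0 : 0 < len).
Let M0 : 0 <= M. Proof. exact: le_trans M1. Qed.

(* The shift of the initial datum corresponding to the shift (delta, delta) after L alternating phases. *)
Fixpoint back_shift (L : nat) (b : bool) : R * R :=
  if L is L'.+1 then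
    let ab := back_shift L' (~~ b) in
    if b then (ab.1 + M * ab.2, ab.2) else (ab.1, ab.2 + M * ab.1)
  else (delta, delta).

(** All components are nonnegative, so nothing cancels: each phase multiplies the larger bound by M
    + 1, and makes the updated component at least M times the one updated before. *)
Lemma back_shift_bounds L b : let ab := back_shift L b in
  [/\ 0 <= ab.1 <= delta * (M + 1) ^+ L, 0 <= ab.2 <= delta * (M + 1) ^+ L &
      delta * M ^+ L <= if b then ab.1 else ab.2].
Proof.
elim: L b => [|L IH] b /=; first by rewrite !expr0 mulr1 delta0 lexx; case: b.
have := IH (~~ b); move: (back_shift L (~~ b)) => [x y] /= [/andP[x0 x1] /andP[y0 y1] h].
have E : delta * (M + 1) ^+ L.+1 = delta * (M + 1) ^+ L + M * (delta * (M + 1) ^+ L).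
  by rewrite exprS; ring.
have E' : delta * M ^+ L.+1 = M * (delta * M ^+ L) by rewrite exprS; ring.
have P0 : 0 <= delta * (M + 1) ^+ L by exact: le_trans x1.
have MP0 : 0 <= M * (delta * (M + 1) ^+ L) by rewrite mulr_ge0.
have xM : M * x <= M * (delta * (M + 1) ^+ L) by rewrite ler_wpM2l.
have yM : M * y <= M * (delta * (M + 1) ^+ L) by rewrite ler_wpM2l.
have x0M : 0 <= M * x by rewrite mulr_ge0.
have y0M : 0 <= M * y by rewrite mulr_ge0.
rewrite E E'; case: b h {IH} => /= h; have hM := ler_wpM2l M0 h; split;
  try (apply/andP; split); lra.
Qed.

(** The shift in front of each phase is prescribed by [back_shift] whatever translates are used, so
    phases are chosen in chronological order, each for the function produced by the previous ones
    and at the cost of a factor 4. The half-width [rho] of the support grows by at most M r per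
    phase and has to stay below 1/4. *)
Lemma choose_phases L b s f B rho : 
  lebn.-integrable setT (EFin \o f) -> (forall x, `|f x| <= B) ->
  (forall x, f x != 0 -> `|x 0 i0 - c| <= rho /\ `|x 0 i1 - c| <= rho) ->
  rho + L%:R * (M * r) <= 1 / 4 -> delta * (M + 1) ^+ L <= r / 4 ->
  exists l : seq (phase R), [/\ size l = L, timely s (s + L%:R * len) l,
    (forall p, p \in l -> plen p = len /\ exists a, pprof p = profile c M r a) &
    (4 ^+ L)^-1 * variation (plane_vec (back_shift L b)) f <=
      variation (plane_vec (delta, delta)) (fun x => f (full_inv l x))].
Proof.
elim: L b s f rho => [|L IH] b s f rho If fB fs rL dL.
  by exists [::]; split => //=; rewrite ?mul0r ?addr0// invr1 mul1r.
have Mr0 : 0 <= M * r by rewrite mulr_ge0// ltW.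
have L0 : 0 <= L%:R :> R by [].
have dL' : delta * (M + 1) ^+ L <= r / 4.
  by apply: le_trans dL; rewrite ler_wpM2l// ler_weXn2l// lerDr.
have rho1 : rho <= 1 / 4.
  by apply: le_trans rL; rewrite lerDl mulr_ge0.
pose z := plane_vec (back_shift L (~~ b)).
have [/andP[x0 x1] /andP[y0 y1] _] := back_shift_bounds L (~~ b).
have [||a Ha] := @variation_phase c M r M0 r0 r1 s len b f B z If fB.
- by move=> x /fs[h0 h1]; rewrite /pread /=; case: (b); apply: le_trans rho1.
- move: x0 x1 y0 y1; rewrite /pread /z /=; case: (b) => x0 x1 y0 y1.
    by rewrite plane_vec1 y0 (le_trans y1).
  by rewrite plane_vec0 x0 (le_trans x1).
pose p := tooth_phase c M r s len b a.
pose f1 x := f (pshear p (-1) x).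
have If1 : lebn.-integrable setT (EFin \o f1).
  apply: (integrable_scaling ler01 _ If); apply: pshear_scaling.
  exact: measurable_profile.
have f1s x : f1 x != 0 -> `|x 0 i0 - c| <= rho + M * r /\ `|x 0 i1 - c| <= rho + M * r.
  move=> /fs[]; rewrite !shearE => h0 h1.
  have pb i : `|-1 * pdisp p x * (i == pmove p)%:R| <= M * r.
    rewrite mulN1r mulNr normrN normrM (le_trans _ (profile_le c M0 r0 a (x 0 (pread p))))//.
    by rewrite ler_piMr// ger0_norm// lern1 leq_b1.
  split.
  - rewrite -(addrK (-1 * pdisp p x * (i0 == pmove p)%:R) (x 0 i0 - c)).
    by rewrite (le_trans (ler_normB _ _))// lerD// addrAC.
  - rewrite -(addrK (-1 * pdisp p x * (i1 == pmove p)%:R) (x 0 i1 - c)).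
    by rewrite (le_trans (ler_normB _ _))// lerD// addrAC.
have [||l [sl tl pl Vl]] := IH (~~ b) (s + len) f1 (rho + M * r) If1 (fun x => fB _) f1s => //.
  by move: rL; rewrite -natr1 mulrDl mul1r; lra.
exists (p :: l); split.
- by rewrite /= sl.
- split => //=; rewrite -natr1 mulrDl mul1r.
  by have -> : s + (L%:R * len + len) = s + len + L%:R * len by ring.
- move=> q; rewrite inE => /predU1P[->|/pl//]; split => //; by exists a.
- apply: le_trans Vl; rewrite exprS invfM -mulrA mulrCA ler_wpM2l ?invr_ge0 ?exprn_ge0//.
  apply: le_trans Ha; rewrite ler_wpM2l// le_eqVlt; apply/orP; left; apply/eqP.
  congr (variation _ f); rewrite /z /pread /pmove /=.
  case: (b); rewrite ?plane_vec0 ?plane_vec1 /plane_vec /= scalerDl ?addrA//.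
  by rewrite -!addrA; congr (_ + _); rewrite addrC.
Qed.

End many_phases.

End variation.

(** * Choice of the parameters *)

Section parameters.
Context {R : realType}.

Lemma expR1_le4 : expR 1 <= 4 :> R.
Proof.
have h := expR_ge1Dx (- (1 / 2) : R).
have p := expR_gt0 (1 / 2 : R).
have E : expR (1 / 2) * expR (- (1 / 2)) = 1 :> R by rewrite -expRD subrr expR0.
have -> : (1 : R) = 1 / 2 + 1 / 2 by field.
rewrite expRD; move: h p E; move: (expR (1 / 2)) (expR (- (1 / 2))) => a b h p E.
have : a <= 2 by nra.
nra.
Qed.

Variable Theta : R -> R.
Hypothesis adm : admissible_growth Theta.

(** The third condition makes the modulus dominate below the scale e^(-L/2); the fourth does so
    above it, and also keeps the total displacement of a level small. That k <= L is used when the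
    final bounds are compared. *)
Definition size_ok (k L : nat) := [/\ (5 <= L)%N, (k <= L)%N,
  8 * 8 ^+ k <= Theta (L%:R / 2) & 16 * 8 ^+ k * L%:R * expR (- (L%:R / 2)) <= 1 :> R].

Lemma size_exists k : exists L, size_ok k L.
Proof.
have [_ _ mono tend _] := adm.
have /cvgryPge/(_ (8 * 8 ^+ k)) [A [Ar HA]] := tend.
(* Since e^(L/2) >= (L/4)^2, the last condition follows from 16 * 8^k * L <= L^2 / 16, that is, from
   256 * 8^k <= L. *)
pose B : R := 256 * 8 ^+ k.
pose L := (5 + k + (Num.truncn (2 * `|A|)).+1 + (Num.truncn B).+1)%N.
have LA : 2 * `|A| < L%:R.
  rewrite (lt_le_trans (truncnS_gt _))// ler_nat /L -addnA.
  exact: leq_trans (leq_addr _ _) (leq_addl _ _).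
have LB : B < L%:R by rewrite (lt_le_trans (truncnS_gt _))// ler_nat leq_addl.
have L5 : (5 <= L)%N by rewrite /L -!addnA leq_addr.
have Lk : (k <= L)%N by rewrite /L -!addnA addnCA leq_addr.
clearbody L; exists L; split => //.
  by apply: HA; have := ler_norm A; lra.
have B0 : 0 <= B by rewrite mulr_ge0// exprn_ge0.
have L0 : 0 < L%:R :> R by exact: le_lt_trans LB.
have e4 : L%:R / 4 <= expR (L%:R / 4) :> R by rewrite (le_trans _ (expR_ge1Dx _))// lerDr ler01.
have E : expR (L%:R / 4) ^+ 2 * expR (- (L%:R / 2)) = 1 :> R.
  have E0 : L%:R / 4 + L%:R / 4 - L%:R / 2 = 0 :> R by field.
  by rewrite expr2 -!expRD E0 expR0.
have p2 := expR_gt0 (- (L%:R / 2) : R).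
move: E e4 p2 LB L0 B0; rewrite /B.
move: (expR (L%:R / 4 : R)) (expR (- (L%:R / 2) : R)) => a b.
move: ((8 : R) ^+ k) (L%:R : R) => e l E e4 p2 LB L0 B0.
have l2 : (l / 4) ^+ 2 * b <= 1.
  have l40 : 0 <= l / 4 by rewrite divr_ge0 ?(ltW L0).
  apply: (@le_trans _ _ (a ^+ 2 * b)); last by rewrite E.
  by rewrite ler_wpM2r ?(ltW p2)// lerXn2r ?nnegrE ?(le_trans l40).
apply: le_trans l2; rewrite ler_wpM2r ?(ltW p2)//.
have : 256 * e * l <= l * l by rewrite ler_wpM2r ?(ltW L0) ?(ltW LB).
by rewrite expr2; lra.
Qed.

Variables (k L : nat).
Hypothesis ok : size_ok k L.

Definition tooth_size : R := expR (- L%:R).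
Local Notation r := tooth_size.

Lemma tooth_size_gt0 : 0 < r. Proof. exact: expR_gt0. Qed.

Lemma tooth_size_le_half : r <= expR (- (L%:R / 2)).
Proof. by rewrite ler_expR lerN2; have : 0 <= L%:R :> R by []; lra. Qed.

Lemma size_gt0 : 5 <= L%:R :> R.
Proof. by have [L5 _ _ _] := ok; rewrite ler_nat. Qed.

Lemma tooth_total : 16 * 8 ^+ k * L%:R * r <= 1.
Proof.
have [_ _ _ h] := ok; apply: le_trans h; rewrite ler_wpM2l ?tooth_size_le_half//.
Qed.

Lemma tooth_size_small : r <= 1 / 80.
Proof.
have L5 := size_gt0; have h := tooth_total; have r0 := tooth_size_gt0.
have e1 : 1 <= 8 ^+ k :> R by rewrite exprn_ege1// ler1n.
have : 80 * r <= 16 * 8 ^+ k * L%:R * r.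
  rewrite ler_wpM2r ?(ltW r0)//.
  by move: L5 e1; move: (L%:R) (8 ^+ k) => a b; nra.
lra.
Qed.

Lemma tooth_size_ge : (4 ^+ L)^-1 <= r.
Proof.
rewrite /tooth_size expRN lef_pV2 ?posrE ?expR_gt0 ?exprn_gt0//.
rewrite -(mulr_natl 1 L) expRM_natl lerXn2r ?nnegrE ?expR_ge0 ?expR1_le4//.
Qed.

Lemma phi_modulus_ge0 (x : R) : 0 <= x -> 0 <= phi_modulus Theta x.
Proof.
have [pos0 _ _ _ _] := adm => x0; rewrite /phi_modulus; case: ifPn => // ; rewrite -ltNge => xp.
have T3 : 0 <= Theta 3 by rewrite ltW// pos0// ler1n.
case: ifPn => x2; last by rewrite mulr_ge0// mulr_ge0// expR_ge0.
have l3 : 3 <= ln (expR 1 / x).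
  rewrite -ler_expR lnK ?posrE ?divr_gt0 ?expR_gt0// ler_pdivlMr//.
  have : expR 3 * x <= expR 3 * expR (- 2) by rewrite ler_wpM2l ?expR_ge0// ltW.
  by rewrite -expRD (_ : 3 - 2 = 1) //; lra.
rewrite mulr_ge0// ?mulr_ge0//; first by rewrite (le_trans _ l3).
by rewrite ltW// pos0// (le_trans _ l3)// ler1n.
Qed.

(** Below e^(-L/2) the logarithm is at least L/2 and [Theta] there at least 8 * 8^k, and their
    product is exactly 4 * 8^k * L. Above, the left-hand side is at most 4 * 8^k * L * e^(-L) <=
    e^(-L/2), while the modulus is at least e^(-L/2) * Theta 1. The factor on the right covers both
    cases. *)
Lemma modulus_bound (e : R) : 0 <= e ->
  4 * 8 ^+ k * L%:R * Num.min e r <= (1 + (Theta 1)^-1) * phi_modulus Theta e.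
Proof.
move=> e0; have [pos0 _ mono _ _] := adm; have [_ _ okT okh] := ok.
have L5 := size_gt0; have r0 := tooth_size_gt0; have T1 : 0 < Theta 1 by exact: pos0.
have P0 := phi_modulus_ge0 e0.
have P1 : phi_modulus Theta e <= (1 + (Theta 1)^-1) * phi_modulus Theta e.
  by rewrite mulrDl mul1r lerDl mulr_ge0// invr_ge0 ltW.
have P2 : (Theta 1)^-1 * phi_modulus Theta e <= (1 + (Theta 1)^-1) * phi_modulus Theta e.
  by rewrite mulrDl mul1r lerDr.
have c0 : 0 <= 4 * 8 ^+ k * L%:R :> R by rewrite mulr_ge0// mulr_ge0// exprn_ge0.
have half2 : expR (- (L%:R / 2)) < expR (- 2) :> R by rewrite ltr_expR ltrN2; lra.
have [small|big] := ltP e (expR (- (L%:R / 2))).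
  apply: le_trans P1; apply: (@le_trans _ _ (4 * 8 ^+ k * L%:R * e)).
    by rewrite ler_wpM2l// ge_min lexx.
  rewrite /phi_modulus; case: ifPn => [e1|]; first by rewrite mulr_ge0_le0.
  rewrite -ltNge => ep; rewrite (lt_trans small half2).
  have l2 : L%:R / 2 <= ln (expR 1 / e).
    rewrite -ler_expR lnK ?posrE ?divr_gt0 ?expR_gt0// ler_pdivlMr//.
    have : expR (L%:R / 2) * e <= expR (L%:R / 2) * expR (- (L%:R / 2)).
      by rewrite ler_wpM2l ?expR_ge0// ltW.
    by rewrite -expRD subrr expR0 => h; rewrite (le_trans h)// -expR0 ler_expR.
  have T2 : 8 * 8 ^+ k <= Theta (ln (expR 1 / e)).
    by rewrite (le_trans okT)// mono//; lra.
  apply: (@le_trans _ _ (e * (L%:R / 2) * (8 * 8 ^+ k))).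
    by rewrite le_eqVlt; apply/orP; left; apply/eqP; field.
  have E80 : 0 <= 8 * 8 ^+ k :> R by rewrite mulr_ge0// exprn_ge0.
  apply: ler_pM => //; first by rewrite mulr_ge0//; lra.
  by rewrite ler_wpM2l.
apply: le_trans P2; rewrite ler_pdivlMl//.
apply: (@le_trans _ _ (expR (- (L%:R / 2)) * Theta 1)).
  rewrite mulrC ler_wpM2r ?(ltW T1)//.
  apply: (@le_trans _ _ (4 * 8 ^+ k * L%:R * expR (- (L%:R / 2)) * expR (- (L%:R / 2)))).
    rewrite -[leRHS]mulrA; apply: ler_wpM2l => //; rewrite ge_min; apply/orP; right.
    have E : - (L%:R / 2) - L%:R / 2 = - L%:R :> R by field.
    by rewrite /tooth_size -expRD E lexx.
  rewrite ler_piMl ?expR_ge0//.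
  apply: le_trans okh; rewrite -!mulrA ler_wpM2r ?ler_nat//.
rewrite /phi_modulus; case: ifPn => [e1|].
  by have := lt_le_trans (expR_gt0 _) (le_trans big e1); rewrite ltxx.
rewrite -ltNge => ep; case: ifPn => [e2|e2].
  have l3 : 1 <= ln (expR 1 / e).
    rewrite -ler_expR lnK ?posrE ?divr_gt0 ?expR_gt0// ler_pdivlMr//.
    rewrite ler_piMr ?expR_ge0// (le_trans (ltW e2))// -expR0 ler_expR; lra.
  apply: ler_pM => //; rewrite ?expR_ge0 ?(ltW T1)//; last by apply: mono.
  by rewrite (le_trans big)// ler_peMr.
apply: ler_pM => //; rewrite ?expR_ge0 ?(ltW T1)//; last by apply: mono => //; rewrite ler1n.
by rewrite (le_trans (ltW half2))// ler_peMl ?expR_ge0// ler1n.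
Qed.

End parameters.

Section level_construction.
Context {R : realType} (d : nat) (Theta : R -> R) (m : nat).
Local Notation n := d.+2.
Local Notation lebn := (lebesgue_rV R n).
Local Notation i0 := (i0 d).
Local Notation i1 := (i1 d).
Hypothesis adm : admissible_growth Theta.

(** The largest shift whose upper bound delta * (M + 1)^L through all phases, with M = 4^k, stays
    within a quarter of a tooth. *)
Definition shift_size (k L : nat) : R := @tooth_size R L / 4 / (4 ^+ k + 1) ^+ L.

Definition good_level (k L : nat) (l : seq (phase R)) : Prop :=
  [/\ size_ok Theta k L, size l = L, timely (2 ^- k.+1) (2 ^- k) l,
    (forall p, p \in l -> plen p = 2 ^- k.+1 / L%:R /\
      exists a, pprof p = profile (center_coord k) (4 ^+ k) (tooth_size L) a) &
    (4 ^+ L)^-1 * variation (plane_vec d (back_shift (4 ^+ k) (shift_size k L) L true))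
        (datum_piece m k) <=
      variation (plane_vec d (shift_size k L, shift_size k L))
        (fun x => datum_piece m k (full_inv l x))].

Lemma pow4_ge1 k : 1 <= 4 ^+ k :> R. Proof. by rewrite exprn_ege1// ler1n. Qed.

Lemma center_coordE k (i : 'I_n) : (i < 2)%N -> (center d k : 'rV[R]_n) 0 i = center_coord k.
Proof. by move=> i2; rewrite mxE i2. Qed.

Lemma datum_piece_coord k x : datum_piece m k x != 0 ->
  `|x 0 i0 - center_coord k| <= 1 / 16 :> R /\ `|x 0 i1 - center_coord k| <= 1 / 16 :> R.
Proof.
move=> /datum_piece_neq0 xk.
have B (i : 'I_n) : (i < 2)%N -> `|x 0 i - center_coord k| <= 1 / 16.
  move=> i2; have := bump_coord i xk; rewrite mxE [X in _ + X]mxE center_coordE// => h.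
  rewrite (le_trans (ltW h))// div1r lef_pV2 ?posrE ?mulr_gt0//.
  by rewrite -natrM ler_nat; lia.
by split; exact: B.
Qed.

Lemma good_level_exists k : exists Ll, good_level k Ll.1 Ll.2.
Proof.
have [L ok] := size_exists adm k; have M1 := pow4_ge1 k.
have r0 := @tooth_size_gt0 R L; have rs := tooth_size_small ok.
have L5 := size_gt0 ok; have L0 : 0 < L%:R :> R by rewrite (lt_le_trans _ L5).
have r1 : tooth_size L <= 1 / 8 :> R by rewrite (le_trans rs)//; lra.
have Mp : 0 < (4 ^+ k + 1) ^+ L :> R by rewrite exprn_gt0// ltr_wpDl// (le_trans ler01).
have d0 : 0 <= shift_size k L by rewrite /shift_size !divr_ge0 ?(ltW r0) ?(ltW Mp).
have len0 : 0 < 2 ^- k.+1 / L%:R :> R by rewrite divr_gt0// invr_gt0 exprn_gt0.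
have tot : L%:R * (4 ^+ k * tooth_size L) <= 1 / 16 :> R.
  have h := tooth_total ok; rewrite ler_pdivlMr//; apply: le_trans h.
  have -> : 16 * 8 ^+ k * L%:R * tooth_size L = 8 ^+ k * (L%:R * tooth_size L * 16) :> R by ring.
  have -> : L%:R * (4 ^+ k * tooth_size L) * 16 = 4 ^+ k * (L%:R * tooth_size L * 16) :> R by ring.
  by rewrite ler_wpM2r ?mulr_ge0 ?(ltW r0)// lerXn2r ?nnegrE// ler_nat.
have b1 (x : 'rV[R]_n) : `|datum_piece m k x| <= 1.
  by rewrite ger0_norm ?datum_piece_ge0 ?datum_piece_le1.
have [||l [sl tl pl Vl]] := @choose_phases R d (center_coord k) (4 ^+ k) (tooth_size L)
    (shift_size k L) (2 ^- k.+1 / L%:R) M1 r0 r1 d0 len0 L true (2 ^- k.+1)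
    (datum_piece m k) 1 (1 / 16) (intg_datum_piece d m k)
    b1 (@datum_piece_coord k).
- by rewrite (le_trans (lerD (lexx _) tot))//; lra.
- by rewrite /shift_size divfK// gt_eqF.
- exists (L, l); split => //=.
  have E : 2 ^- k.+1 + L%:R * (2 ^- k.+1 / L%:R) = 2 ^- k :> R.
    rewrite mulrC divfK ?gt_eqF// exprS invfM; have : (2 : R) ^- k != 0 by rewrite invr_eq0 expf_neq0.
    by move: ((2 : R) ^- k) => e _; field.
  by rewrite E in tl.
Qed.

Definition level_data (k : nat) : nat * seq (phase R) := projT1 (cid (good_level_exists k)).
Definition levels k : seq (phase R) := (level_data k).2.
Definition level_count k : nat := (level_data k).1.

Lemma levels_good k : good_level k (level_count k) (levels k).
Proof. exact: (projT2 (cid (good_level_exists k))). Qed.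

Definition level_amplitude k : R := 4 ^+ k * tooth_size (level_count k).
Definition level_lipschitz k : R := 4 * 2 ^+ k * (level_count k)%:R * 4 ^+ k.

Lemma level_pspeed k p t : p \in levels k ->
  `|pspeed p t| <= 4 * 2 ^+ k * (level_count k)%:R.
Proof.
move=> pk; have [ok _ tl /(_ _ pk)[pl _] _] := levels_good k.
have [p0 _ _] := timely_mem tl pk; have /andP[a b] := pspeed_bounds t p0.
rewrite ger0_norm// (le_trans b)// pl invf_div invrK exprS.
by rewrite le_eqVlt; apply/orP; left; apply/eqP; ring.
Qed.

Lemma level_tooth_speed k p t y z e : p \in levels k -> `|y - z| <= e ->
  `|pspeed p t * (pprof p y - pprof p z)| <=
    4 * 8 ^+ k * (level_count k)%:R * Num.min e (tooth_size (level_count k)).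
Proof.
move=> pk yz; have [ok _ tl /(_ _ pk)[pl [a pa]] _] := levels_good k.
rewrite normrM pa; have M0 := le_trans ler01 (pow4_ge1 k).
have r0 := @tooth_size_gt0 R (level_count k).
have h := @profile_lip R (center_coord k) _ _ M0 r0 a y z e yz.
apply: (le_trans (ler_pM _ _ (level_pspeed t pk) h)) => //.
have -> : (8 : R) = 2 * 4 by rewrite -natrM.
by rewrite exprMn le_eqVlt; apply/orP; left; apply/eqP; ring.
Qed.

Lemma levels_system : level_system levels level_amplitude level_lipschitz.
Proof.
have M0 k : 0 <= 4 ^+ k :> R by rewrite (le_trans ler01)// pow4_ge1.
have r0 k := @tooth_size_gt0 R (level_count k).
have amp k p y : p \in levels k -> `|pprof p y| <= level_amplitude k.
  move=> pk; have [_ _ _ /(_ _ pk)[_ [a ->]] _] := levels_good k.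
  exact: profile_le.
have tot k : 16 * 8 ^+ k * (level_count k)%:R * tooth_size (level_count k) <= 1 :> R.
  by have [ok _ _ _ _] := levels_good k; exact: tooth_total ok.
have e8 k : (8 : R) ^+ k = 2 ^+ k * 4 ^+ k by rewrite -exprMn -natrM.
have P k : 0 <= 2 ^+ k * 4 ^+ k * (level_count k)%:R * tooth_size (level_count k) :> R.
  by rewrite mulr_ge0 ?(ltW (r0 k))// mulr_ge0// mulr_ge0// exprn_ge0.
split.
- by move=> k; have [] := levels_good k.
- move=> k p pk; have [_ _ _ /(_ _ pk)[_ [a ->]] _] := levels_good k.
  exact: continuous_profile.
- move=> k p y pk yc; have [_ _ _ /(_ _ pk)[_ [a ->]] _] := levels_good k.
  exact: profile_out.
- exact: amp.
- move=> k; have [_ -> _ _ _] := levels_good k; rewrite -[leRHS]mul1r ler_pdivlMr ?exprn_gt0//.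
  apply: le_trans (tot k); rewrite /level_amplitude e8 !exprS le_eqVlt.
  by apply/orP; left; apply/eqP; ring.
- move=> k p t y pk; rewrite normrM.
  apply: (le_trans (ler_pM _ _ (level_pspeed t pk) (amp k p y pk))) => //.
  apply: le_trans (tot k); rewrite /level_amplitude e8; move: (P k).
  move: (2 ^+ k) (4 ^+ k) ((level_count k)%:R) (tooth_size (level_count k)) => a b c e; lra.
- by move=> k; rewrite /level_lipschitz !mulr_ge0// exprn_ge0.
- move=> k p t y z pk; apply: (le_trans (level_tooth_speed t pk (lexx _))).
  apply: (@le_trans _ _ (4 * 8 ^+ k * (level_count k)%:R * `|y - z|)).
    by rewrite ler_wpM2l ?ge_min ?lexx// mulr_ge0// mulr_ge0// exprn_ge0.
  rewrite /level_lipschitz e8 le_eqVlt; apply/orP; left; apply/eqP; ring.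
Qed.

Lemma levels_modulus : has_modulus (phi_modulus Theta) (@u R d levels).
Proof.
have [pos0 _ _ _ _] := adm; have T1 := pos0 1 (lexx _).
apply: (@has_modulus_u R d _ _ _ levels_system _ (1 + (Theta 1)^-1)).
- by rewrite ltr_pwDl// invr_ge0 ltW.
- exact: phi_modulus_ge0.
- move=> k p t y z r pk yz; have [ok _ _ _ _] := levels_good k.
  rewrite (le_trans (level_tooth_speed t pk yz))// (modulus_bound adm ok)//.
  exact: le_trans yz.
Qed.

Lemma full_invE k t (x : 'rV[R]_n) : 2 ^- k <= t -> flow_inv (levels k) t x = full_inv (levels k) x.
Proof.
move=> kt; have [_ _ tl _ _] := levels_good k; move: tl.
elim: (levels k) (2 ^- k.+1) => //= p l IH s [p0 sp tl].
rewrite (IH _ tl) pstep_after// (le_trans _ kt)//.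
exact: timely_le tl.
Qed.

End level_construction.

(** * Loss of regularity *)

Section pieces.
Context {R : realType} (d : nat) (m : nat).
Local Notation n := d.+2.
Local Notation lebn := (lebesgue_rV R n).
Local Notation i0 := (i0 d).
Local Notation i1 := (i1 d).
Variables (lev : nat -> seq (phase R)) (amp lip : nat -> R).
Hypothesis H : level_system lev amp lip.
Local Notation phi := (@phi R d lev).
Local Notation phi_inv := (@phi_inv R d lev).
Local Notation phases := (phases lev).
Implicit Types (x y : 'rV[R]_n) (t : R).

Lemma center_coord_gap i k : i != k -> 2 <= `|center_coord k - center_coord i| :> R.
Proof.
have s2 : 0 < Num.sqrt 2 :> R by rewrite sqrtr_gt0.
have s3 : Num.sqrt 2 <= 2 :> R.
  by rewrite -[leRHS]ger0_norm// -sqrtr_sqr ler_wsqrtr//; lra.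
have lt i' k' : (i' < k')%N -> 2 <= center_coord k' - center_coord i' :> R.
  rewrite -(ler_nat R) -natr1 => ik; rewrite /center_coord -mulrBl ler_pdivlMr// /shell_radius.
  by move: ik s2 s3; move: (Num.sqrt 2) (i'%:R) (k'%:R) => a b c; nra.
move=> ik; have [h|h|h] := ltngtP i k; last by rewrite h eqxx in ik.
  by rewrite (le_trans (lt _ _ h))// ler_norm.
by rewrite distrC (le_trans (lt _ _ h))// ler_norm.
Qed.

Lemma far_near_center i k x : i != k -> enorm (x - center d k) <= 1 / 2 -> far i x.
Proof.
move=> ik xk; have g := center_coord_gap ik.
have B (j : 'I_n) : (j < 2)%N -> 1 / 2 <= `|x 0 j - center_coord i|.
  move=> j2; have := coord_le_enorm (x - center d k) j.
  rewrite mxE [X in _ + X]mxE center_coordE// => h.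
  have := ler_normB (x 0 j - center_coord i) (x 0 j - center_coord k).
  have -> : x 0 j - center_coord i - (x 0 j - center_coord k) = center_coord k - center_coord i by ring.
  move: g h xk; move: `|_| `|_| `|_| (enorm _) => a b c e; lra.
by split; exact: B.
Qed.

Lemma near_after_flow k t x : enorm (x - center d k) <= 1 / 8 ->
  enorm (flow (lev k) t x - center d k) <= 1 / 4.
Proof.
move=> xk; have h := level_flow_disp H k t x.
rewrite -[X in enorm X](subrKA x) (le_trans (enormD _ _))//.
have e : 2 ^- k.+4 <= 1 / 8 :> R.
  rewrite div1r lef_pV2 ?posrE ?exprn_gt0// -natrX -[leLHS]/(2 ^ 3)%:R ler_nat.
  by rewrite leq_exp2l; lia.
move: h e xk; move: (enorm _) (enorm _) (2 ^- _) => a b c; lra.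
Qed.

(** On the diagonal the strips of different levels are well separated: the other levels fix points
    within 1/2 of the k-th centre, and level k does not move the point out of that ball. *)
Lemma phi_near_center k t x : enorm (x - center d k) <= 1 / 8 ->
  phi t x = flow (lev k) t x.
Proof.
move=> xk; have xk2 : enorm (x - center d k) <= 1 / 2 by rewrite (le_trans xk)//; lra.
have yk2 : enorm (flow (lev k) t x - center d k) <= 1 / 2.
  by rewrite (le_trans (near_after_flow t xk))//; lra.
have low K y : (K <= k)%N -> enorm (y - center d k) <= 1 / 2 -> flow (phases K) t y = y.
  elim: K y => //= K IH y Kk yk.
  by rewrite flow_cat (far_flow H) ?IH// ?(ltnW Kk)//; apply: (far_near_center _ yk); lia.
have high j : flow (phases (j + k.+1)) t x = flow (phases k.+1) t x.
  elim: j => // j IH; rewrite addSn /= flow_cat (far_flow H) -?IH//.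
  by apply: (far_near_center _ xk2); lia.
rewrite (phiE H (K := (space_bound x + k.+1)%N)).
  by rewrite high /= flow_cat low.
by rewrite (le_trans (space_boundP x))// ler_nat leq_addr.
Qed.

Definition moved_piece t k x : R := datum_piece m k (flow_inv (lev k) t x).

Lemma moved_piece_near t k x : moved_piece t k x != 0 -> enorm (x - center d k) <= 1 / 4.
Proof.
move=> /datum_piece_enorm xk; have := near_after_flow t xk.
by rewrite flow_invK.
Qed.

Lemma annular_moved_piece t : annular (moved_piece t).
Proof.
move=> k x /moved_piece_near xk; rewrite -(enorm_center d).
by rewrite (le_lt_trans (enorm_dist _ _))// (le_lt_trans xk)//; lra.
Qed.

Lemma datum_phi_inv t x : datum m (phi_inv t x) = annular_sum (moved_piece t) x.
Proof.
have [[k Fk]|F0] := pselect (exists k, datum_piece m k (phi_inv t x) != 0).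
  have E : flow_inv (lev k) t x = phi_inv t x.
    have := phi_near_center t (datum_piece_enorm Fk); rewrite (phi_invK H) => h.
    by rewrite -[RHS](flowK (lev k) t) -h.
  have Pk : moved_piece t k x != 0 by rewrite /moved_piece E.
  rewrite /datum (annular_sum_single (@annular_datum R d m) Fk).
  by rewrite (annular_sum_single (annular_moved_piece (t := t)) Pk) /moved_piece E.
rewrite /datum /annular_sum !big1// => k _; apply/eqP/negPn/negP => Pk; last first.
  by apply: F0; exists k.
move: (nat_of_ord k) Pk => {k} k Pk.
apply: F0; exists k; have := phi_near_center t (datum_piece_enorm Pk).
by rewrite flow_invK => <-; rewrite (phiK H).
Qed.

Lemma continuous_moved_piece t k : continuous (moved_piece t k).
Proof.
apply: (@continuous_composition _ _ _ (flow_inv (lev k) t)).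
  by apply: continuous_flow_inv => p; exact: (level_regular H).
exact: continuous_datum_piece.
Qed.

Lemma intg_moved_piece t k : lebn.-integrable setT (EFin \o moved_piece t k).
Proof.
apply: (integrable_scaling ler01 _ (intg_datum_piece d m k)).
by apply: flow_inv_scaling => p; exact: (level_regular H).
Qed.

Lemma moved_piece_bounded t k x : `|moved_piece t k x| <= 1.
Proof. by rewrite ger0_norm ?datum_piece_ge0 ?datum_piece_le1. Qed.

(** The moved pieces remain farther apart than the shift, so at every point the increment of one
    piece is either 0 or the increment of the whole truncated sum; [sobolev_translation] then gives
    one constant for all k. *)
Lemma variation_moved_piece t s : 0 < s ->
  sobolev s (fun x => datum m (phi_inv t x)) ->
  exists2 C, 0 <= C & forall k z, enorm z <= 1 / 8 ->
    variation z (moved_piece t k) <= C * (enorm z ^+ 2) `^ Num.min s 1.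
Proof.
move=> s0; have -> : (fun x => datum m (phi_inv t x)) = annular_sum (moved_piece t).
  by apply/funext => x; exact: datum_phi_inv.
have aP := annular_moved_piece (t := t).
have E j : (fun x => if enorm x <= j%:R then annular_sum (moved_piece t) x else 0) =
    (fun x => \sum_(k < (j.-1 %/ 4)%N) moved_piece t k x).
  by apply/funext => x; exact: annular_sum_trunc.
move=> sob; have [|||C C0 HC] := @sobolev_translation _ _ _ 1 _ _ _ s s0 sob.
- by move=> j; rewrite E; apply: continuous_fsum => k; exact: continuous_moved_piece.
- by move=> j; rewrite E; apply: intg_sum => k; exact: intg_moved_piece.
- exact: (annular_sum_bounded ler01 aP (moved_piece_bounded t)).
exists C => // k z zs; apply: HC.
  exact: (intg_measurable (intg_increment (intg_moved_piece t k) z)).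
(* From this radius on the ball contains the k-th piece, whose annulus ends at 4k + 5. *)
exists (4 * k + 5)%N => // j /= jk x.
have kj : (k < j.-1 %/ 4)%N by rewrite leq_divRL//; lia.
have S y : (forall i, i != k -> moved_piece t i y = 0) ->
    (if enorm y <= j%:R then annular_sum (moved_piece t) y else 0) = moved_piece t k y.
  move=> y0; rewrite (annular_sum_trunc _ _ aP) (bigD1 (Ordinal kj))//= big1 ?addr0// => i ik.
  by apply: y0; apply: contra ik => /eqP ik; apply/eqP/val_inj.
have [N0|N0] := boolP ((moved_piece t k x != 0) || (moved_piece t k (x + z) != 0)); last first.
  by move: N0; rewrite negb_or !negbK => /andP[/eqP -> /eqP ->]; rewrite subrr normr0.
have other y : y = x \/ y = x + z -> forall i, i != k -> moved_piece t i y = 0.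
  move=> yE i ik; apply/eqP/negPn/negP => /moved_piece_near yi.
  have yk : enorm (y - center d k) <= 1 / 4 + 1 / 8.
    have near_z (a b : 'rV[R]_n) : enorm (a - center d k) <= 1 / 4 -> enorm (b - a) <= 1 / 8 ->
        enorm (b - center d k) <= 1 / 4 + 1 / 8.
      move=> h1 h2; rewrite -[X in enorm X](subrKA a) (le_trans (enormD _ _))// addrC lerD//.
    have z0 : enorm (x + z - x) <= 1 / 8 by rewrite addrAC subrr add0r.
    have z1 : enorm (x - (x + z)) <= 1 / 8 by rewrite enormB.
    have z2 (a : 'rV[R]_n) : enorm (a - a) <= 1 / 8 by rewrite subrr enorm0 divr_ge0.
    by case/orP : N0 => /moved_piece_near h; case: yE => ->; exact: near_z h _.
  have : `|enorm (center d k : 'rV[R]_n) - enorm (center d i : 'rV[R]_n)| <= 1 / 4 + (1 / 4 + 1 / 8).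
    rewrite (le_trans (enorm_dist _ _))// -[X in enorm X](subrKA y) (le_trans (enormD _ _))//.
    by rewrite addrC lerD// enormB.
  rewrite !enorm_center /shell_radius => h.
  have lt i' k' : (i' < k')%N -> 1 <= k'%:R - i'%:R :> R.
    by rewrite -(ler_nat R) -natr1; lra.
  have [e|e|e] := ltngtP i k; last by rewrite e eqxx in ik.
    by have := lt _ _ e; move: h; rewrite ler_norml => /andP[]; lra.
  by have := lt _ _ e; move: h; rewrite ler_norml => /andP[]; lra.
by rewrite (S x (other x (or_introl erefl))) (S _ (other _ (or_intror erefl))).
Qed.

End pieces.

Section bump_mass.
Context {R : realType} (d m : nat).
Local Notation n := d.+2.
Local Notation leb := (@lebesgue_measure R).
Local Notation lebn := (lebesgue_rV R n).

Lemma intg_cos_bump_sqr : leb.-integrable setT (EFin \o (fun t => cos_bump (bump_freq d) m.+1 t ^+ 2)).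
Proof.
have I := @intg_cos_bump R (bump_freq d) (bump_freq_gt0 d) m.
apply: (intg_mulb I (intg_measurable I) (B := 1)) => t.
by rewrite ger0_norm ?cos_bump_ge0 ?cos_bump_le1.
Qed.

Lemma Rint_cos_bump_sqr_gt0 : 0 < \int[leb]_t (cos_bump (bump_freq d) m.+1 t ^+ 2).
Proof.
set q := cos_bump _ _.
have q0 : q 0 = 1.
  rewrite /q /cos_bump bump_clamp_id ?mul0r ?cos0 ?expr1n// normr0 ltW//.
  by apply: bump_width_gt0; exact: bump_freq_gt0.
have := @continuous_cos_bump R (bump_freq d) m.+1 0.
move=> /cvgrPdist_le /(_ (1 / 2)) []; first by rewrite divr_gt0.
move=> e /= e0 He; pose J : set (measurableTypeR R) := `[0, e / 2]%classic.
have mJ : measurable J by exact: measurable_itv.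
have IJ : leb.-integrable setT (EFin \o (\1_J : _ -> R)) by exact: integrable_indic_itv.
have : \int[leb]_t (4^-1 * \1_J t) <= \int[leb]_t (q t ^+ 2).
  apply: Rint_le; [exact: intgZ|exact: intg_cos_bump_sqr|move=> t].
  rewrite indicE; case: (boolP (t \in J)) => [|_]; last by rewrite mulr0 sqr_ge0.
  rewrite inE /J /= in_itv /= mulr1 => /andP[t0 t1].
  have := He t; rewrite /= sub0r normrN ger0_norm// -/q q0 => /(_ _) h.
  have {}h : `|1 - q t| <= 1 / 2 by apply: h; lra.
  have : 1 / 2 <= q t by move: h; rewrite ler_norml => /andP[]; lra.
  by move: (q t) => a; nra.
apply: lt_le_trans; rewrite RintegralZl// mulr_gt0//.
rewrite /Rintegral integral_indic// setIT /J /= lebesgue_measure_itv /= lte_fin.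
by rewrite ifT /= ?oppr0 ?addr0 //= divr_gt0.
Qed.

Definition bump_mass : R := \int[lebn]_x (bump m x ^+ 2).

Lemma bump_mass_gt0 : 0 < bump_mass.
Proof.
have -> : bump_mass = (\int[leb]_t (cos_bump (bump_freq d) m.+1 t ^+ 2)) ^+ n.
  rewrite -(Rint_rVprod n intg_cos_bump_sqr); apply: eq_Rintegral => x _.
  by apply/esym; exact: prodrXl.
by rewrite exprn_gt0// Rint_cos_bump_sqr_gt0.
Qed.

Lemma Rint_datum_piece_sqr k :
  \int[lebn]_x (datum_piece m k x ^+ 2) = bump_mass / 4 ^+ k.
Proof.
have st := translation_scaling (- center d k : 'rV[R]_n).
have I2 : lebn.-integrable setT (EFin \o (fun x : 'rV[R]_n => bump m x ^+ 2)).
  by apply: (intg_sqr (intg_bump d m) (B := 1)) => x; rewrite ger0_norm ?bump_ge0 ?bump_le1.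
transitivity (\int[lebn]_x ((4 ^+ k)^-1 * bump m (x - center d k) ^+ 2)).
  apply: eq_Rintegral => x _; rewrite /datum_piece expr_div_n -exprM mulnC exprM.
  by rewrite (_ : 2 ^+ 2 = 4) 1?mulrC// -natrX.
rewrite RintegralZl//; last exact: (integrable_scaling ler01 st I2).
by rewrite (Rintegral_scaling ler01 st I2) mul1r mulrC.
Qed.

End bump_mass.

Section shift_bounds.
Context {R : realType} (r M : R) (L : nat).

Lemma shift_upper : 0 <= r <= 1 -> 1 <= M -> r / 4 / (M + 1) ^+ L <= (4 * M ^+ L)^-1.
Proof.
move=> /andP[r0 r1] M1; have M0 := le_trans ler01 M1.
have p : 0 < M ^+ L by rewrite exprn_gt0// (lt_le_trans ltr01).
have q : 0 < (M + 1) ^+ L by rewrite exprn_gt0// ltr_wpDl.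
have pq : M ^+ L <= (M + 1) ^+ L by rewrite lerXn2r ?nnegrE ?addr_ge0 ?lerDl.
rewrite invfM -mulrA; apply: (@le_trans _ _ (1 * (4^-1 / (M + 1) ^+ L))).
  by rewrite ler_wpM2r// mulr_ge0// invr_ge0 ltW.
by rewrite mul1r ler_wpM2l// lef_pV2.
Qed.

(** The upper and lower bounds on the amplified shift differ by the factor (M / (M + 1))^L >= 2^-L
    whatever the slope. Together with r >= 4^-L, the amplified shift is thus bounded below
    independently of k. *)
Lemma shift_lower : (4 ^+ L)^-1 <= r -> 1 <= M ->
  (4 * 8 ^+ L)^-1 <= r / 4 / (M + 1) ^+ L * M ^+ L.
Proof.
move=> rL M1; have M0 := le_trans ler01 M1.
have M2 : 0 < M + 1 by rewrite ltr_wpDl.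
have c : (2^-1) ^+ L <= (M / (M + 1)) ^+ L.
  have h : 2^-1 <= M / (M + 1) by rewrite ler_pdivlMr//; lra.
  by rewrite lerXn2r ?nnegrE ?(le_trans _ h).
have -> : r / 4 / (M + 1) ^+ L * M ^+ L = r / 4 * (M / (M + 1)) ^+ L.
  by rewrite expr_div_n mulrAC mulrA.
have -> : (4 * 8 ^+ L)^-1 = (4 ^+ L)^-1 / 4 * (2^-1) ^+ L :> R.
  have -> : (8 : R) = 4 * 2 by rewrite -natrM.
  by rewrite exprMn exprVn !invfM; ring.
by apply: ler_pM => //; rewrite ?exprn_ge0 ?ler_wpM2r.
Qed.

End shift_bounds.

Section contradiction.
Context {R : realType} (L : nat).

Lemma pow2_shift : 2 ^+ (3 * L + 2) = 4 * 8 ^+ L :> R.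
Proof.
rewrite exprD exprM mulrC (_ : 2 ^+ 2 = 4 :> R); last by rewrite -natrX.
by rewrite (_ : 2 ^+ 3 = 8 :> R)// -natrX.
Qed.

Lemma pow4_shift : 4 ^+ (3 * L + 2) = 16 * (4 ^+ L) ^+ 3 :> R.
Proof.
rewrite exprD (mulnC 3%N) exprM mulrC (_ : 4 ^+ 2 = 16 :> R)//.
by rewrite -natrX.
Qed.

Lemma sqr_shift_le (K : nat) (a : R) : 0 <= a -> a <= (4 * (4 ^+ K) ^+ L)^-1 ->
  2 * a ^+ 2 <= (4 ^+ (2 * K * L))^-1.
Proof.
move=> a0 h; apply: (@le_trans _ _ (2 * ((4 * (4 ^+ K) ^+ L)^-1) ^+ 2)).
  by rewrite ler_wpM2l// lerXn2r ?nnegrE ?(le_trans a0).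
have -> : (2 * K * L = K * L * 2)%N by rewrite -mulnA mulnC.
rewrite exprVn exprMn -!exprM invfM mulrA ler_piMl ?invr_ge0 ?exprn_ge0//.
by rewrite ler_pdivrMr ?exprn_gt0// mul1r -natrX ler_nat.
Qed.

(** The lower bound loses 4^L to the selection of translates, 4^(3L+2) to the doublings and 4^K to
    the squared amplitude. The upper bound is at most C * 4^(-6L), as K s >= 3. Comparing them gives
    mass * 16^L <= 8 C * 4^K, and L >= K turns this into mass * 4^K <= 8 C. *)
Lemma growth_contradiction (K : nat) (mass C s V e : R) : 0 < mass -> 0 <= C -> 0 < s ->
  3 <= K%:R * s -> (K <= L)%N -> 8 * C / mass < 4 ^+ K ->
  0 <= e <= (4 ^+ (2 * K * L))^-1 -> 2 * (mass / 4 ^+ K) <= 4 ^+ (3 * L + 2) * V ->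
  (4 ^+ L)^-1 * V <= C * e `^ s -> False.
Proof.
move=> mass0 C0 s0 k2 KL k3 /andP[e0 zn] Low Up.
have pw : e `^ s <= (4 ^+ (6 * L))^-1.
  apply: (@le_trans _ _ ((4 ^+ (2 * K * L))^-1 `^ s)).
    by apply: ge0_ler_powR; rewrite ?nnegrE ?(ltW s0) ?invr_ge0 ?exprn_ge0.
  rewrite -!powR_mulrn// -!powRN -powRrM ler_powR ?ler1n// mulNr lerN2 !natrM.
  have := ler_wpM2r (ler0n R L) k2; move: (K%:R) (L%:R) => a b; lra.
have a0 : 0 < 4 ^+ K :> R by rewrite exprn_gt0.
have b0 : 0 < 4 ^+ L :> R by rewrite exprn_gt0.
have ab : 4 ^+ K <= 4 ^+ L :> R by rewrite ler_weXn2l ?ler1n.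
have {}Up := le_trans Up (ler_wpM2l C0 pw).
move: Up Low k3; rewrite pow4_shift mulnC exprM.
move: (4 ^+ K) (4 ^+ L) a0 b0 ab => a b a0 b0 ab.
rewrite ler_pdivrMl// ltr_pdivrMr// => Up Low k3.
have Q : 2 * mass / a <= 16 * b ^+ 3 * (b * (C / b ^+ 6)).
  by rewrite -mulrA (le_trans Low)// ler_wpM2l// mulr_ge0// exprn_ge0// ltW.
have E : 16 * b ^+ 3 * (b * (C / b ^+ 6)) = 16 * C / b ^+ 2.
  by field; rewrite gt_eqF.
move: Q; rewrite E ler_pdivrMr// mulrAC ler_pdivlMr ?exprn_gt0// => Q.
have Q2 : mass * b ^+ 2 <= 8 * C * a by move: Q; lra.
have Q3 : mass * a ^+ 2 <= 8 * C * a.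
  by rewrite (le_trans _ Q2)// ler_wpM2l ?(ltW mass0)// lerXn2r ?nnegrE// ltW.
move: Q3; rewrite expr2 mulrA ler_pM2r// leNgt => /negP; apply.
by rewrite (mulrC mass).
Qed.

End contradiction.

Section growth.
Context {R : realType} (d : nat) (Theta : R -> R) (m : nat).
Local Notation n := d.+2.
Local Notation lebn := (lebesgue_rV R n).
Local Notation i0 := (i0 d).
Hypothesis adm : admissible_growth Theta.
Local Notation lev := (levels d m adm).
Local Notation Lk k := (level_count d m adm k).
Local Notation shift k := (shift_size k (Lk k) : R).

Lemma shift_size_gt0 k : 0 < shift k.
Proof.
rewrite /shift_size !divr_gt0 ?tooth_size_gt0// exprn_gt0// ltr_wpDl//.
Qed.

Lemma shift_size_le k : shift k <= (4 * (4 ^+ k) ^+ Lk k)^-1.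
Proof.
have [ok _ _ _ _] := levels_good d m adm k.
rewrite /shift_size; apply: shift_upper; last exact: pow4_ge1.
by rewrite (ltW (tooth_size_gt0 _)) (le_trans (tooth_size_small ok))//; lra.
Qed.

Lemma shift_size_ge k : (4 * 8 ^+ Lk k)^-1 <= shift k * (4 ^+ k) ^+ Lk k.
Proof.
rewrite /shift_size; apply: shift_lower; first exact: tooth_size_ge.
exact: pow4_ge1.
Qed.

Lemma plane_diag_enorm (a : R) : enorm (plane_vec d (a, a)) ^+ 2 = 2 * a ^+ 2.
Proof.
rewrite enorm_sqr (@sum_two d) => [|i /negbTE a0 /negbTE a1].
  by rewrite (plane_vec0 d (a, a)) (plane_vec1 d (a, a)) /=; ring.
by rewrite !mxE a0 a1 !mulr0 addr0 expr0n.
Qed.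

Lemma plane_shift_coord (x : 'rV[R]_n) (q : R) (ab : R * R) :
  (x + q *: plane_vec d ab) 0 i0 = x 0 i0 + q * ab.1.
Proof. by rewrite mxE; congr (_ + _); rewrite mxE plane_vec0. Qed.

(** The 3L + 2 doublings multiply the shift by 4 * 8^L, which makes its first component at least 1,
    whereas the piece has width at most 1/8 in that coordinate. The enlarged translate is thus
    disjoint from the piece, and the variation is twice the squared L^2 norm. *)
Lemma initial_variation k :
  2 * (bump_mass d m / 4 ^+ k) <= 4 ^+ (3 * Lk k + 2) *
    variation (plane_vec d (back_shift (4 ^+ k) (shift k) (Lk k) true)) (datum_piece m k).
Proof.
set ab := back_shift _ _ _ _.
have b1 (x : 'rV[R]_n) : `|datum_piece m k x| <= 1.
  by rewrite ger0_norm ?datum_piece_ge0 ?datum_piece_le1.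
have Id := @intg_datum_piece R d m k.
rewrite -Rint_datum_piece_sqr -(@variation_disjoint _ _ _ _ Id b1 (2 ^+ (3 * Lk k + 2) *: plane_vec d ab)).
  exact: (variation_pow2 Id b1).
move=> x; apply/eqP; apply: contraT; rewrite mulf_eq0 negb_or => /andP[h1 h2].
have [a1 _] := datum_piece_coord h1; have [a2 _] := datum_piece_coord h2.
have [_ _ g] := back_shift_bounds (pow4_ge1 (R := R) k) (ltW (shift_size_gt0 k)) (Lk k) true.
have S := le_trans (shift_size_ge k) g.
have P : 1 <= 2 ^+ (3 * Lk k + 2) * ab.1.
  have -> : 2 ^+ (3 * Lk k + 2) = 4 * 8 ^+ Lk k :> R.
    exact: pow2_shift.
  by rewrite -ler_pdivrMl ?mulr_gt0 ?exprn_gt0// mulr1.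
move: a1 a2 P; rewrite plane_shift_coord; move: ab.1 (2 ^+ _) (x 0 i0) (center_coord k) => e q y c.
rewrite !ler_norml => /andP[_ a1] /andP[a2 _]; have : y + q * e - c - (y - c) = q * e by clear; ring.
by move: a1 a2; clear => a1 a2 E P; exfalso; move: (q * e) a1 a2 E P => w; lra.
Qed.

Lemma no_sobolev t s : 0 < t -> 0 < s ->
  ~ sobolev s (fun x : 'rV[R]_n => datum m (phi_inv lev t x)).
Proof.
move=> t0 s0 sob.
have [C C0 HC] := variation_moved_piece (levels_system d m adm) s0 sob.
pose s1 := Num.min s 1; have s10 : 0 < s1 by rewrite lt_min s0 ltr01.
have mass := bump_mass_gt0 (R := R) d m.
(* The three summands ensure that level K is over by time t, that K * s1 >= 3, and that 4^K exceeds
   the constant of the contradiction. *)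
pose K := ((Num.truncn t^-1).+1 + (Num.truncn (3 / s1)).+1 + (Num.truncn (8 * C / bump_mass d m)).+1)%N.
have k1 : 2 ^- K <= t.
  rewrite (le_trans _ (time_boundP t0))// lef_pV2 ?posrE ?exprn_gt0//.
  by rewrite ler_weXn2l ?ler1n// /time_bound /K -addnA leq_addr.
have k2 : 3 <= K%:R * s1.
  rewrite -ler_pdivrMr// (le_trans (ltW (truncnS_gt _)))// ler_nat /K addnAC.
  by rewrite leq_addl.
have k3 : 8 * C / bump_mass d m < 4 ^+ K.
  apply: (lt_le_trans (truncnS_gt _)); rewrite -natrX ler_nat.
  apply: (@leq_trans K); first by rewrite /K leq_addl.
  by rewrite ltnW// ltn_expl.
clearbody K.
have [[L5 KL _ _] _ _ _ V] := levels_good d m adm K.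
pose z : 'rV[R]_n := plane_vec d (shift K, shift K).
have zn : enorm z ^+ 2 <= (4 ^+ (2 * K * Lk K))^-1.
  rewrite plane_diag_enorm; apply: sqr_shift_le; last exact: shift_size_le.
  exact: ltW (shift_size_gt0 K).
have z8 : enorm z <= 1 / 8.
  rewrite -ler_sqr ?nnegrE ?enorm_ge0 ?divr_ge0// (le_trans zn)//.
  rewrite expr_div_n expr1n div1r lef_pV2 ?posrE ?exprn_gt0// -!natrX ler_nat.
  rewrite (_ : 8 ^ 2 = 4 ^ 3)%N// leq_exp2l//.
  have K1 : (0 < K)%N by rewrite lt0n; apply: contraTN k2 => /eqP ->; rewrite mul0r -ltNge.
  by move: (Lk K) L5 => L L5; nia.
have E : moved_piece m lev t K = (fun x : 'rV[R]_n => datum_piece m K (full_inv (lev K) x)).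
  by apply/funext => x; rewrite /moved_piece full_invE.
have U := HC K z z8; rewrite E in U.
apply: (growth_contradiction mass C0 s10 k2 KL k3 _ (initial_variation K) (le_trans V U)).
by rewrite sqr_ge0 zn.
Qed.

End growth.

Theorem theorem1 (R : realType) (d : nat) (sigma : R) (Theta : R -> R)
    (d_ge2 : (2 <= d)%N) (sigma_gt0 : 0 < sigma) (sigma_lt : sigma < d%:R / 2)
    (admTheta : admissible_growth Theta) :
  exists (u : R -> 'rV[R]_d -> 'rV[R]_d) (theta0 : 'rV[R]_d -> R),
    [/\ measurable_field u,
        divergence_free u,
        has_modulus (phi_modulus Theta) u &
        sobolev sigma theta0] /\
    (exists theta, transport_solution u theta0 theta) /\
    (forall theta, transport_solution u theta0 theta ->
       forall t s, 0 < t -> 0 < s -> ~ sobolev s (theta t)).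
Proof.
case: d d_ge2 sigma_lt => [|[|d]]// _ _.
have [m sob] := sobolev_datum d sigma_gt0.
have H := levels_system d m admTheta.
exists (@u R d (levels d m admTheta)), (datum m); split; last split.
- split => //.
  + exact: measurable_field_u H.
  + exact: divergence_free_u H.
  + exact: levels_modulus.
- exists (theta (levels d m admTheta) (datum m)); split.
    exact: theta_weak_solution H _ (intg_datum d m).
  exists (phi (levels d m admTheta)), (phi_inv (levels d m admTheta)); split.
    exact: phi_is_flow H.
  by move=> t t0; split => //; [exact: phiK H _|exact: phi_invK H _].
(* An arbitrary solution comes with its own flow, which [flow_unique] identifies with [phi]; the
   inverses then agree, and so do the solutions. *)
- move=> th [_ [psi [psi_inv [flow_psi inv_psi]]]] t s t0 s0.
  have [c1 c2 E] := inv_psi t (ltW t0).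
  suff -> : th t = (fun x => datum m (phi_inv (levels d m admTheta) t x)).
    exact: no_sobolev.
  apply/funext => x; rewrite E; congr datum.
  rewrite -{2}(c2 x) (flow_unique H flow_psi _ (ltW t0)).
  by rewrite (phiK H).
Qed.
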